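(* Let $j,k,n,m\ge 1$ be integers, let $\Omega\subseteq\mathbb{C}$ be open, and let $A(x)$ be an $n\times n$ complex matrix depending on $x=(x_1,\dots,x_j)\in\mathbb{R}^j$. Assume that $A$ is $k$ times differentiable at $\bar{x}=(\bar{x}_1,\dots,\bar{x}_j)$ and that $A(x)\in M_n(\Omega,m)$ for all $x$ in some neighborhood of $\bar{x}$. Let $f$ be $(k+1)m-1$ times continuously differentiable on $\Omega$, and let $\alpha$ be a multi-index (in $j$ variables) with $1\le|\alpha|\le k$. Then $$\partial^\alpha f(A(x))|_{x=\bar{x}}=\sum_{i=1}^{|\alpha|}\ \sum_{s\in S_\alpha^i} L_f^{(i)}\big(A(\bar{x}),A^{(s_1)}(\bar{x}),\dots,A^{(s_i)}(\bar{x})\big),$$ where the inner sum is over the members $s=\{s_1,\dots,s_i\}$ of the multi-set $S_\alpha^i$, counted with multiplicity.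
   Context: For an open set $\Omega\subseteq\mathbb{C}$, $M_n(\Omega,m)$ denotes the set of $n\times n$ complex matrices whose spectrum is contained in $\Omega$ and whose largest Jordan block has size at most $m$. For a scalar function $f:\Omega\to\mathbb{C}$ (differentiability on $\Omega$ is with respect to the complex variable), $f(A)$ denotes the matrix function in the standard sense, defined through the Jordan canonical form (equivalently Hermite interpolation) of $A$. ''$k$ times differentiable at $\bar{x}$'' is in the usual sense for functions of several real variables. $A^{(\alpha)}(\bar{x})=\partial^\alpha A(x)|_{x=\bar{x}}$. The Fréchet derivative $L_f(A,E)=L_f^{(1)}(A,E)$ is the unique mapping, linear in $E$, with $L_f(A,E)=f(A+E)-f(A)+o(\|E\|)$. For $i>1$, the $i$th Fréchet derivative $L_f^{(i)}(A_0,E_1,\dots,E_i)$ is the mapping, linear in each of $E_1,\dots,E_i$, that satisfies $$L_f^{(i)}(A_0,E_1,\dots,E_i)=L_f^{(i-1)}(A_0+E_i,E_1,\dots,E_{i-1})-L_f^{(i-1)}(A_0,E_1,\dots,E_{i-1})+o(\|E_i\|).$$ For a multi-index $\alpha$ with $|\alpha|\ge 1$, the multi-set $S_\alpha^k$ of partitions of $\alpha$ into $k$ nonzero multi-indices (each partition being itself a multi-set, i.e. order does not matter) is defined recursively: $S_\alpha^0=\emptyset$; $S_\alpha^1$ has the single member $\{\alpha\}$; $S_\alpha^k=\emptyset$ for $k>|\alpha|$; and for $1<k\le|\alpha|$, write $\alpha=\beta+\gamma$ with $|\gamma|=1$, and let $S_\alpha^k$ consist of (i) one member $\{u_1,\dots,u_{k-1},\gamma\}$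 for each $u=\{u_1,\dots,u_{k-1}\}\in S_\beta^{k-1}$, and (ii) the $k$ members $\{u_1,\dots,u_l+\gamma,\dots,u_k\}$, $l=1,\dots,k$, for each $u=\{u_1,\dots,u_k\}\in S_\beta^k$. Duplicates are kept (multi-set). Example: $S_{(2,1)}^2$ consists of $\{(2,0),(0,1)\}$ once and $\{(1,1),(1,0)\}$ twice. *)

(* Defs.v *)
From HB Require Import structures.
From mathcomp Require Import all_boot all_order all_algebra.
From mathcomp Require Import complex.
From mathcomp Require Import all_classical all_reals all_analysis.

Set Implicit Arguments.
Unset Strict Implicit.
Unset Printing Implicit Defensive.

Import Order.TTheory GRing.Theory Num.Theory.
Import numFieldNormedType.Exports.

Local Open Scope classical_set_scope.
Local Open Scope ring_scope.
Local Open Scope complex_scope.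

(* R[i] carries the topology and norm that every numFieldType has over itself,
   so [derive1] of a function R[i] -> R[i] is its complex derivative. *)
HB.instance Definition _ (R : realType) := NormedModule.copy R[i] (R[i]^o).

Section Differentiation.
Context {K : numFieldType} {V W : normedModType K}.

(* For k > 1: F is differentiable near x and its derivative is k-1 times
   differentiable at x.  The derivative takes its values in linear maps, so it
   is differentiated through its evaluations at fixed directions v. *)
Fixpoint diff_times (k : nat) (F : V -> W) (x : V) : Prop :=
  match k with
  | 0 => True
  | 1 => differentiable F x
  | (_.+1 as k').+1 =>
      (\forall y \near x, differentiable F y) /\
      (forall v : V, diff_times k' (fun y => 'd F y v) x)
  end.

(* For Es = [:: E_1; ...; E_i], E_1 is the direction of the innermost
   derivative and E_i that of the outermost one: the i-th derivative is the
   differential at X, in the direction E_i, of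
   Y |-> frechet F Y [:: E_1; ...; E_(i-1)]. *)
Fixpoint frechet (F : V -> W) (X : V) (Es : seq V) : W :=
  if Es is E :: Es' then frechet (fun Y => 'd F Y E) X Es' else F X.

End Differentiation.

Section MultiIndices.
Context {j : nat}.

Definition multi_index := {ffun 'I_j -> nat}.

Implicit Types alpha beta : multi_index.

Definition mi_deg alpha : nat := (\sum_i alpha i)%N.
Definition mi_add alpha beta : multi_index := [ffun i => alpha i + beta i]%N.
Definition mi_sub alpha beta : multi_index := [ffun i => alpha i - beta i]%N.
Definition mi_unit (i : 'I_j) : multi_index := [ffun l => (l == i) : nat].

(* Multi-sets are represented by sequences.  In the decomposition
   alpha = beta + gamma, gamma is the unit multi-index of the first nonzero
   entry of alpha; the first argument N is fuel. *)
Fixpoint mi_partitions_rec (N : nat) alpha (k : nat) :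
    seq (seq multi_index) :=
  if k == 0%N then [::]
  else if k == 1%N then [:: [:: alpha]]
  else if (mi_deg alpha < k)%N then [::]
  else if N isn't N'.+1 then [::]
  else if [pick i | (0 < alpha i)%N] is Some i then
    let gamma := mi_unit i in
    let beta := mi_sub alpha gamma in
    [seq rcons u gamma | u <- mi_partitions_rec N' beta k.-1] ++
    flatten [seq [seq set_nth gamma u l (mi_add (nth gamma u l) gamma)
                     | l <- iota 0 k]
                | u <- mi_partitions_rec N' beta k]
  else [::].

Definition mi_partitions alpha k := mi_partitions_rec (mi_deg alpha) alpha k.

Definition pderive {R : realType} alpha (F : 'rV[R]_j -> R) : 'rV[R]_j -> R :=
  foldr (fun i G => iter (alpha i) (fun H x => 'D_(delta_mx 0 i) H x) G)
        F (enum 'I_j).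

End MultiIndices.
Arguments multi_index : clear implicits.

(* Differentiability and partial derivatives, with respect to a real vector
   variable, of a complex matrix: both are taken on the real and imaginary
   parts of the entries. *)
Definition mx_diff_times {R : realType} {j n : nat} (k : nat)
    (A : 'rV[R]_j -> 'M[R[i]]_n) (x : 'rV[R]_j) : Prop :=
  forall a b, diff_times k (fun y => complex.Re (A y a b)) x /\
              diff_times k (fun y => complex.Im (A y a b)) x.

Definition mx_pderive {R : realType} {j n : nat} (alpha : multi_index j)
    (A : 'rV[R]_j -> 'M[R[i]]_n) (x : 'rV[R]_j) : 'M[R[i]]_n :=
  \matrix_(a, b) (pderive alpha (fun y => complex.Re (A y a b)) x
                  +i* pderive alpha (fun y => complex.Im (A y a b)) x).

Section MatrixFunctions.
Context {R : realType}.
Local Notation C := (R[i]).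

Definition cont_diff_times_on (N : nat) (Omega : set C) (f : C -> C) : Prop :=
  (forall d z, (d < N)%N -> Omega z -> derivable (derive1n d f) z 1) /\
  (forall z, Omega z -> {for z, continuous (derive1n N f)}).

Definition jordan_block (s : nat) (lambda : C) : 'M[C]_s :=
  \matrix_(a, b) (if a == b then lambda
                  else if b == a.+1 :> nat then 1 else 0).

(* Q is the inverse of P; both are typed as rectangular matrices because the
   size \sum_i s i of the Jordan matrix is only propositionally equal to n. *)
Definition jordan_form (n : nat) (A : 'M[C]_n) (p : nat)
    (s : 'I_p -> nat) (lambda : 'I_p -> C)
    (P : 'M[C]_(n, \sum_i s i)) (Q : 'M[C]_(\sum_i s i, n)) : Prop :=
  [/\ forall i, (0 < s i)%N,
      P *m Q = 1%:M,
      Q *m P = 1%:M &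
      A = P *m (\mxdiag_i jordan_block (s i) (lambda i)) *m Q].

(* The set M_n(Omega, m). *)
Definition spectral_class (n : nat) (Omega : set C) (m : nat) : set 'M[C]_n :=
  [set A | (forall z, eigenvalue A z -> Omega z) /\
     exists p (s : 'I_p -> nat) (lambda : 'I_p -> C)
            (P : 'M[C]_(n, \sum_i s i)) (Q : 'M[C]_(\sum_i s i, n)),
       jordan_form A lambda P Q /\ forall i, (s i <= m)%N].

Definition fun_jordan_block (f : C -> C) (s : nat) (lambda : C) : 'M[C]_s :=
  \matrix_(a, b) (if (a <= b)%N
                  then derive1n (b - a) f lambda / ((b - a)`!)%:R else 0).

(* f(A): the value does not depend on the Jordan decomposition of A. *)
Definition matfun (f : C -> C) (n : nat) (A : 'M[C]_n) : 'M[C]_n :=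
  xget 0 [set B | exists p (s : 'I_p -> nat) (lambda : 'I_p -> C)
      (P : 'M[C]_(n, \sum_i s i)) (Q : 'M[C]_(\sum_i s i, n)),
    jordan_form A lambda P Q /\
    B = P *m (\mxdiag_i fun_jordan_block f (s i) (lambda i)) *m Q].

End MatrixFunctions.

(* Main.v *)
(* Being C^1 on Omega in the complex sense, f satisfies Cauchy's formula, which
   follows by differentiating under the integral sign along a homotopy of
   circles.  Hence f(X) is the sum, over the eigenvalues u of A(xbar), of the
   contour integrals of f(z) (z - X)^-1 along small circles around u, for every
   X near A(xbar) and whatever the Jordan structure of X.  The entries of this
   integrand belong to a class of parametrised families closed under
   differentiation in X, so X |-> f(X) has Frechet derivatives of all orders
   near A(xbar).  The formula then follows by induction on the degree of alpha:
   the product rule for y |-> L^(i)(A(y), E_1(y), ..., E_i(y)) produces the two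
   kinds of members of S_alpha^k out of those of S_beta^(k-1) and S_beta^k. *)
From HB Require Import structures.
Require Import Defs.
From mathcomp Require Import all_boot all_order all_algebra.
From mathcomp Require Import complex.
From mathcomp Require Import all_classical all_reals all_analysis.
From mathcomp Require Import zify ring lra.
Import Order.TTheory GRing.Theory Num.Theory.
Import numFieldNormedType.Exports.
Local Open Scope classical_set_scope.
Local Open Scope ring_scope.
Local Open Scope complex_scope.
Set Implicit Arguments.
Unset Strict Implicit.
Unset Printing Implicit Defensive.

(** * Differentiability over the reals and over the complex numbers *)

Section ComplexBasics.
Context {R : realType}.
Local Notation C := R[i].
Local Notation re := (@complex.Re R).
Local Notation im := (@complex.Im R).

(** Frechet derivatives probe every direction, so f(X) has to be controlled on a full neighbourhood
    of A(xbar), where the Jordan structure jumps from matrix to matrix. A formula read off a Jordan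
    form cannot be differentiated in X; an integral over circles fixed once and for all can. By
    Cramer's rule the entries of the resolvent are quotients of polynomials in the entries of X, so
    that only sums, products and inverses of nonvanishing functions have to be differentiated under
    the integral. Two scalar fields meet: x is a real vector, while the matrices form a space over
    [R[i]]. Their composition is handled by an estimate with a real increment and a complex value
    ([mixed_diff]), converted into statements on real and imaginary parts afterwards. No exchange of
    partial derivatives is ever made: gamma is the unit of the first nonzero entry of alpha and
    [pderive] applies the least index outermost, so the derivative along gamma always lands on the
    outside, for f(A(x)) as well as for each A^(u) with u a member of a partition of beta. *)

Lemma normc_i : `|'i%C : C| = 1.
Proof. by rewrite normc_def /= expr0n expr1n add0r sqrtr1. Qed.

Lemma normc_real (x : R) : `|x%:C| = `|x|%:C.
Proof. by rewrite normc_def /= expr0n addr0 sqrtr_sqr. Qed.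

Lemma normc_ge_Im (z : C) : `|im z|%:C <= `|z|.
Proof.
by have := normc_ge_Re (z * 'i); rewrite ReiNIm normrN normrM normc_i mulr1.
Qed.

Lemma normc_le_ReIm (z : C) :
  `|z| <= (`|re z| + `|im z|)%:C.
Proof.
rewrite [z in leLHS]complexE (le_trans (ler_normD _ _)) // rmorphD /= lerD //.
  by rewrite normc_real.
by rewrite normrM normc_i mul1r normc_real.
Qed.

Lemma gt0_complexP (e : C) : 0 < e -> exists2 r : R, 0 < r & e = r%:C.
Proof.
case: e => r s; rewrite ltcE /= => /andP[/eqP -> r0]; exists r => //.
Qed.

Lemma ge0_complexP (e : C) : 0 <= e -> exists2 r : R, 0 <= r & e = r%:C.
Proof.
case: e => r s; rewrite lecE /= => /andP[/eqP -> r0]; exists r => //.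
Qed.

Lemma complex_cvgP (T : Type) (F : set_system T) (FF : Filter F) (g : T -> C)
    (l : C) :
  g @ F --> l <-> (re \o g) @ F --> re l /\
                  (im \o g) @ F --> im l.
Proof.
split=> [/cvgrPdist_lt gl|[/cvgrPdist_lt gr /cvgrPdist_lt gi]].
  split; apply/cvgrPdist_lt => e e0; have e0' : 0 < e%:C :> C by rewrite ltcR.
    apply: filterS (gl _ e0') => t /(le_lt_trans (normc_ge_Re _)).
    by rewrite ltcR raddfB.
  apply: filterS (gl _ e0') => t /(le_lt_trans (normc_ge_Im _)).
  by rewrite ltcR raddfB.
apply/cvgrPdist_lt => _ /gt0_complexP[e e0 ->].
have e2 : 0 < e / 2 by rewrite divr_gt0.
apply: filterS2 (gr _ e2) (gi _ e2) => t /= tr ti.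
rewrite (le_lt_trans (normc_le_ReIm _)) // ltcR !raddfB /=.
by rewrite [ltRHS]splitr ltrD.
Qed.

Lemma continuous_complexP (T : topologicalType) (g : T -> C) (t : T) :
  {for t, continuous g} <-> {for t, continuous (re \o g)} /\
                            {for t, continuous (im \o g)}.
Proof. exact: complex_cvgP. Qed.

End ComplexBasics.

Section EpsilonDifferential.
Context {K : numFieldType} {V W : normedModType K}.
Implicit Types (f L : V -> W) (x : V).

Lemma diff_eps f x : differentiable f x -> forall e, 0 < e ->
  \forall h \near 0, `|f (x + h) - f x - 'd f x h| <= e * `|h|.
Proof.
move=> df e e0; have /eqaddoP/(_ e e0) := diff_locally df.
by apply: filterS => h /=; rewrite !fctE /= opprD addrA (addrC h).
Qed.

Lemma is_diff_eps f L x : linear L -> (exists k, forall h, `|L h| <= k * `|h|) ->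
  (forall e, 0 < e ->
     \forall h \near 0, `|f (x + h) - f x - L h| <= e * `|h|) ->
  is_diff x f L.
Proof.
move=> Llin [k Lk] fL.
pose glM := GRing.isLinear.Build _ _ _ _ _ Llin.
pose gL : {linear _ -> _} := HB.pack L glM.
have gLc : continuous gL.
  apply: bounded_linear_continuous; apply/ex_bound; exists `|k|.
  apply/nbhs_norm0P; exists 1 => //= h /ltW h1.
  apply: (le_trans (Lk h)).
  have [|h0] := real_le0P (normr_real h).
    by rewrite normr_le0 => /eqP ->; rewrite normr0 mulr0.
  (* [K] is only partially ordered, so [k] might fail to be real; it is real as soon as some [h] is
     nonzero, since [k * |h|] bounds a norm. *)
  have kr : k \is Num.real.
    have : 0 <= k * `|h| by rewrite (le_trans _ (Lk h)).
    by move=> /ger0_real; rewrite -[in k \is _](mulfK (lt0r_neq0 h0) k) => kh;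
        rewrite rpredM // rpredV ger0_real // ltW.
  rewrite (le_trans (ler_wpM2r (normr_ge0 h) (real_ler_norm kr))) //.
  by rewrite ler_piMr.
have fE : f \o shift x = cst (f x) + gL +o_ 0 id.
  apply/eqaddoP => e e0; apply: filterS (fL e e0) => h.
  by rewrite !fctE /= opprD addrA (addrC h).
have dE : 'd f x = L :> (_ -> _) := diff_unique gLc fE.
by apply: DiffDef => //; apply/diff_locallyP; rewrite dE.
Qed.

Lemma diff_lip f x : differentiable f x ->
  exists2 k, 0 < k & forall h, `|'d f x h| <= k * `|h|.
Proof. by move=> df; apply: linear_lipschitz; apply: diff_continuous. Qed.

End EpsilonDifferential.

Section MixedDifferential.
Context {R : realType} {U : normedModType R}.
Local Notation C := R[i].
Local Notation re := (@complex.Re R).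
Local Notation im := (@complex.Im R).

(* is_diff does not apply here, as U is a space over R and V one over R[i]. *)
Definition mixed_diff (V : normedModType C) (g : U -> V) (x : U) (L : U -> V) :=
  forall e : R, 0 < e ->
    \forall h \near 0, `|g (x + h) - g x - L h| <= (e * `|h|)%:C.

Lemma mixed_diff_cvg (V : normedModType C) (g : U -> V) x L k :
  (forall h, `|L h| <= (k * `|h|)%:C) -> mixed_diff g x L ->
  \forall h \near 0, `|g (x + h) - g x| <= ((1 + k) * `|h|)%:C.
Proof.
move=> Lk gL; apply: filterS (gL _ ltr01) => h gh.
rewrite -[g _ - _](subrK (L h)) (le_trans (ler_normD _ _)) //.
by rewrite mulrDl rmorphD lerD.
Qed.

(** [F] is linearised at the increment [g (x + h) - g x], which [mixed_diff_cvg] bounds by a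
    multiple of the norm of [h]; the remainder of [g] then passes through the bounded differential
    of [F]. Each part takes half of [e]. *)
Lemma mixed_diff_comp (V W : normedModType C) (F : V -> W) (g : U -> V) x L k :
  (forall h, `|L h| <= (k * `|h|)%:C) -> mixed_diff g x L ->
  differentiable F (g x) ->
  mixed_diff (F \o g) x ('d F (g x) \o L).
Proof.
move=> Lk gL dF e e0 /=.
have [kd kd0 dFk] := diff_lip dF.
have [kr kr0 kdE] := gt0_complexP kd0; rewrite {}kdE in dFk kd0.
pose k1 := 1 + `|k|.
have k10 : 0 < k1 by rewrite ltr_pwDl.
have Lk' h : `|L h| <= (`|k| * `|h|)%:C.
  by rewrite (le_trans (Lk h)) // lecR ler_wpM2r // ler_norm.
have e1 : 0 < e / 2 / kr by rewrite !divr_gt0.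
have e2 : 0 < (e / 2 / k1)%:C :> C by rewrite ltcR !divr_gt0.
have gc := mixed_diff_cvg Lk' gL.
have g0 : g (x + h) - g x @[h --> 0] --> 0.
  apply/cvgr0Pnorm_lt => _ /gt0_complexP[d d0 ->].
  have d1 : 0 < d / k1 by rewrite divr_gt0.
  near=> h; apply: (@le_lt_trans _ _ ((1 + `|k|) * `|h|)%:C); first by near: h.
  rewrite ltcR mulrC -ltr_pdivlMr //.
near=> h.
have -> : F (g (x + h)) - F (g x) - 'd F (g x) (L h) =
  (F (g x + (g (x + h) - g x)) - F (g x) - 'd F (g x) (g (x + h) - g x)) +
  'd F (g x) (g (x + h) - g x - L h).
  by rewrite [g x + _]addrC subrK (linearB _ (g (x + h) - g x)) addrA subrK.
rewrite (le_trans (ler_normD _ _)) // [e]splitr mulrDl rmorphD lerD //.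
  apply: (@le_trans _ _ ((e / 2 / k1)%:C * `|g (x + h) - g x|)).
    by near: h; apply: (g0 _ (diff_eps dF e2)).
  have : `|g (x + h) - g x| <= ((1 + `|k|) * `|h|)%:C by near: h.
  move=> /(ler_wpM2l (ltW e2)) /le_trans; apply; rewrite -rmorphM lecR.
  by rewrite mulrA divfK ?gt_eqF.
rewrite (le_trans (dFk _)) //.
have : `|g (x + h) - g x - L h| <= (e / 2 / kr * `|h|)%:C by near: h; exact: gL.
have kr0' : 0 <= kr%:C :> C by rewrite lecR ltW.
move=> /(ler_wpM2l kr0') /le_trans; apply; rewrite -rmorphM lecR.
by rewrite mulrA [kr * _]mulrC divfK ?gt_eqF.
Unshelve. all: by end_near. Qed.

Lemma mixed_diffP (g : U -> C) x (L : U -> C) : linear (re \o L) ->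
  linear (im \o L) -> (exists k, forall h, `|L h| <= (k * `|h|)%:C) ->
  mixed_diff g x L <->
  is_diff x (re \o g) (re \o L) /\ is_diff x (im \o g) (im \o L).
Proof.
move=> lre lim [k Lk]; split=> [gL|[gr gi] e e0].
  split; apply: is_diff_eps => //.
  - exists k => h; have := le_trans (normc_ge_Re _) (Lk h); by rewrite lecR.
  - move=> e e0; apply: filterS (gL e e0) => h /(le_trans (normc_ge_Re _)).
    by rewrite lecR !raddfB.
  - exists k => h; have := le_trans (normc_ge_Im _) (Lk h); by rewrite lecR.
  - move=> e e0; apply: filterS (gL e e0) => h /(le_trans (normc_ge_Im _)).
    by rewrite lecR !raddfB.
have e2 : 0 < e / 2 by rewrite divr_gt0.
have dr : differentiable (re \o g) x by [].
have di : differentiable (im \o g) x by [].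
apply: filterS2 (diff_eps dr e2) (diff_eps di e2) => h.
rewrite (@diff_val _ _ _ _ _ _ _ gr) (@diff_val _ _ _ _ _ _ _ gi) /= => hr hi.
rewrite (le_trans (normc_le_ReIm _)) // lecR !raddfB /=.
by rewrite [e]splitr mulrDl lerD.
Qed.

End MixedDifferential.

(** * Means of complex functions over the unit interval *)

Section ComplexMean.
Context {R : realType}.
Local Notation C := R[i].
Local Notation re := (@complex.Re R).
Local Notation im := (@complex.Im R).
Local Notation mu := (@lebesgue_measure R).

(** On a circle z(t) with centre c, run through once for t in [0, 1], dz = 2 pi i (z - c) dt. So the
    contour integral of h divided by 2 pi i is the [cmean] of h(z) (z - c), which is why a factor
    [circ c r t - c] accompanies the integrands below. *)
Definition cmean (g : R -> C) : C :=
  (\int[mu]_(x in `[0, 1]) re (g x)) +i* (\int[mu]_(x in `[0, 1]) im (g x)).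

Lemma integrable01 (h : R -> R) : continuous h ->
  mu.-integrable `[0, 1] (EFin \o h).
Proof.
move=> ch; apply: continuous_compact_integrable; first exact: segment_compact.
exact: continuous_subspaceT.
Qed.

Lemma continuous_re (g : R -> C) : continuous g -> continuous (re \o g).
Proof. by move=> cg x; have /continuous_complexP[] := cg x. Qed.

Lemma continuous_im (g : R -> C) : continuous g -> continuous (im \o g).
Proof. by move=> cg x; have /continuous_complexP[] := cg x. Qed.

Lemma cmeanD (f g : R -> C) : continuous f -> continuous g ->
  cmean (fun x => f x + g x) = cmean f + cmean g.
Proof.
move=> cf cg; rewrite /cmean; congr (_ +i* _).
  rewrite -RintegralD //; [|exact/integrable01/continuous_re..].
  by apply: eq_Rintegral => x _; rewrite raddfD.
rewrite -RintegralD //; [|exact/integrable01/continuous_im..].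
by apply: eq_Rintegral => x _; rewrite raddfD.
Qed.

Lemma cmeanZ (c : C) (g : R -> C) : continuous g ->
  cmean (fun x => c * g x) = c * cmean g.
Proof.
move=> cg; rewrite /cmean; case: c => a b.
have ir := integrable01 (continuous_re cg).
have ii := integrable01 (continuous_im cg).
have mulr_int (h : R -> R) d : continuous h -> mu.-integrable `[0, 1] (EFin \o (fun
    x => d * h x)).
  by move=> ch; apply: integrable01 => x; apply: cvgMr; exact: ch.
apply/eqP; rewrite eq_complex /=; apply/andP; split; apply/eqP.
  rewrite -RintegralZl // -RintegralZl // -RintegralB //.
  - by apply: eq_Rintegral => x _; case: (g x).
  - exact/mulr_int/continuous_re.
  - exact/mulr_int/continuous_im.
rewrite -RintegralZl // -RintegralZl // -RintegralD //.
- by apply: eq_Rintegral => x _; case: (g x).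
- exact/mulr_int/continuous_im.
- exact/mulr_int/continuous_re.
Qed.

Lemma cmeanB (f g : R -> C) : continuous f -> continuous g ->
  cmean (fun x => f x - g x) = cmean f - cmean g.
Proof.
move=> cf cg; have cN : continuous (fun x => -1 * g x).
  by move=> x; apply: cvgMr; exact: cg.
rewrite -mulN1r -cmeanZ // -cmeanD //.
by congr cmean; apply/funext => x; rewrite mulN1r.
Qed.

Lemma cmean_cst (c : C) : cmean (fun=> c) = c.
Proof.
rewrite /cmean !Rintegral_cst //= lebesgue_measure_itv /= lte_fin ltr01.
by rewrite oppr0 addr0 !mulr1; case: c.
Qed.

(** The real and the imaginary integral are bounded separately, hence the factor 2, a harmless
    constant in what follows. *)
Lemma norm_cmean_le (g : R -> C) (b : R) : continuous g ->
  (forall x, x \in `[0, 1] -> `|g x| <= b%:C) -> `|cmean g| <= (2 * b)%:C.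
Proof.
move=> cg gb.
have int_le (h : R -> R) : continuous h -> (forall x, x \in `[0, 1] -> `|h x| <= b) ->
    `|\int[mu]_(x in `[0, 1]) h x| <= b.
  move=> ch hb; rewrite (le_trans (le_normr_Rintegral _ _)) //.
    exact: integrable01.
  have <- : \int[mu]_(x in `[0, 1]) b = b.
    by rewrite Rintegral_cst //= lebesgue_measure_itv /= lte_fin ltr01 oppr0 addr0 mulr1.
  apply: le_Rintegral => //.
  - by apply: integrable01 => x; apply: cvg_norm; exact: ch.
  - by apply: integrable01 => x; exact: cvg_cst.
apply: (le_trans (normc_le_ReIm _)); rewrite lecR mulr_natl mulr2n lerD //=.
  apply: int_le; first exact: continuous_re.
  by move=> x /gb /(le_trans (normc_ge_Re _)); rewrite lecR.
apply: int_le; first exact: continuous_im.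
by move=> x /gb /(le_trans (normc_ge_Im _)); rewrite lecR.
Qed.

Lemma Rintegral01_deriv (F f : R -> R) : continuous f ->
  (forall x : R, is_derive x 1 F (f x)) -> \int[mu]_(x in `[0, 1]) f x = F 1 - F 0.
Proof.
move=> cf dF; rewrite /Rintegral (@continuous_FTC2 _ _ F) //.
- exact: continuous_subspaceT.
- have cF x : {for x, continuous F}.
    by apply/differentiable_continuous/derivable1_diffP.
  split=> [x _ //||]; [apply: cvg_at_right_filter|apply: cvg_at_left_filter]; exact: cF.
- by move=> x _; rewrite derive1E; apply: derive_val.
Qed.

End ComplexMean.

Section Curves.
Context {R : realType}.
Local Notation C := R[i].
Local Notation re := (@complex.Re R).
Local Notation im := (@complex.Im R).

Definition curve_deriv (G : R -> C) (x : R) (c : C) :=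
  mixed_diff G x (fun h => h%:C * c).

Lemma is_diff_scale_derive (f : R -> R) (x d : R) :
  is_diff x f (fun h => h * d) <-> is_derive x 1 f d.
Proof.
split=> [fd|fd].
  have df : differentiable f x by [].
  by apply: DeriveDef; [exact: diff_derivable|rewrite deriveE // diff_val mul1r].
have df : differentiable f x by apply/derivable1_diffP.
by apply: DiffDef => //; rewrite diff1E // derive1E derive_val.
Qed.

Lemma curve_derivP (G : R -> C) (x : R) (c : C) :
  curve_deriv G x c <->
  is_derive x 1 (re \o G) (re c) /\ is_derive x 1 (im \o G) (im c).
Proof.
have reE : re \o (fun h => h%:C * c) = (fun h => h * re c).
  by apply/funext => h /=; case: c => a b /=; rewrite mul0r subr0.
have imE : im \o (fun h => h%:C * c) = (fun h => h * im c).
  by apply/funext => h /=; case: c {reE} => a b /=; rewrite mul0r addr0.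
rewrite -!is_diff_scale_derive -reE -imE; apply: mixed_diffP.
- by rewrite reE => a u v; rewrite mulrDl scalerAl.
- by rewrite imE => a u v; rewrite mulrDl scalerAl.
- have [k k0 kE] := ge0_complexP (normr_ge0 c).
  by exists k => h; rewrite normrM kE normc_real -rmorphM mulrC.
Qed.

Lemma cmean_deriv (G g : R -> C) : continuous g ->
  (forall x, curve_deriv G x (g x)) -> cmean g = G 1 - G 0.
Proof.
move=> cg dG; apply/eqP; rewrite eq_complex /=; apply/andP; split; apply/eqP.
  have /= -> := @Rintegral01_deriv _ (re \o G) (re \o g) (continuous_re cg)
    (fun x => proj1 (iffLR (curve_derivP _ _ _) (dG x))).
  by rewrite raddfB.
have /= -> := @Rintegral01_deriv _ (im \o G) (im \o g) (continuous_im cg)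
  (fun x => proj2 (iffLR (curve_derivP _ _ _) (dG x))).
by rewrite raddfB.
Qed.

(** Complex-valued curves satisfy no mean value equality; the real theorem is applied to both parts,
    hence the factor 2. *)
Lemma curve_mvt (G g : R -> C) (b : R) :
  (forall x : R, x \in `[0, 1] -> curve_deriv G x (g x)) ->
  (forall x : R, x \in `[0, 1] -> `|g x| <= b%:C) -> `|G 1 - G 0| <= (2 * b)%:C.
Proof.
move=> dG gb.
have mvt (F f : R -> R) : (forall x : R, x \in `[0, 1] -> is_derive x 1 F (f x)) ->
    (forall x : R, x \in `[0, 1] -> `|f x| <= b) -> `|F 1 - F 0| <= b.
  move=> dF fb.
  have dF' (x : R) : x \in `]0, 1[ -> is_derive x 1 F (f x).
    by move=> x01; apply: dF; apply: subset_itv_oo_cc.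
  have cF : {within `[0, 1], continuous F}.
    apply: derivable_within_continuous => x x01.
    by have dFx := dF x x01; apply: ex_derive.
  have [c c01 FE] := MVT_segment ler01 dF' cF.
  by rewrite FE subr0 mulr1; exact: fb.
apply: (le_trans (normc_le_ReIm _)); rewrite lecR mulr_natl mulr2n !raddfB lerD //=.
  apply: (mvt (re \o G) (re \o g)) => x x01; first by have /curve_derivP[] := dG x x01.
  by have := le_trans (normc_ge_Re _) (gb x x01); rewrite lecR.
apply: (mvt (im \o G) (im \o g)) => x x01; first by have /curve_derivP[] := dG x x01.
by have := le_trans (normc_ge_Im _) (gb x x01); rewrite lecR.
Qed.

Lemma curve_deriv_comp (F : C -> C) (G : R -> C) x c : derivable F (G x) 1 ->
  curve_deriv G x c -> curve_deriv (F \o G) x (derive1 F (G x) * c).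
Proof.
move=> dF dG.
have dF' : differentiable F (G x) by apply/derivable1_diffP.
have [k k0 kE] := ge0_complexP (normr_ge0 c).
have ck (h : R) : `|h%:C * c| <= (k * `|h|)%:C.
  by rewrite normrM kE normc_real -rmorphM mulrC.
have H := mixed_diff_comp ck dG dF'.
move=> e e0; apply: filterS (H e e0) => h /=.
by rewrite diff1E //= /GRing.scale /= -mulrA (mulrC c).
Qed.

End Curves.

Section DiffTimes.
Context {K : numFieldType} {V W : normedModType K}.
Implicit Types F G : V -> W.

Lemma near_eq_is_diff F G x L : (\forall y \near x, F y = G y) ->
  is_diff x F L -> is_diff x G L.
Proof.
move=> FG dF.
have dF' : differentiable F x by [].
apply: is_diff_eps.
- by rewrite -(@diff_val _ _ _ _ _ _ _ dF); exact: linearP.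
- have [k k0 Lk] := diff_lip dF'; exists k.
  by rewrite -(@diff_val _ _ _ _ _ _ _ dF).
move=> e e0; have := diff_eps dF' e0; rewrite (@diff_val _ _ _ _ _ _ _ dF).
apply: filter_app; have FG' := FG; rewrite (near_shift 0 x) in FG'.
have FGx : F x = G x by apply: nbhs_singleton FG.
apply: filterS FG' => h /=; rewrite subr0 => FGh.
by rewrite -FGx (addrC x h) FGh.
Qed.

Lemma near_eq_differentiable F G x : (\forall y \near x, F y = G y) ->
  differentiable F x -> differentiable G x /\ 'd G x = 'd F x :> (V -> W).
Proof.
by move=> FG /differentiableP dF; have dG := near_eq_is_diff FG dF; split;
  [exact: ex_diff|exact: diff_val].
Qed.

Lemma diff_times_near_eq k F G x : (\forall y \near x, F y = G y) ->
  diff_times k F x -> diff_times k G x.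
Proof.
elim: k F G => [//|[|k] IH] F G FG /=; first by case/(near_eq_differentiable FG).
move=> [dF dF']; have FG2 := near_join FG; split.
  by apply: filterS2 FG2 dF => y /near_eq_differentiable H /H[].
move=> v; apply: IH (dF' v); apply: filterS2 FG2 dF => y.
by move=> /near_eq_differentiable H /H[_ ->].
Qed.

Lemma diff_times_le k l F x : (k <= l)%N -> diff_times l F x -> diff_times k F x.
Proof.
elim: k l F => [//|k IH] [//|l] F; rewrite ltnS => kl.
case: l kl => [|l] kl; first by move: kl; rewrite leqn0 => /eqP ->.
case: k IH kl => [|k] IH kl [dF dF']; first exact: nbhs_singleton dF.
by split=> // v; exact: (IH l.+1 _ kl (dF' v)).
Qed.

End DiffTimes.

(** * Differentiation under the integral sign *)

Section Families.
Context {R : realType}.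
Local Notation C := R[i].
Context {V : normedModType C}.
Implicit Types (g : R -> V -> C) (X : V).

(** Parameter and increment vary together: the estimate is uniform for parameters near [t], and
    compactness of [0, 1] will make it uniform along the whole interval of integration. *)
Definition little_o (t : R) (u : R * V -> C) := forall e : C, 0 < e ->
  \forall p \near ((t, 0) : R * V), `|u p| <= e * `|p.2|.

Definition big_O (t : R) (u : R * V -> C) := exists2 M : C, 0 < M &
  \forall p \near ((t, 0) : R * V), `|u p| <= M * `|p.2|.

Definition family_diff g X (dg : R -> V -> C) := forall t : R,
  little_o t (fun p => g p.1 (X + p.2) - g p.1 X - dg p.1 p.2).

Definition family_bnd (dg : R -> V -> C) := forall t : R,
  exists2 M : C, 0 < M &
    \forall s \near t, forall H, `|dg s H| <= M * `|H|.

Lemma little_oD t u v : little_o t u -> little_o t v ->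
  little_o t (fun p => u p + v p).
Proof.
move=> ou ov e e0; have e2 : 0 < e / 2 by rewrite divr_gt0.
apply: filterS2 (ou _ e2) (ov _ e2) => p up vp.
by rewrite (le_trans (ler_normD _ _)) // [e]splitr mulrDl lerD.
Qed.

Lemma little_oM t u v (l : C) : little_o t u ->
  v p @[p --> ((t, 0) : R * V)] --> l -> little_o t (fun p => u p * v p).
Proof.
move=> ou vl e e0.
have M0 : 0 < `|l| + 1 by rewrite ltr_wpDl.
have vM : \forall p \near ((t, 0) : R * V), `|v p| <= `|l| + 1.
  have /cvgrPdist_le/(_ 1 ltr01) := vl; apply: filterS => p vp.
  rewrite -[v p](subKr l) (le_trans (ler_normB _ _)) //.
  by rewrite lerD2l.
apply: filterS2 (ou _ (divr_gt0 e0 M0)) vM => p up vp.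
rewrite normrM (le_trans (ler_pM _ _ up vp)) //.
by rewrite mulrAC divfK // gt_eqF.
Qed.

Lemma big_OM t u v : big_O t u ->
  v p @[p --> ((t, 0) : R * V)] --> (0 : C) -> little_o t (fun p => u p * v p).
Proof.
move=> [M M0 uM] v0 e e0.
have vM : \forall p \near ((t, 0) : R * V), `|v p| <= e / M.
  by have /cvgr0Pnorm_le/(_ _ (divr_gt0 e0 M0)) := v0.
apply: filterS2 uM vM => p up vp.
rewrite normrM (le_trans (ler_pM _ _ up vp)) //.
by rewrite mulrAC mulrCA divff ?mulr1 ?gt_eqF // mulrC.
Qed.

Lemma family_bnd_O (dg : R -> V -> C) t : family_bnd dg ->
  big_O t (fun p => dg p.1 p.2).
Proof.
move=> /(_ t)[M M0 dM]; exists M => //.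
have : \forall p \near ((t, 0) : R * V), forall H, `|dg p.1 H| <= M * `|H|.
  exact: (cvg_fst dM).
by apply: filterS => p; exact.
Qed.

Lemma cmean_diff g X (dg : R -> V -> C) :
  (\forall Y \near X, continuous (g^~ Y)) ->
  (forall H, continuous (dg^~ H)) -> (forall t, linear (dg t)) ->
  family_bnd dg -> family_diff g X dg ->
  is_diff X (fun Y => cmean (g^~ Y)) (fun H => cmean (dg^~ H)).
Proof.
move=> cg cdg ldg bdg gdg.
have c01 : compact (`[0, 1] : set R) := @segment_compact _ 0 1.
(* Compactness as near-covering: what holds jointly near each parameter of [0, 1] and along a filter
   eventually holds for all these parameters at once. It is used with the filter +oo for a common
   bound on all [dg t], and with the neighbourhoods of 0 for the remainders. *)
have near01 := iffLR (compact_near_coveringP _) c01.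
have [M M0 dgM] : exists2 M : R, 0 <= M &
    forall t, t \in `[0, 1] -> forall H, `|dg t H| <= M%:C * `|H|.
  have dM : \forall M \near +oo%R,
      `[0, 1] `<=` [set t | forall H, `|dg t H| <= M%:C * `|H|].
    apply: near01 => t _; have [M0 M0_gt0 dM] := bdg t.
    have [M M_gt0 ME] := gt0_complexP M0_gt0.
    exists ([set s | forall H, `|dg s H| <= M0 * `|H|], [set M' | M <= M']) => /=.
      by split; [exact: dM|exact: (nbhs_pinfty_ge (num_real M))].
    move=> [s M'] /= [sM MM'] H; apply: (le_trans (sM H)).
    by rewrite ME ler_wpM2r // lecR.
  have [M [M0 dgM]] := filter_ex (filterI (nbhs_pinfty_ge (num_real 0)) dM).
  by exists M => // t t01 H; exact: dgM.
have Hr (H : V) := ge0_complexP (normr_ge0 H).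
apply: is_diff_eps.
- move=> a u v; rewrite -[a *: cmean _]/(a * cmean _) -cmeanZ // -cmeanD //.
  + by congr cmean; apply/funext => t; rewrite ldg.
  + by move=> t; apply: cvgMr; exact: cdg.
- exists (2 * M)%:C => H; have [h h0 hE] := Hr H.
  rewrite hE -rmorphM -mulrA; apply: norm_cmean_le; first exact: cdg.
  by move=> t /dgM /(_ H); rewrite hE -rmorphM.
move=> _ /gt0_complexP[e e0 ->].
have e2 : 0 < (e / 2)%:C :> C by rewrite ltcR divr_gt0.
have : \forall H \near (0 : V), `[0, 1] `<=`
    [set t | `|g t (X + H) - g t X - dg t H| <= (e / 2)%:C * `|H|].
  by apply: near01 => t _; exact: (gdg t _ e2).
move: cg; rewrite (near_shift 0 X) => cg.
have cgX : continuous (g^~ X) by have := nbhs_singleton cg; rewrite /= subr0 add0r.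
apply: filterS2 cg => H; rewrite /= subr0 (addrC H) => cgH gH.
have cd : continuous (fun t => g t (X + H) - g t X).
  by move=> t; apply: cvgB; [exact: cgH|exact: cgX].
rewrite -(cmeanB cgH cgX) -(cmeanB cd (cdg H)).
have [h h0 hE] := Hr H.
have -> : e%:C * `|H| = (2 * (e / 2 * h))%:C.
  by rewrite mulrA mulrCA divff ?mulr1 // hE -rmorphM.
apply: norm_cmean_le => [t|t t01]; first by apply: cvgB; [exact: cd|exact: cdg].
by rewrite rmorphM /= -hE; exact: gH.
Qed.


(* Parametrised families of which all derivatives stay in the same class, so
   that their means are infinitely often differentiable. *)
Inductive good_family (A : set V) : (R -> V -> C) -> Prop :=
| good_cst (phi : R -> C) : continuous phi -> good_family A (fun t _ => phi t)
| good_lin (L : V -> C) : linear L -> (exists k, forall H, `|L H| <= k * `|H|) ->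
    good_family A (fun _ X => L X)
| good_add g h : good_family A g -> good_family A h ->
    good_family A (fun t X => g t X + h t X)
| good_mul g h : good_family A g -> good_family A h ->
    good_family A (fun t X => g t X * h t X)
| good_inv g : good_family A g -> (forall t X, A X -> g t X != 0) ->
    good_family A (fun t X => (g t X)^-1).

Lemma bounded_linear_cvg (L : V -> C) X : linear L ->
  (exists k, forall H, `|L H| <= k * `|H|) -> {for X, continuous L}.
Proof.
move=> lL kL.
have dL : is_diff X L L.
  apply: is_diff_eps => // e e0; apply: nearW => h.
  have := lL 1 X h; rewrite !scale1r => ->. rewrite [L X + _]addrC addrK subrr normr0.
  by rewrite mulr_ge0 // ltW.
exact: differentiable_continuous.
Qed.

Lemma good_family_cvg (A : set V) g : good_family A g ->
  forall t X, A X -> {for (t, X), continuous (fun p : R * V => g p.1 p.2)}.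
Proof.
elim=> {g}[phi cphi|L lL kL|g h _ IHg _ IHh|g h _ IHg _ IHh|g _ IHg g0] t X AX.
- exact: (@cvg_comp _ _ _ (fun p : R * V => p.1) phi _ _ _ cvg_fst (cphi t)).
- apply: (@cvg_comp _ _ _ (fun p : R * V => p.2) L); first exact: cvg_snd.
  exact: (bounded_linear_cvg lL kL).
- exact: cvgD (IHg t X AX) (IHh t X AX).
- exact: cvgM (IHg t X AX) (IHh t X AX).
- by apply: cvgV (IHg t X AX); exact: g0.
Qed.

Lemma good_family_cvg_shift (A : set V) g : good_family A g ->
  forall t X, A X -> g p.1 (X + p.2) @[p --> ((t, 0) : R * V)] --> g t X.
Proof.
move=> gg t X AX; have := @good_family_cvg A g gg t X AX.
apply: (@cvg_comp _ _ _ (fun p : R * V => (p.1, X + p.2)) (fun p => g p.1 p.2)).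
have cX : X + p.2 @[p --> ((t, 0) : R * V)] --> X.
  rewrite -[X in _ --> X]addr0; apply: cvgD; first exact: cvg_cst.
  exact: cvg_snd.
have ct : p.1 @[p --> ((t, 0) : R * V)] --> t by exact: cvg_fst.
exact: cvg_pair ct cX.
Qed.

Lemma good_family_cvg_fst (A : set V) g : good_family A g ->
  forall t X, A X -> g p.1 X @[p --> ((t, 0) : R * V)] --> g t X.
Proof.
move=> gg t X AX; have := @good_family_cvg A g gg t X AX.
apply: (@cvg_comp _ _ _ (fun p : R * V => (p.1, X)) (fun p => g p.1 p.2)).
have ct : p.1 @[p --> ((t, 0) : R * V)] --> t by exact: cvg_fst.
exact: cvg_pair ct (cvg_cst X).
Qed.

Lemma good_family_continuous (A : set V) g : good_family A g ->
  forall X, A X -> continuous (g^~ X).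
Proof.
move=> gg X AX t; have := @good_family_cvg A g gg t X AX.
apply: (@cvg_comp _ _ _ (fun s : R => (s, X)) (fun p => g p.1 p.2)).
exact: cvg_pair cvg_id (cvg_cst X).
Qed.

Lemma family_bndD (dg dh : R -> V -> C) : family_bnd dg -> family_bnd dh ->
  family_bnd (fun t H => dg t H + dh t H).
Proof.
move=> bg bh t; have [M M0 gM] := bg t; have [N N0 hN] := bh t.
exists (M + N); first exact: addr_gt0.
apply: filterS2 gM hN => s gM hN H.
by rewrite (le_trans (ler_normD _ _)) // mulrDl lerD.
Qed.

Lemma family_bndM (phi : R -> C) (dg : R -> V -> C) : continuous phi ->
  family_bnd dg -> family_bnd (fun t H => phi t * dg t H).
Proof.
move=> cphi bg t; have [M M0 gM] := bg t.
exists ((`|phi t| + 1) * M); first by rewrite mulr_gt0 // ltr_wpDl.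
have phiM : \forall s \near t, `|phi s| <= `|phi t| + 1.
  have /cvgrPdist_le/(_ 1 ltr01) := cphi t; apply: filterS => s ps.
  by rewrite -[phi s](subKr (phi t)) (le_trans (ler_normB _ _)) // lerD2l.
apply: filterS2 gM phiM => s gM phiM H.
by rewrite normrM -mulrA ler_pM.
Qed.

(** Induction on the construction. With the direction [H] fixed, the derivative is built by the same
    constructors: a bounded linear form has the constant [L H] as derivative, products obey Leibniz'
    rule, and inverses give -dg / g^2. *)
Lemma good_family_diff (A : set V) g : good_family A g ->
  exists dg : R -> V -> V -> C,
    (forall H, good_family A (fun t X => dg t X H)) /\
    (forall X, A X -> [/\ forall t, linear (dg t X), family_bnd (dg^~ X) &
                          family_diff g X (dg^~ X)]).
Proof.
elim=> {g}[phi cphi|L lL kL|g h gg IHg gh IHh|g h gg IHg gh IHh|g gg IHg g0].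
- exists (fun _ _ _ => 0); split=> [H|X AX].
    by apply: good_cst => t; exact: cvg_cst.
  split=> [t a u v|t|t e e0]; first by rewrite scaler0 addr0.
    by exists 1; [exact: ltr01|apply: (@nearW _ (nbhs t)) => s H; rewrite normr0 mul1r].
  by apply: (@nearW _ (nbhs ((t, 0) : R * V))) => p; rewrite subrr subr0 normr0
      mulr_ge0 // ltW.
- exists (fun _ _ H => L H); split=> [H|X AX].
    by apply: good_cst => t; exact: cvg_cst.
  split=> [t //|t|t e e0].
    have [k Lk] := kL; exists (`|k| + 1); [by rewrite ltr_wpDl|].
    apply: (@nearW _ (nbhs t)) => s H; apply: (le_trans (Lk H)).
    rewrite -[leLHS](ger0_norm (le_trans (normr_ge0 _) (Lk H))).
    by rewrite normrM normr_id ler_wpM2r // lerDl.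
  apply: (@nearW _ (nbhs ((t, 0) : R * V))) => p.
  have := lL 1 X p.2; rewrite !scale1r => ->; rewrite [L X + _]addrC addrK subrr normr0.
  by rewrite mulr_ge0 // ltW.
- have [dg [gdg Hdg]] := IHg; have [dh [gdh Hdh]] := IHh.
  exists (fun t X H => dg t X H + dh t X H); split=> [H|X AX].
    by apply: good_add; [exact: gdg|exact: gdh].
  have [lg bg fg] := Hdg X AX; have [lh bh fh] := Hdh X AX.
  split=> [t a u v||t].
  + by rewrite lg lh scalerDr addrACA.
  + exact: family_bndD.
  + have := little_oD (fg t) (fh t); congr little_o; apply/funext => p.
    by ring.
- have [dg [gdg Hdg]] := IHg; have [dh [gdh Hdh]] := IHh.
  exists (fun t X H => h t X * dg t X H + g t X * dh t X H); split=> [H|X AX].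
    by apply: good_add; exact: good_mul.
  have [lg bg fg] := Hdg X AX; have [lh bh fh] := Hdh X AX.
  have cg := good_family_continuous gg AX; have ch := good_family_continuous gh AX.
  split=> [t a u v||t].
  + by rewrite lg lh /GRing.scale /=; ring.
  + exact: (family_bndD (family_bndM (phi := h^~ X) ch bg) (family_bndM (phi := g^~
      X) cg bh)).
  + have hh0 : h p.1 (X + p.2) - h p.1 X @[p --> ((t, 0) : R * V)] --> 0.
      rewrite -[X in _ --> X](subrr (h t X)); apply: cvgB.
        exact: (good_family_cvg_shift gh).
      exact: (good_family_cvg_fst gh).
    (* The remainder of the product is (rem g) h(X + H) + dg (h(X + H) - h(X)) + (rem h) g(X). *)
    have := little_oD (little_oD
      (little_oM (fg t) (good_family_cvg_shift gh AX))
      (big_OM (family_bnd_O t bg) hh0))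
      (little_oM (fh t) (good_family_cvg_fst gg AX)).
    congr little_o; apply/funext => p; ring.
- have [dg [gdg Hdg]] := IHg.
  have gi := good_inv gg g0.
  exists (fun t X H => (- 1 * ((g t X)^-1 * (g t X)^-1)) * dg t X H); split=> [H|X AX].
    apply: good_mul; last exact: gdg.
    apply: good_mul; last exact: good_mul.
    by apply: (@good_cst _ (fun=> -1)) => t; exact: cvg_cst.
  have [lg bg fg] := Hdg X AX.
  have cg := good_family_continuous gi AX.
  split=> [t a u v||t].
  + by rewrite lg /GRing.scale /=; ring.
  + have cphi : continuous (fun t => -1 * ((g t X)^-1 * (g t X)^-1)).
      by move=> t; apply: (cvgM (cvg_cst _)); apply: (cvgM (cg t) (cg t)).
    exact: (family_bndM cphi bg).
  + have gg0 : g p.1 (X + p.2) - g p.1 X @[p --> ((t, 0) : R * V)] --> 0.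
      rewrite -[X in _ --> X](subrr (g t X)); apply: cvgB.
        exact: (good_family_cvg_shift gg).
      exact: (good_family_cvg_fst gg).
    have gis : (g p.1 (X + p.2))^-1 @[p --> ((t, 0) : R * V)] --> (g t X)^-1.
      by apply: cvgV; [exact: g0|exact: (good_family_cvg_shift gg)].
    have gif : (g p.1 X)^-1 @[p --> ((t, 0) : R * V)] --> (g t X)^-1.
      by apply: cvgV; [exact: g0|exact: (good_family_cvg_fst gg)].
    have nz : \forall p \near ((t, 0) : R * V), g p.1 (X + p.2) != 0.
      exact: (cvgr_neq0 _ (good_family_cvg_shift gg AX) (g0 t X AX)).
    (* With g' = g(X + H), the remainder of 1/g is dg (g' - g) / (g^2 g') - (rem g) / (g g'), an
       identity valid where g' does not vanish. *)
    have o1 := little_oM (little_oM (little_oM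
      (big_OM (family_bnd_O t bg) gg0) gif) gif) gis.
    have cN : (fun=> -1 : C) p @[p --> ((t, 0) : R * V)] --> (-1 : C).
      exact: cvg_cst.
    have o2 := little_oM (little_oM (little_oM (fg t) gif) gis) cN.
    move=> e e0; apply: filterS2 nz (little_oD o1 o2 e0) => p gs0.
    congr (`|_| <= _); have gp0 := g0 p.1 X AX.
    by field; rewrite gs0 gp0.
Qed.

End Families.

Section FamilyMeans.
Context {R : realType}.
Local Notation C := R[i].
Context {V : normedModType C}.
Implicit Types (g : R -> V -> C) (X : V).

Lemma good_family_mean (A : set V) g (dg : R -> V -> V -> C) X : open A -> A X ->
  good_family A g -> (forall H, good_family A (fun t X => dg t X H)) ->
  (forall X, A X -> [/\ forall t, linear (dg t X), family_bnd (dg^~ X) &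
                        family_diff g X (dg^~ X)]) ->
  is_diff X (fun Y => cmean (g^~ Y)) (fun H => cmean (fun t => dg t X H)).
Proof.
move=> oA AX gg gdg Hdg; have [ldg bdg fdg] := Hdg X AX.
apply: (@cmean_diff _ _ g X (dg^~ X)) => //.
- have : \forall Y \near X, A Y by exact: open_nbhs_nbhs.
  by apply: filterS => Y; exact: good_family_continuous.
- by move=> H; exact: (good_family_continuous (gdg H)).
Qed.

Lemma good_family_smooth (A : set V) g N X : open A -> good_family A g -> A X ->
  diff_times N (fun Y => cmean (g^~ Y)) X.
Proof.
move=> oA; elim: N g X => [//|N IH] g X gg AX.
have [dg [gdg Hdg]] := good_family_diff gg.
have dmean Y (AY : A Y) := good_family_mean oA AY gg gdg Hdg.
case: N IH => [_|N IH]; first by have := dmean X AX => ?; exact: ex_diff.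
have nA : \forall Y \near X, A Y by exact: open_nbhs_nbhs.
split; first by apply: filterS nA => Y AY; have := dmean Y AY => ?; exact: ex_diff.
move=> v; apply: diff_times_near_eq (IH _ X (gdg v) AX).
by apply: filterS nA => Y AY; have := dmean Y AY => dY; rewrite diff_val.
Qed.

Lemma family_diff_slice g X (dg : R -> V -> C) t : linear (dg t) ->
  family_bnd dg -> family_diff g X dg -> is_diff X (g t) (dg t).
Proof.
move=> ldg bdg fdg; apply: is_diff_eps => //.
  have [M M0 dM] := bdg t; exists M; exact: (nbhs_singleton dM).
move=> e e0; have [[P Q] /= [Pt Q0] PQ] := fdg t e e0.
apply: filterS Q0 => h Qh; exact: (PQ (t, h) (conj (nbhs_singleton Pt) Qh)).
Qed.

End FamilyMeans.

(** * Continuously differentiable functions of one complex variable *)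

Section ComplexDerivative.
Context {R : realType}.
Local Notation C := R[i].
Implicit Types (f g : C -> C) (z : C).

(** [good_family_diff] yields a derivative without a formula; uniqueness identifies its value in the
    direction 1 with the [d t] computed by ordinary calculus. *)
Lemma good_family_derive (A : set C) (g : R -> C -> C) (d : R -> C) (w : C) :
  open A -> A w -> good_family A g -> (forall t, is_derive w 1 (g t) (d t)) ->
  is_derive w 1 (fun Y => cmean (g^~ Y)) (cmean d).
Proof.
move=> oA Aw gg gd; have [dg [gdg Hdg]] := good_family_diff gg.
have dm := good_family_mean oA Aw gg gdg Hdg.
have [ldg bdg fdg] := Hdg w Aw.
have dE : d = fun t => dg t w 1.
  apply/funext => t; have dt := family_diff_slice (ldg t) bdg fdg.
  have dft : differentiable (g t) w by [].
  have := gd t => dgt.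
  have <- : 'D_1 (g t) w = d t by rewrite derive_val.
  by rewrite deriveE // diff_val.
have dfm : differentiable (fun Y => cmean (g^~ Y)) w by [].
apply: DeriveDef; first exact: diff_derivable.
by rewrite deriveE // diff_val dE.
Qed.

Definition C1_at f z := (\forall y \near z, derivable f y 1) /\
  {for z, continuous (derive1 f)}.

Lemma C1_continuous f z : C1_at f z -> {for z, continuous f}.
Proof.
move=> [/nbhs_singleton df _].
by apply: differentiable_continuous; apply/derivable1_diffP.
Qed.

Lemma C1_of (f f' : C -> C) z : (\forall y \near z, is_derive (y : C) (1 : C) f (f' y)) ->
  {for z, continuous f'} -> C1_at f z.
Proof.
move=> df cf; split; first by apply: filterS df => y dfy; exact: ex_derive.
have fE : \forall y \near z, f' y = derive1 f y.
  by apply: filterS df => y dfy; rewrite derive1E derive_val.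
rewrite /prop_for /continuous_at -(nbhs_singleton fE); apply: cvg_trans cf.
exact: (near_eq_cvg fE).
Qed.

Lemma C1_cst (a : C) z : C1_at (fun=> a) z.
Proof.
apply: (@C1_of _ (fun=> 0)); last exact: cst_continuous.
by apply: (@nearW _ (nbhs z)) => y; exact: is_derive_cst.
Qed.

Lemma C1_id z : C1_at id z.
Proof.
apply: (@C1_of _ (fun=> 1)); last exact: cst_continuous.
by apply: (@nearW _ (nbhs z)) => y; exact: is_derive_id.
Qed.

Lemma C1_derive f z : C1_at f z -> \forall y \near z, is_derive (y : C) (1 : C) f
    (derive1 f y).
Proof.
by case=> df _; apply: filterS df => y dfy; rewrite derive1E; exact: derivableP.
Qed.

Lemma C1D f g z : C1_at f z -> C1_at g z -> C1_at (fun y => f y + g y) z.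
Proof.
move=> cf cg; apply: (@C1_of _ (fun y => derive1 f y + derive1 g y)).
  by apply: filterS2 (C1_derive cf) (C1_derive cg) => y dfy dgy; exact: is_deriveD.
by case: cf cg => _ cf [_ cg]; exact: cvgD cf cg.
Qed.

Lemma C1M f g z : C1_at f z -> C1_at g z -> C1_at (fun y => f y * g y) z.
Proof.
move=> cf cg.
apply: (@C1_of _ (fun y => f y *: derive1 g y + g y *: derive1 f y)).
  by apply: filterS2 (C1_derive cf) (C1_derive cg) => y dfy dgy; exact: is_deriveM.
have ccf := C1_continuous cf; have ccg := C1_continuous cg.
by case: cf cg => _ cf [_ cg]; exact: (cvgD (cvgM ccf cg) (cvgM ccg cf)).
Qed.

Lemma C1V f z : C1_at f z -> f z != 0 -> C1_at (fun y => (f y)^-1) z.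
Proof.
move=> cf fz; have ccf := C1_continuous cf.
have fnz : \forall y \near z, f y != 0 by exact: cvgr_neq0 ccf fz.
apply: (@C1_of _ (fun y => - ((f y)^-1 * (f y)^-1) * derive1 f y)).
  apply: filterS2 fnz (C1_derive cf) => y fy dfy.
  have [df dE] := dfy.
  apply: DeriveDef; first exact: derivableV.
  rewrite (deriveV fy df) dE -invfM -expr2.
  by [].
case: cf => _ cf.
have cV : (f y)^-1 @[y --> z] --> (f z)^-1 by exact: (cvgV fz ccf).
exact: (cvgM (cvgN (cvgM cV cV)) cf).
Qed.

End ComplexDerivative.

(** * Cauchy's formula on circles *)

Section Cauchy.
Context {R : realType}.
Local Notation C := R[i].
Local Notation re := (@complex.Re R).
Local Notation im := (@complex.Im R).
Implicit Types (f g : C -> C) (z : C).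

Lemma curve_deriv_line (z h : C) (s : R) :
  curve_deriv (fun s : R => z + s%:C * h) s h.
Proof.
move=> e e0; apply: (@nearW _ (nbhs (0 : R))) => d.
have -> : z + (s + d)%:C * h - (z + s%:C * h) - d%:C * h = 0.
  by rewrite rmorphD /=; ring.
by rewrite normr0 ler0c mulr_ge0 // ltW.
Qed.

(** Strict differentiability: the base point moves too, which supplies the uniformity in the
    parameter demanded by [little_o]. It comes from [curve_mvt] for y |-> f(y) - f'(z) y on the
    segment from z to z + h. *)
Lemma strict_diff f z0 (e : C) : C1_at f z0 -> 0 < e ->
  \forall p \near ((z0, 0) : C * C),
    `|f (p.1 + p.2) - f p.1 - derive1 f p.1 * p.2| <= e * `|p.2|.
Proof.
move=> [df cf] /gt0_complexP[r r0 ->].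
(* On the segment f' differs from f'(z) by at most r/4 + r/4, and the factor 2 of [curve_mvt] then
   gives r. *)
have r4 : 0 < (r / 4)%:C :> C by rewrite ltcR divr_gt0.
have /cvgrPdist_le/(_ _ r4) cf4 := cf.
have dcf : \forall z \near z0, derivable f z 1 /\
    `|derive1 f z0 - derive1 f z| <= (r / 4)%:C by apply: filterI.
have /nbhs_normP[d /= d0 dP] := dcf.
have d2 : 0 < d / 2 by rewrite divr_gt0.
exists ([set z | `|z0 - z| < d / 2], [set h | `|h| < d / 2]) => /=.
  split; first by apply/nbhs_normP; exists (d / 2).
  exact: nbhs0_lt.
move=> [z h] /= [zd hd].
have seg s : s \in `[0, 1] -> `|z0 - (z + s%:C * h)| < d.
  rewrite in_itv /= => /andP[s0 s1].
  rewrite opprD addrA (le_lt_trans (ler_normB _ _)) // [d]splitr ltrD //.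
  apply: le_lt_trans hd; rewrite normrM normc_real (ger0_norm s0).
  by apply: ler_piMl => //; rewrite -[1]/(1%:C) lecR.
pose F (y : C) := f y - derive1 f z * y.
have dF s : s \in `[0, 1] -> curve_deriv (F \o (fun s : R => z + s%:C * h)) s
    ((derive1 f (z + s%:C * h) - derive1 f z) * h).
  move=> s01; have [dfs _] := dP _ (seg s s01).
  have dFs : is_derive (z + s%:C * h) (1 : C) F (derive1 f (z + s%:C * h) - derive1 f z).
    apply: is_deriveB; first by rewrite derive1E; exact: derivableP.
    by rewrite -[X in is_derive _ _ _ X]mulr1; apply: is_deriveZ.
  have <- : derive1 F (z + s%:C * h) = derive1 f (z + s%:C * h) - derive1 f z.
    by rewrite derive1E derive_val.
  apply: curve_deriv_comp; first exact: ex_derive.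
  exact: curve_deriv_line.
have [h1 h10 hE] := ge0_complexP (normr_ge0 h).
have := curve_mvt dF (b := r / 2 * h1).
rewrite /F /= mul1r mul0r addr0 => H.
have -> : f (z + h) - f z - derive1 f z * h =
   f (z + h) - derive1 f z * (z + h) - (f z - derive1 f z * z) by ring.
have -> : r%:C * `|h| = (2 * (r / 2 * h1))%:C.
  by rewrite mulrA mulrCA divff ?mulr1 // hE -rmorphM.
apply: H => s s01; rewrite normrM hE rmorphM /=; apply: ler_wpM2r; first by rewrite lecR.
have z0z : `|z0 - z| < d by have := seg 0; rewrite mul0r addr0; apply; rewrite
    in_itv /= lexx ler01.
have [_ /= b1] := dP _ (seg s s01); have [_ /= b2] := dP _ z0z.
move: b1 b2; move: (derive1 f (z + s%:C * h)) (derive1 f z0) (derive1 f z) => a b d'.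
move=> b1 b2; rewrite (_ : a - d' = - (b - a) + (b - d')); last by ring.
apply: (le_trans (ler_normD _ _)); rewrite normrN; apply: (le_trans (lerD b1 b2)).
by rewrite -rmorphD lecR (_ : r / 4 + r / 4 = r / 2) //; field.
Qed.

Definition unit_circle (t : R) : C := cos (2 * pi * t) +i* sin (2 * pi * t).

Definition circ (c : C) (r : R) (t : R) : C := c + r%:C * unit_circle t.

Lemma norm_unit_circle t : `|unit_circle t| = 1.
Proof. by rewrite normc_def /= cos2Dsin2 sqrtr1. Qed.

Lemma norm_circ c r t : 0 <= r -> `|circ c r t - c| = r%:C.
Proof.
by move=> r0; rewrite /circ addrC addKr normrM norm_unit_circle mulr1 normc_real
    ger0_norm.
Qed.

Lemma circ01 c r : circ c r 1 = circ c r 0.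
Proof.
by rewrite /circ /unit_circle mulr1 mulr0 cos0 sin0 mulr_natl cos2pi sin2pi.
Qed.

Lemma curve_deriv_circ c r t :
  curve_deriv (circ c r) t ((2 * pi)%:C * 'i%C * (circ c r t - c)).
Proof.
have dl : is_derive t (1 : R) (fun t : R => 2 * pi * t) (2 * pi).
  by rewrite -[X in is_derive _ _ _ X]mulr1; apply: is_deriveZ.
have dc : is_derive t (1 : R) (fun t : R => cos (2 * pi * t)) (- sin (2 * pi * t) *
    (2 * pi)).
  exact: (@is_derive1_comp _ cos (fun t => 2 * pi * t)).
have ds : is_derive t (1 : R) (fun t : R => sin (2 * pi * t)) (cos (2 * pi * t) *
    (2 * pi)).
  exact: (@is_derive1_comp _ sin (fun t => 2 * pi * t)).
have uE : circ c r t - c = r%:C * unit_circle t by rewrite /circ addrC addKr.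
rewrite uE; apply/curve_derivP; split.
  have -> : re \o circ c r = fun t => re c + r * cos (2 * pi * t).
    by apply/funext => s; rewrite /circ /= raddfD /= mul0r subr0.
  rewrite (_ : re (_ * _) = 0 + r *: (- sin (2 * pi * t) * (2 * pi))).
    exact: (is_deriveD (is_derive_cst (re c) t (1 : R)) (is_deriveZ r dc)).
  by rewrite /unit_circle /GRing.scale /=; ring.
have -> : im \o circ c r = fun t => im c + r * sin (2 * pi * t).
  by apply/funext => s; rewrite /circ /= raddfD /= mul0r addr0.
rewrite (_ : im (_ * _) = 0 + r *: (cos (2 * pi * t) * (2 * pi))).
  exact: (is_deriveD (is_derive_cst (im c) t (1 : R)) (is_deriveZ r ds)).
by rewrite /unit_circle /GRing.scale /=; ring.
Qed.

Lemma curve_deriv_continuous (G : R -> C) t l : curve_deriv G t l ->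
  {for t, continuous G}.
Proof.
move=> /curve_derivP[dr di]; apply/continuous_complexP; split.
  by apply/differentiable_continuous/derivable1_diffP; exact: (@ex_derive _ _ _ _ _
      _ _ dr).
by apply/differentiable_continuous/derivable1_diffP; exact: (@ex_derive _ _ _ _ _ _ _ di).
Qed.

Lemma continuous_circ c r : continuous (circ c r).
Proof. by move=> t; apply: curve_deriv_continuous (curve_deriv_circ c r t). Qed.

End Cauchy.

Section Cauchy.
Context {R : realType}.
Local Notation C := R[i].
Implicit Types (f g : C -> C) (z w c : C).

Lemma segment_cst (K : C -> C) :
  (forall s : R, s \in `[0, 1] -> is_derive (s%:C : C) (1 : C) K 0) -> K 1 = K 0.
Proof.
move=> dK.
have dG (s : R) : s \in `[0, 1] -> curve_deriv (K \o (fun s : R => 0 + s%:C * 1)) s 0.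
  move=> s01; have Ks := dK s s01.
  have E : 0 + s%:C * 1 = s%:C :> C by rewrite add0r mulr1.
  have d0 : derive1 K (0 + s%:C * 1) * 1 = 0.
    by rewrite E derive1E derive_val mul0r.
  have dKs : derivable K (0 + s%:C * 1) 1 by rewrite E; exact: ex_derive.
  by have := curve_deriv_comp dKs (curve_deriv_line 0 1 s); rewrite d0.
have := curve_mvt dG (b := 0); rewrite mulr0 /= !mulr1 !add0r => H.
by apply/subr0_eq/normr0_eq0/le_anti; rewrite normr_ge0 H // => s _; rewrite normr0.
Qed.

(** The integral of a derivative along a closed curve vanishes; [a] collects constant factors such
    as 2 pi i. *)
Lemma cmean_circ_deriv (G d : R -> C) (a : C) : continuous d -> a != 0 ->
  (forall t, curve_deriv G t (a * d t)) -> G 1 = G 0 -> cmean d = 0.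
Proof.
move=> cd a0 dG G01; apply: (mulfI a0); rewrite mulr0 -(cmeanZ a cd).
have cad : continuous (fun t => a * d t) by move=> t; apply: cvgMr; exact: cd.
by rewrite (cmean_deriv cad dG) G01 subrr.
Qed.

Lemma twopi_i_neq0 : (2 * pi : R)%:C * 'i%C != 0 :> C.
Proof.
rewrite mulf_neq0 //; last by rewrite -normr_eq0 normc_i oner_eq0.
by rewrite -[0]/(0%:C) (inj_eq (@complexI _)) gt_eqF // mulr_gt0 // pi_gt0.
Qed.

Lemma circ_neq c (r : R) w t : 0 <= r -> `|w - c| < r%:C -> circ c r t - w != 0.
Proof.
move=> r0 wr; apply: contraTneq wr => /subr0_eq <-.
by rewrite norm_circ // ltxx.
Qed.

Lemma circ_neq_out c (r : R) w t : 0 <= r -> r%:C < `|w - c| -> circ c r t - w != 0.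
Proof.
move=> r0 wr; apply: contraTneq wr => /subr0_eq <-.
by rewrite norm_circ // ltxx.
Qed.

Lemma continuous_circB c r w : continuous (fun t => circ c r t - w).
Proof. by move=> t; apply: cvgB; [exact: continuous_circ|exact: cvg_cst]. Qed.

Lemma continuous_circ_ratio c (r : R) w : 0 <= r -> `|w - c| < r%:C ->
  continuous (fun t => (circ c r t - c) / (circ c r t - w)).
Proof.
move=> r0 wr t; apply: cvgM; first exact: continuous_circB.
apply: cvgV; first exact: circ_neq.
exact: continuous_circB.
Qed.

Section Homotopy.
Variables (f : C -> C) (c w : C) (r r' : R).
Hypotheses (r0 : 0 < r) (rr' : r < r') (wr : `|w - c| < r%:C)
  (fC1 : forall z, `|z - c| < r'%:C -> C1_at f z).

Let z := circ c r.
Let phi t := (z t - c) / (z t - w).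
(** The derivative in [s] of f(w + s (z - w)) times [phi]: the factor z - w from the chain rule
    cancels the denominator of [phi]. *)
Let coef (s : R) t := derive1 f (w + s%:C * (z t - w)) * (z t - c).

Let cphi : continuous phi. Proof. exact: continuous_circ_ratio (ltW r0) wr. Qed.

Let seg_le (s t : R) : s \in `[0, 1] -> `|w + s%:C * (z t - w) - c| <= r%:C.
Proof.
rewrite in_itv /= => /andP[s0 s1].
have -> : w + s%:C * (z t - w) - c = (1 - s)%:C * (w - c) + s%:C * (z t - c).
  by rewrite rmorphB /=; ring.
apply: (le_trans (ler_normD _ _)); rewrite !normrM !normc_real norm_circ ?(ltW r0) //.
have s1' : 0 <= 1 - s by rewrite subr_ge0.
rewrite (ger0_norm s0) (ger0_norm s1').
rewrite [leRHS](_ : _ = (1 - s)%:C * r%:C + s%:C * r%:C); last first.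
  by rewrite rmorphB /=; ring.
by rewrite lerD2r; apply: ler_wpM2l; [rewrite lecR subr_ge0|exact: (ltW wr)].
Qed.

Let zw_le t : `|z t - w| <= (2 * r)%:C.
Proof.
have -> : z t - w = (z t - c) - (w - c) by ring.
apply: (le_trans (ler_normB _ _)); rewrite norm_circ ?(ltW r0) //.
by rewrite mulr_natl mulr2n rmorphD lerD2l (ltW wr).
Qed.

Let seg_C1 (s t : R) : s \in `[0, 1] -> C1_at f (w + s%:C * (z t - w)).
Proof.
by move=> s01; apply: fC1; rewrite (le_lt_trans (seg_le t s01)) // ltcR.
Qed.

Let cseg (s : C) : continuous (fun t => w + s * (z t - w)).
Proof.
move=> t; apply: cvgD; first exact: cvg_cst.
by apply: cvgMr; exact: continuous_circB.
Qed.

Let ccoef s : s \in `[0, 1] -> continuous (coef s).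
Proof.
move=> s01 t; apply: cvgM; last exact: continuous_circB.
have [_ cf] := seg_C1 t s01.
exact: (continuous_comp (@cseg s%:C t) cf).
Qed.

(** For s nonzero, 2 pi i s times [coef s] is the t-derivative of f along the closed curve w + s (z
    - w). At s = 0 this factor is lost, but [coef] is then a constant multiple of z - c. *)
Let cmean_coef s : s \in `[0, 1] -> cmean (coef s) = 0.
Proof.
move=> s01; have [s0|s0] := eqVneq s 0.
  have dz : cmean (fun t => z t - c) = 0.
    apply: (cmean_circ_deriv (a := (2 * pi)%:C * 'i%C) (G := z)).
    - exact: continuous_circB.
    - exact: twopi_i_neq0.
    - by move=> t; exact: curve_deriv_circ.
    - exact: circ01.
  have -> : coef s = fun t => derive1 f w * (z t - c).
    by apply/funext => t; rewrite /coef s0 mul0r addr0.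
  by rewrite (cmeanZ _ (@continuous_circB c r c)) dz mulr0.
apply: (cmean_circ_deriv (a := s%:C * ((2 * pi)%:C * 'i%C))
   (G := f \o (fun t => w + s%:C * (z t - w)))).
- exact: ccoef.
- by rewrite mulf_neq0 ?twopi_i_neq0 // -[0]/(0%:C) (inj_eq (@complexI _)).
- move=> t; have [/nbhs_singleton df _] := seg_C1 t s01.
  have -> : s%:C * ((2 * pi)%:C * 'i%C) * coef s t =
      derive1 f (w + s%:C * (z t - w)) * (s%:C * ((2 * pi)%:C * 'i%C * (z t - c))).
    by rewrite /coef; ring.
  apply: curve_deriv_comp => //.
  have -> : (fun t => w + s%:C * (z t - w)) = (fun y => w + s%:C * (y - w)) \o z by [].
  have dF y : is_derive (y : C) (1 : C) (fun y => w + s%:C * (y - w)) s%:C.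
    have dyw : is_derive (y : C) (1 : C) (fun y => y - w) (1 - 0).
      exact: is_deriveB.
    have := is_deriveD (is_derive_cst w y (1 : C)) (is_deriveZ s%:C dyw).
    by rewrite add0r subr0 /GRing.scale /= mulr1.
  rewrite -[X in X * _](_ : derive1 (fun y => w + s%:C * (y - w)) (z t) = s%:C);
      last first.
    by rewrite derive1E; have := dF (z t) => dFz; rewrite derive_val.
  apply: curve_deriv_comp; last exact: curve_deriv_circ.
  by have := dF (z t) => dFz; exact: ex_derive.
- by rewrite /= /z circ01.
Qed.

Let near_seg_continuous (s : R) : s \in `[0, 1] ->
  \forall Y \near (s%:C : C), continuous (fun t => f (w + Y * (z t - w)) * phi t).
Proof.
move=> s01.
(* Since |z - w| <= 2 r, moving the parameter by less than (r' - r) / (2 r) moves the point by less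
   than r' - r, so it stays in the disc where f is [C1_at]. *)
have d0 : 0 < (r' - r) / (2 * r) by rewrite divr_gt0 ?mulr_gt0 // subr_gt0.
have : \forall Y \near (s%:C : C), `|s%:C - Y| < ((r' - r) / (2 * r))%:C.
  by apply/nbhs_normP; exists ((r' - r) / (2 * r))%:C => //=; rewrite ltcR.
apply: filterS => Y sY t; apply: cvgM; last exact: cphi.
have : C1_at f (w + Y * (z t - w)).
  apply: fC1.
  have -> : w + Y * (z t - w) - c =
    (w + s%:C * (z t - w) - c) - (s%:C - Y) * (z t - w) by ring.
  apply: (le_lt_trans (ler_normB _ _)); rewrite normrM.
  have -> : r'%:C = r%:C + ((r' - r) / (2 * r))%:C * (2 * r)%:C :> C.
    rewrite -rmorphM -rmorphD; congr (_%:C); field.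
    by rewrite gt_eqF.
  apply: ler_ltD; first exact: seg_le.
  have [zw|zw] := eqVneq (z t - w) 0.
    by rewrite zw normr0 mulr0 -rmorphM ltcR mulr_gt0 // mulr_gt0.
  apply: (@lt_le_trans _ _ (((r' - r) / (2 * r))%:C * `|z t - w|)).
    by rewrite ltr_pM2r // normr_gt0.
  by apply: ler_wpM2l; [rewrite lecR ltW|exact: zw_le].
move/C1_continuous => cf; exact: (continuous_comp (@cseg Y t) cf).
Qed.

Let seg_family_diff (s : R) : s \in `[0, 1] ->
  family_diff (fun (t : R) (Y : C) => f (w + Y * (z t - w)) * phi t) (s%:C : C)
    (fun (t : R) (H : C) => coef s t * H).
Proof.
move=> s01 t.
have o1 : little_o t (fun p : R * C =>
    f (w + (s%:C + p.2) * (z p.1 - w)) - f (w + s%:C * (z p.1 - w)) -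
    derive1 f (w + s%:C * (z p.1 - w)) * (p.2 * (z p.1 - w))).
  move=> e e0.
  have r20 : 0 < (2 * r)%:C :> C by rewrite ltcR mulr_gt0.
  have e1 : 0 < e / (2 * r)%:C by rewrite divr_gt0.
  have := strict_diff (seg_C1 t s01) e1.
  have c1 : w + s%:C * (z p.1 - w) @[p --> ((t, 0) : R * C)] --> w + s%:C * (z t - w).
    exact: (@cvg_comp _ _ _ (fun p : R * C => p.1) (fun t => w + s%:C * (z t - w))
        _ _ _ cvg_fst (@cseg s%:C t)).
  have c2 : p.2 * (z p.1 - w) @[p --> ((t, 0) : R * C)] --> 0.
    rewrite -[X in _ --> X](mul0r (z t - w)); apply: cvgM; first exact: cvg_snd.
    exact: (@cvg_comp _ _ _ (fun p : R * C => p.1) (fun t => z t - w) _ _ _ cvg_fst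
        (@continuous_circB c r w t)).
  move=> /(cvg_pair c1 c2) H.
  apply: (@filterS _ (nbhs ((t, 0) : R * C)) _ _ _ _ H) => p /=.
  have -> : w + s%:C * (z p.1 - w) + p.2 * (z p.1 - w) =
            w + (s%:C + p.2) * (z p.1 - w) by ring.
  move=> /le_trans; apply; rewrite normrM mulrA (mulrAC e).
  rewrite [leRHS](_ : _ = e * `|p.2| / (2 * r)%:C * (2 * r)%:C).
    by apply: ler_wpM2l; [rewrite !mulr_ge0 ?invr_ge0 // ltW|exact: zw_le].
  by rewrite divfK // gt_eqF.
have cp : phi p.1 @[p --> ((t, 0) : R * C)] --> phi t.
  exact: (@cvg_comp _ _ _ (fun p : R * C => p.1) phi _ _ _ cvg_fst (@cphi t)).
have := little_oM o1 cp; congr little_o; apply/funext => p.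
have zw : z p.1 - w != 0 by exact: circ_neq (ltW r0) wr.
by rewrite /coef /phi; field.
Qed.

(** At [Y] = 1 the curve is the circle, at [Y] = 0 it has shrunk to the point [w], and the mean has
    zero derivative in between. [Y] is a complex variable because [cmean_diff] works over complex
    spaces. *)
Lemma cauchy_homotopy :
  cmean (fun t => f (z t) * phi t) = f w * cmean phi.
Proof.
pose K (Y : C) := cmean (fun t => f (w + Y * (z t - w)) * phi t).
have K10 : K 1 = K 0.
  apply: segment_cst => s s01.
  have dK : is_diff (s%:C : C) K (fun H => cmean (fun t => coef s t * H)).
    apply: (@cmean_diff _ _ (fun (t : R) (Y : C) => f (w + Y * (z t - w)) * phi t) s%:C
      (fun (t : R) (H : C) => coef s t * H)).
    - exact: near_seg_continuous.
    - by move=> H t; apply: cvgMl; exact: ccoef.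
    - by move=> t a u v; rewrite /GRing.scale /=; ring.
    - apply: family_bndM; first exact: ccoef.
      move=> t; exists 1; [exact: ltr01|].
      by apply: (@nearW _ (nbhs t)) => t' H; rewrite mul1r.
    - exact: seg_family_diff.
  have dfK : differentiable K (s%:C : C) by [].
  apply: DeriveDef; first exact: diff_derivable.
  rewrite deriveE // diff_val; have := cmean_coef s01; congr (_ = 0); congr cmean.
  by apply/funext => t; rewrite mulr1.
have <- : K 1 = cmean (fun t => f (z t) * phi t).
  by congr cmean; apply/funext => t; rewrite mul1r addrC subrK.
rewrite K10 /K -(cmeanZ (f w) cphi).
by congr cmean; apply/funext => t; rewrite mul0r addr0.
Qed.

End Homotopy.
End Cauchy.

Section CauchyFormula.
Context {R : realType}.
Local Notation C := R[i].
Implicit Types (f g : C -> C) (z w c : C).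

Lemma open_norm_lt (V : normedModType C) (a : V) (r : C) :
  open [set y : V | `|y - a| < r].
Proof.
rewrite openE => x /= xr; apply/nbhs_normP; exists (r - `|x - a|).
  by rewrite /= subr_gt0.
move=> y /=; rewrite ltrBrDr => xy; apply: le_lt_trans xy.
by rewrite -(subrKA x) (le_trans (ler_normD _ _)) // distrC.
Qed.

Lemma is_deriveV_complex f (y d : C) : f y != 0 -> is_derive y (1 : C) f d ->
  is_derive y (1 : C) (fun y => (f y)^-1) (- (f y)^-1 ^+ 2 * d).
Proof.
move=> fy dfy; have [df dE] := dfy.
apply: DeriveDef; first exact: derivableV.
by rewrite (deriveV fy df) dE exprVn.
Qed.

Lemma good_exp (V : normedModType C) (A : set V) (g : R -> V -> C) k :
  good_family A g -> good_family A (fun t X => g t X ^+ k).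
Proof.
move=> gg; elim: k => [|k IH].
  under [X in good_family _ X]eq_fun => t do under eq_fun => X do rewrite expr0.
  by apply: (@good_cst _ _ _ (fun=> 1)); exact: cst_continuous.
under [X in good_family _ X]eq_fun => t do under eq_fun => X do rewrite exprS.
exact: good_mul.
Qed.

Lemma is_derive_inv_sub (a y : C) : a - y != 0 ->
  is_derive y (1 : C) (fun y => (a - y)^-1) ((a - y)^-1 ^+ 2).
Proof.
move=> ay.
have dl : is_derive y (1 : C) (fun y => a - y) (0 - 1) by exact: is_deriveB.
have := @is_deriveV_complex (fun y => a - y) y _ ay dl.
by rewrite sub0r mulrN1 opprK.
Qed.

Lemma is_derive_inv_sub_exp (a y : C) k : a - y != 0 ->
  is_derive y (1 : C) (fun y => (a - y)^-1 ^+ k.+1)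
    (k.+1%:R * (a - y)^-1 ^+ k.+2).
Proof.
move=> ay; have d := is_derive_inv_sub ay.
have := is_deriveX k.+1 d.
rewrite exprfctE; congr (is_derive _ _ _ _).
by rewrite /GRing.scale /= -mulrA -exprD addn2.
Qed.

Variables (c : C) (r : R).
Hypothesis r0 : 0 < r.
Let z := circ c r.

(** On the circle, 1 / (z - w)^2 has the primitive -1 / (z - w). *)
Lemma cmean_inv_sqr w : (forall t, z t - w != 0) ->
  cmean (fun t => (z t - c) * (z t - w)^-1 ^+ 2) = 0.
Proof.
move=> zw; pose F y : C := (y - w)^-1.
have ci : continuous (fun t => (z t - w)^-1).
  by move=> t; apply: cvgV; [exact: zw|exact: continuous_circB].
apply: (cmean_circ_deriv (a := - ((2 * pi)%:C * 'i%C)) (G := F \o z)).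
- move=> t; apply: cvgM; first exact: continuous_circB.
  exact: (cvgM (@ci t) (@ci t)).
- by rewrite oppr_eq0 twopi_i_neq0.
- move=> t.
  have dl : is_derive (z t) (1 : C) (fun y => y - w) (1 - 0) by exact: is_deriveB.
  have dF := @is_deriveV_complex (fun y => y - w) (z t) _ (zw t) dl.
  have dFE : derive1 F (z t) = - (z t - w)^-1 ^+ 2.
    by rewrite derive1E derive_val subr0 mulr1.
  have -> : - ((2 * pi)%:C * 'i%C) * ((z t - c) * (z t - w)^-1 ^+ 2) =
     derive1 F (z t) * ((2 * pi)%:C * 'i%C * (z t - c)) by rewrite dFE; ring.
  apply: curve_deriv_comp; last exact: curve_deriv_circ.
  exact: ex_derive.
- by rewrite /= /z circ01.
Qed.

(** The pole is moved from [c] to [w] along c + T (w - c). The derivative in [T] is w - c times a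
    mean as in [cmean_inv_sqr], hence zero, and at T = 0 the integrand is 1. *)
Lemma cauchy_index w : `|w - c| < r%:C ->
  cmean (fun t => (z t - c) / (z t - w)) = 1.
Proof.
move=> wr; pose A := [set T : C | `|T * (w - c) - 0| < r%:C].
have oA : open A.
  apply: (@open_comp _ _ (fun T : C => T * (w - c)) [set y | `|y - 0| < r%:C]).
    by move=> T _; exact: mulrr_continuous.
  exact: open_norm_lt.
pose g (t : R) (T : C) := (z t - c) * ((z t - c) + - (T * (w - c)))^-1.
have nz (t : R) (T : C) : A T -> (z t - c) + - (T * (w - c)) != 0.
  rewrite /A /= subr0 => Tr; apply: contraTneq Tr => /subr0_eq <-.
  by rewrite norm_circ ?ltxx // ltW.
have gg : good_family A g.
  apply: good_mul; first by apply: good_cst; exact: continuous_circB.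
  apply: good_inv; last by move=> t T; exact: nz.
  apply: good_add; first by apply: good_cst; exact: continuous_circB.
  apply: good_lin; first by move=> a u v; rewrite /GRing.scale /=; ring.
  by exists `|w - c| => H; rewrite normrN normrM mulrC.
pose K (T : C) := cmean (g^~ T).
have K10 : K 1 = K 0.
  apply: segment_cst => s; rewrite in_itv /= => /andP[s0 s1].
  have As : A s%:C.
    rewrite /A /= subr0 normrM normc_real (ger0_norm s0); apply: le_lt_trans wr.
    by apply: ler_piMl => //; rewrite -[1]/(1%:C) lecR.
  have zE t : z t - (c + s%:C * (w - c)) = z t - c + - (s%:C * (w - c)).
    by rewrite opprD addrA.
  have dg (t : R) : is_derive (s%:C : C) (1 : C) (g t)
      ((w - c) * ((z t - c) * (z t - (c + s%:C * (w - c)))^-1 ^+ 2)).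
    have dl : is_derive (s%:C : C) (1 : C) (fun T => (z t - c) + - (T * (w - c)))
        (0 - (w - c)).
      have E : (fun T : C => (z t - c) + - (T * (w - c))) =
          cst (z t - c) - (w - c) *: id.
        by apply/funext => T; rewrite !fctE mulrC.
      rewrite E (_ : 0 - (w - c) = 0 - (w - c) *: 1); last by rewrite /GRing.scale
          /= mulr1.
      exact: (is_deriveB (is_derive_cst (z t - c) (s%:C : C) (1 : C)) (is_deriveZ
          (w - c) (is_derive_id (s%:C : C) (1 : C)))).
    have := is_deriveZ (z t - c) (@is_deriveV_complex (fun T => (z t - c) + - (T *
        (w - c))) s%:C _ (nz t _ As) dl).
    rewrite -zE sub0r mulrNN; congr (is_derive _ _ _ _).
    by rewrite /GRing.scale /=; ring.
  have := good_family_derive oA As gg dg.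
  rewrite (_ : cmean _ = 0) //.
  have cc : continuous (fun t => (z t - c) * (z t - (c + s%:C * (w - c)))^-1 ^+ 2).
    move=> t; apply: cvgM; first exact: continuous_circB.
    have ci : {for t, continuous (fun t => (z t - (c + s%:C * (w - c)))^-1)}.
      by apply: cvgV; [rewrite zE; exact: nz|exact: continuous_circB].
    exact: (cvgM ci ci).
  rewrite (cmeanZ _ cc) cmean_inv_sqr ?mulr0 // => t.
  by rewrite zE; exact: nz.
have <- : K 1 = cmean (fun t => (z t - c) / (z t - w)).
  by congr cmean; apply/funext => t; rewrite /g; congr (_ / _); ring.
rewrite K10 -[RHS](cmean_cst 1); congr cmean; apply/funext => t.
rewrite /g mul0r oppr0 addr0 divff //; apply: circ_neq; first exact: ltW.
by rewrite subrr normr0 ltcR.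
Qed.

Lemma cauchy_formula f (r' : R) w : r < r' ->
  (forall y, `|y - c| < r'%:C -> C1_at f y) -> `|w - c| < r%:C ->
  cmean (fun t => f (z t) * ((z t - c) / (z t - w))) = f w.
Proof.
move=> rr' fC1 wr; rewrite (cauchy_homotopy r0 rr' wr fC1).
by rewrite -/z cauchy_index // mulr1.
Qed.

Lemma continuous_on_circ f (r' : R) : r < r' ->
  (forall y, `|y - c| < r'%:C -> C1_at f y) -> continuous (f \o z).
Proof.
move=> rr' fC1 t; apply: (continuous_comp (@continuous_circ _ c r t)).
by apply/C1_continuous/fC1; rewrite norm_circ ?ltcR // ltW.
Qed.

(** Each differentiation in [w] under the integral sign raises the power of (z - w)^-1 by one and
    brings out a factor d + 1, which builds up the factorial. *)
Lemma cauchy_derive1n f (r' : R) w d : r < r' ->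
  (forall y, `|y - c| < r'%:C -> C1_at f y) -> `|w - c| < r%:C ->
  derive1n d f w = d`!%:R *
    cmean (fun t => f (z t) * (z t - c) * (z t - w)^-1 ^+ d.+1).
Proof.
move=> rr' fC1; elim: d w => [|d IH] w wr.
  rewrite derive1n0 mul1r -(cauchy_formula rr' fC1 wr).
  by congr cmean; apply/funext => t; rewrite expr1 mulrA.
pose A := [set y : C | `|y - c| < r%:C].
have oA : open A by exact: open_norm_lt.
pose g (t : R) (y : C) := f (z t) * (z t - c) * (z t - y)^-1 ^+ d.+1.
have cfz : continuous (fun t => f (z t) * (z t - c)).
  move=> t; apply: cvgM; last exact: continuous_circB.
  exact: (continuous_on_circ rr' fC1).
have nz t y : A y -> z t - y != 0 by apply: circ_neq; exact: ltW.
have gg e : good_family A (fun t y => f (z t) * (z t - c) * (z t - y)^-1 ^+ e).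
  apply: good_mul; first exact: good_cst.
  apply: good_exp; apply: good_inv; last by move=> t y; exact: nz.
  apply: good_add; first by apply: good_cst; exact: continuous_circ.
  apply: good_lin; first by move=> a u v; rewrite /GRing.scale /=; ring.
  by exists 1 => H; rewrite normrN mul1r.
pose k (t : R) := f (z t) * (z t - c) * (z t - w)^-1 ^+ d.+2.
have dg (t : R) : is_derive w (1 : C) (g t) (d.+1%:R * k t).
  have := is_deriveZ (f (z t) * (z t - c)) (is_derive_inv_sub_exp d (nz t w wr)).
  by congr (is_derive _ _ _ _); rewrite /GRing.scale /= /k; ring.
have ck : continuous k by exact: (good_family_continuous (gg d.+2) wr).
have dm := good_family_derive oA wr (gg d.+1) dg.
rewrite derive1nS derive1E.
have E : \forall y \near w, derive1n d f y = d`!%:R * cmean (g^~ y).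
  have : \forall y \near w, A y by exact: open_nbhs_nbhs.
  by apply: filterS => y; exact: IH.
rewrite (near_eq_derive _ E).
have := is_deriveZ (d`!%:R : C) dm => dm'.
have -> : 'D_1 (fun y => d`!%:R * cmean (g^~ y)) w = d`!%:R *: cmean (fun t =>
    d.+1%:R * k t).
  by have [_ <-] := dm'.
by rewrite (cmeanZ _ ck) /GRing.scale /= mulrA -natrM mulnC -factS.
Qed.

(** Cauchy's formula at the centre, for h(y) = f(y) (y - c) / (y - w)^(d+1): h vanishes at [c], and
    it is C^1 on the disc of radius min(r', |w - c|), which is larger than r since the pole lies
    outside the circle. *)
Lemma cauchy_out f (r' : R) w d : r < r' ->
  (forall y, `|y - c| < r'%:C -> C1_at f y) -> r%:C < `|w - c| ->
  cmean (fun t => f (z t) * (z t - c) * (z t - w)^-1 ^+ d.+1) = 0.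
Proof.
move=> rr' fC1 wr.
have [p p0 pE] := ge0_complexP (normr_ge0 (w - c)).
have rp : r < p by move: wr; rewrite pE ltcR.
pose h (y : C) := f y * (y - c) * (y - w)^-1 ^+ d.+1.
have C1B y a : C1_at (fun y : C => y - a) y by apply: C1D (C1_id _) (C1_cst _ _).
have hC1 y : `|y - c| < (Num.min r' p)%:C -> C1_at h y.
  move=> yr.
  have yr' : `|y - c| < r'%:C by apply: (lt_le_trans yr); rewrite lecR ge_min lexx.
  have yp : y - w != 0.
    apply: contraTneq yr => /subr0_eq ->.
    by rewrite pE ltcR lt_min ltxx andbF.
  apply: C1M; first by apply: C1M (fC1 _ yr') (C1B _ _).
  elim: d.+1 => [|k IH].
    by under eq_fun => x do rewrite expr0; exact: C1_cst.
  under eq_fun => x do rewrite exprS.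
  by apply: C1M IH; exact: C1V (C1B _ _) yp.
have rm : r < Num.min r' p by rewrite lt_min rr' rp.
have c0 : `|c - c| < r%:C by rewrite subrr normr0 ltcR.
have := cauchy_formula rm hC1 c0; rewrite /h subrr mulr0 mul0r => <-.
congr cmean; apply/funext => t; rewrite divff ?mulr1 //.
by apply: circ_neq c0; exact: ltW.
Qed.


End CauchyFormula.

(** * Jordan form and resolvent *)

Section Jordan.
Context {R : realType}.
Local Notation C := R[i].

Lemma horner_mx_eigen m n (A : 'M[C]_n.+1) (M : 'M[C]_(m, n.+1)) (a : C)
    (q : {poly C}) :
  M *m A = a *: M -> M *m horner_mx A q = q.[a] *: M.
Proof.
move=> MA; elim/poly_ind: q => [|q c IH].
  by rewrite rmorph0 mulmx0 horner0 scale0r.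
rewrite rmorphD rmorphM /= horner_mx_C horner_mx_X mulmxDr mulmxA IH.
rewrite -scalemxAl MA !hornerE scalerA scalerDl -(mul_mx_scalar c).
by [].
Qed.

Lemma jordan_blockE s (a : C) : jordan_block s a =
  a%:M + \matrix_(x, y) (y == x.+1 :> nat)%:R.
Proof.
apply/matrixP => x y; rewrite !mxE.
have [->|xy] := eqVneq x y; last by rewrite mulr0n add0r; case: ifP.
by rewrite mulr1n (_ : _ == _ = false) ?addr0 //; apply/negbTE; rewrite neq_ltn leqnn.
Qed.

Lemma col_mul m n p (A : 'M[C]_(m, n)) (B : 'M[C]_(n, p)) y :
  col y (A *m B) = A *m col y B.
Proof. by apply/colP => x; rewrite !mxE; apply: eq_bigr => z _; rewrite mxE. Qed.

Lemma row_supdiag_mul s p (B : 'M[C]_(s, p)) (x : 'I_s) :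
  row x ((\matrix_(u < s, v < s) (v == u.+1 :> nat)%:R) *m B) =
  if insub x.+1 is Some x' then row x' B else 0.
Proof.
apply/rowP => y; rewrite 2!mxE; case: insubP => [x' _ xx'|xs].
  rewrite (bigD1 x') //= !mxE xx' eqxx mul1r big1 ?addr0 // => z zx.
  rewrite !mxE -xx' (_ : _ == _ = false) ?mul0r //; exact/negbTE.
rewrite mxE big1 // => z _; rewrite mxE (_ : _ == _ = false) ?mul0r //.
by apply: contraNF xs => /eqP <-.
Qed.

Lemma col_mul_supdiag s p (B : 'M[C]_(p, s)) (y : 'I_s) :
  col y (B *m (\matrix_(u < s, v < s) (v == u.+1 :> nat)%:R)) =
  if (y == 0 :> nat)%N then 0
  else if insub y.-1 is Some y' then col y' B else 0.
Proof.
apply/colP => x; rewrite 2!mxE; have [y0|y0] := posnP y.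
  by rewrite mxE big1 // => z _; rewrite mxE y0 mulr0.
case: insubP => [y' _ yy'|].
  rewrite (bigD1 y') //= !mxE yy' prednK // eqxx mulr1 big1 ?addr0 // => z zy.
  rewrite !mxE -(prednK y0) eqSS -yy' eq_sym (_ : _ == _ = false) ?mulr0 //.
  exact/negbTE.
by rewrite (leq_ltn_trans (leq_pred _)).
Qed.

(* A longest Jordan chain, generated by a row vector, and the dual chain of
   column vectors; the common kernel of the latter is an invariant
   complement. *)
Lemma jordan_chain n (A : 'M[C]_n.+1) : exists s (a : C)
    (W : 'M[C]_(s, n.+1)) (U : 'M[C]_(n.+1, s)),
  [/\ (0 < s)%N, W *m A = jordan_block s a *m W,
      A *m U = U *m jordan_block s a & W *m U \in unitmx].
Proof.
have [a ra] : exists a, root (mxminpoly A) a.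
  apply/closed_rootP; rewrite size_mxminpoly eqSS -lt0n.
  exact: mxminpoly_nonconstant.
have p0 : mxminpoly A != 0 by rewrite monic_neq0 // mxminpoly_monic.
have [s [q]] := multiplicity_XsubC (mxminpoly A) a.
rewrite p0 /= => qa pE.
case: s pE => [|s] pE; first by move: ra; rewrite pE mulr1 (negbTE qa).
(* The minimal polynomial is q (X - a)^(s+1) with q(a) nonzero. So with G = q(A) and N = A - a one
   has G N^(s+1) = 0, while G N^s is nonzero by minimality. *)
set N := A - a%:M; set G := horner_mx A q.
have NX k : horner_mx A (('X - a%:P) ^+ k) = N ^+ k.
  by rewrite rmorphXn rmorphB /= horner_mx_X horner_mx_C.
have GN k : G * N ^+ k = N ^+ k * G by rewrite -NX -!rmorphM mulrC.
have GN0 : G * N ^+ s.+1 = 0.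
  by rewrite -NX -rmorphM /= -pE mx_root_minpoly.
have q0 : q != 0 by apply: contra qa => /eqP->; rewrite root0.
have GN1 : G * N ^+ s != 0.
  apply/eqP; rewrite -NX -rmorphM /= => /mxminpoly_min /dvdp_leq.
  rewrite pE mulf_neq0 ?expf_neq0 ?polyXsubC_eq0 // => /(_ isT).
  rewrite !size_mul ?expf_neq0 ?polyXsubC_eq0 // !size_exp_XsubC.
  by rewrite !addnS ltnn.
have [i [j cij]] : exists i j, (G * N ^+ s) i j != 0.
  apply: contrapT => H; case/eqP: GN1; apply/matrixP => i j; rewrite [RHS]mxE.
  by apply: contrapT => ij; apply: H; exists i, j; apply/eqP.
have NA k : N ^+ k *m A = a *: N ^+ k + N ^+ k.+1.
  by rewrite exprSr mulrBr -!mulmxE mul_mx_scalar [RHS]addrC subrK.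
have AN k : A *m N ^+ k = a *: N ^+ k + N ^+ k.+1.
  by rewrite exprS mulrBl -!mulmxE mul_scalar_mx [RHS]addrC subrK.
(* Both chains go through an entry (i, j) at which G N^s is nonzero. The exponent s - y runs through
   the columns backwards, so that the same [jordan_block] governs rows and columns. *)
pose W : 'M[C]_(s.+1, n.+1) := \matrix_(x < s.+1) row i (G *m N ^+ x).
pose U : 'M[C]_(n.+1, s.+1) := (\matrix_(y < s.+1) (col j (G *m N ^+ (s - y)))^T)^T.
have WE x : row x W = row i (G *m N ^+ x) by rewrite rowK.
have UE y : col y U = col j (G *m N ^+ (s - y)) by rewrite -tr_row rowK trmxK.
exists s.+1, a, W, U; split=> //.
- rewrite jordan_blockE mulmxDl mul_scalar_mx; apply/row_matrixP => x.
  rewrite row_mul WE -row_mul -mulmxA NA mulmxDr -scalemxAr !linearD !linearZ /= WE.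
  rewrite row_supdiag_mul; congr (_ + _); case: insubP => [x' _ xx'|].
    by rewrite WE xx'.
  rewrite ltnS -ltnNge ltnS => xs.
  have -> : x = s :> nat by apply/eqP; rewrite eqn_leq xs -ltnS ltn_ord.
  by rewrite mulmxE GN0 row0.
- rewrite jordan_blockE mulmxDr mul_mx_scalar.
  suff colE (B B' : 'M[C]_(n.+1, s.+1)) : (forall y, col y B = col y B') -> B = B'.
    apply: colE => y; rewrite -[LHS]/(col y _) col_mul UE -col_mul.
    have AG : A *m G = G *m A.
      by rewrite mulmxE -[X in X * _ = _](horner_mx_X A)
        -[X in _ = _ * X](horner_mx_X A) -!rmorphM mulrC.
    rewrite mulmxA AG -mulmxA AN mulmxDr -scalemxAr !linearD !linearZ /= UE.
    rewrite col_mul_supdiag; congr (_ + _); have [y0|y0] := posnP y.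
      by rewrite y0 subn0 mulmxE GN0 col0.
    case: insubP => [y' _ yy'|]; last first.
      by rewrite (leq_ltn_trans (leq_pred _)).
    rewrite UE yy'; congr (col j (_ *m _ ^+ _)).
    by have := ltn_ord y; lia.
  by move=> H; apply/matrixP => x y; move/colP: (H y) => /(_ x); rewrite !mxE.
- have WUE x y : (W *m U) x y = (G * (G * N ^+ (s - y + x))) i j.
    have -> : (W *m U) x y = (row x W *m col y U) 0 0.
      by rewrite !mxE; apply: eq_bigr => z _; rewrite !mxE.
    have rowcol (M M' : 'M[C]_n.+1) : (row i M *m col j M') 0 0 = (M *m M') i j.
      by rewrite !mxE; apply: eq_bigr => z _; rewrite !mxE.
    rewrite WE UE rowcol addnC exprD !mulmxE !mulrA; congr (fun_of_matrix (_ * _) i j).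
    by rewrite -(mulrA G _ G) -GN mulrA.
  (* The rows of G N^s are left eigenvectors of A, so multiplication by G acts on them as q(a): the
     diagonal of W U is constant and nonzero. Below the diagonal the exponent reaches s + 1, so W U
     is upper triangular, hence invertible. *)
  have NNA : (G * N ^+ s) *m A = a *: (G * N ^+ s).
    by rewrite -mulmxE -mulmxA NA mulmxDr [X in _ + X]GN0 addr0 scalemxAr.
  have diagE x : (W *m U) x x = q.[a] * (G * N ^+ s) i j.
    have xs : (x <= s)%N by rewrite -ltnS.
    rewrite WUE subnK // {1}GN mulrA.
    by move/matrixP/(_ i j): (horner_mx_eigen q NNA); rewrite [RHS]mxE.
  rewrite unitmxE -det_tr det_trig.
    rewrite unitfE; apply/prodf_neq0 => x _; rewrite mxE diagE.
    by rewrite mulf_neq0.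
  apply/is_trig_mxP => x y xy; rewrite mxE WUE.
  have -> : (s - x + y = s.+1 + (y - x.+1))%N.
    by move: (ltn_ord x) (ltn_ord y) xy => /=; lia.
  by rewrite exprD (mulrA G (N ^+ s.+1)) GN0 mul0r mulr0 mxE.
Qed.

(** Multiplying a linear relation between the rows of [W] and of [K] by [U] kills [K] and leaves the
    invertible [W *m U]. As the ranks add up to n + 1, the two invariant row spaces together give a
    basis. *)
Lemma jordan_split n (A : 'M[C]_n.+1) : exists s (a : C) r (A' : 'M[C]_r)
    (P : 'M[C]_(n.+1, s + r)) (Q : 'M[C]_(s + r, n.+1)),
  [/\ (0 < s)%N, (s + r)%N = n.+1, P *m Q = 1%:M, Q *m P = 1%:M &
      A = P *m block_mx (jordan_block s a) 0 0 A' *m Q].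
Proof.
have [s [a [W [U [s0 WA AU WU]]]]] := jordan_chain A.
set K := row_base (kermx U).
have rU : \rank U = s.
  apply/eqP; rewrite eqn_leq rank_leq_col /= -{1}(mxrank_unit WU).
  exact: mxrankM_maxr.
have KU : K *m U = 0 by apply/sub_kermxP; rewrite eq_row_base.
have /submxP[A' KA] : (K *m A <= K)%MS.
  rewrite eq_row_base; apply/sub_kermxP.
  by rewrite -mulmxA AU mulmxA KU mul0mx.
have sr : (s + \rank (kermx U))%N = n.+1.
  by rewrite mxrank_ker rU subnKC // -rU rank_leq_row.
have fK : row_free K by exact: row_base_free.
clearbody K; pose B := col_mx W K.
have fB : row_free B.
  apply: inj_row_free => v; rewrite -[v]hsubmxK mul_row_col => vB.
  have v1 : lsubmx v = 0.
    have := congr1 (mulmx^~ U) vB.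
    rewrite /= mulmxDl -!mulmxA KU mulmx0 addr0 mul0mx => /(congr1 (mulmx^~ (invmx
        (W *m U)))).
    by rewrite mulmxK // mul0mx.
  move: vB; rewrite v1 mul0mx add0r => /eqP.
  by rewrite mulmx_free_eq0 // => /eqP ->; rewrite row_mx0.
have uB : row_full B by apply/eqP; rewrite -[RHS]sr; exact/eqP.
exists s, a, _, A', (pinvmx B), B; split=> //.
- exact: mulVpmx.
- exact: mulmxVp.
rewrite -mulmxA mul_block_col !mul0mx addr0 add0r -WA -KA -mul_col_mx mulmxA.
by rewrite mulVpmx // mul1mx.
Qed.

(** [matfun] is an [xget] with default 0; this lemma shows that the default is never taken. Sizes
    and eigenvalues are indexed by [nat], so that prepending a block is a plain case distinction on
    the index. *)
Lemma jordan_form_exists n (A : 'M[C]_n) :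
  exists p (s : nat -> nat) (lambda : nat -> C)
    (P : 'M[C]_(n, \sum_(i < p) s i)) (Q : 'M[C]_(\sum_(i < p) s i, n)),
  @jordan_form R n A p (fun i => s i) (fun i => lambda i) P Q.
Proof.
have [N] := ubnP n; elim: N n A => // N IH [|n] A nN.
  exists 0%N, (fun=> 0%N), (fun=> 0), 0, 0; split.
  - by case.
  - by rewrite [RHS]flatmx0 [LHS]flatmx0.
  - by apply/matrixP => i; exfalso; case: i => i; rewrite big_ord0.
  - by rewrite [A]flatmx0 [RHS]flatmx0.
have [s0 [a [r [A' [P [Q [s0_gt0 sr PQ QP AE]]]]]]] := jordan_split A.
have rN : (r < N)%N.
  by move: nN; rewrite ltnS; apply: leq_trans; rewrite -sr -[X in (X < _)%N]add0n
      ltn_add2r.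
have [p [s [lambda [P' [Q' [s_gt0 PQ' QP' A'E]]]]]] := IH r A' rN.
exists p.+1, (fun k => if k is k'.+1 then s k' else s0),
  (fun k => if k is k'.+1 then lambda k' else a).
(* [mxdiag_recl] carries a cast along an equality of sizes. Eliminating that equality turns the
   index into s0 plus the remaining sum, the form in which block matrices can be written. *)
rewrite /jordan_form mxdiag_recl; set e := mxsize_recl; move: e => /=.
set D := \mxdiag_i _.
have -> : D = \mxdiag_(i < p) jordan_block (s i) (lambda i) by [].
case: _ / => /=.
pose P1 := block_mx 1%:M 0 0 P' : 'M[C]_(s0 + r, _).
pose Q1 := block_mx 1%:M 0 0 Q' : 'M[C]_(_, s0 + r).
exists (P *m P1), (Q1 *m Q); split.
- by case=> -[|k] //= kp; exact: (s_gt0 (Ordinal (kp : (k < p)%N))).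
- rewrite mulmxA -(mulmxA P) mulmx_block !(mul0mx, mulmx0, addr0, add0r) mul1mx.
  by rewrite PQ' -scalar_mx_block mulmx1.
- rewrite mulmxA -(mulmxA Q1) QP mulmx1 mulmx_block.
  by rewrite !(mul0mx, mulmx0, addr0, add0r) mul1mx QP' -scalar_mx_block.
rewrite castmx_id !mulmxA -(mulmxA _ P1) -(mulmxA _ _ Q1) !mulmx_block.
by rewrite !(mul0mx, mulmx0, addr0, add0r) mul1mx mulmx1 -A'E.
Qed.

End Jordan.

(** * Resolvent and eigenvalues of a Jordan form *)

Section JordanResolvent.
Context {R : realType}.
Local Notation C := R[i].

Lemma mxdiag_mul p (s : 'I_p -> nat) (B B' : forall i, 'M[C]_(s i)) :
  (\mxdiag_i B i) *m (\mxdiag_i B' i) = \mxdiag_i (B i *m B' i).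
Proof.
rewrite mul_mxdiag_mxblock; apply/eq_mxblockP => i j.
by case: eqVneq => [->|]; rewrite ?conform_mx_id ?mulmx0.
Qed.

Lemma mxdiag_scalar p (s : 'I_p -> nat) (a : C) :
  \mxdiag_i (a%:M : 'M[C]_(s i)) = a%:M.
Proof.
apply/mxblockP => i j; rewrite mxblockK; apply/matrixP => k l.
rewrite [RHS]mxE [RHS]mxE -(val_eqE (tagnat.Rank i k)) /= tagnat.eq_Rank.
case: (eqVneq i j) l => [<-|ij] l /=; last by rewrite mxE mulr0n.
by rewrite conform_mx_id mxE val_eqE.
Qed.

(** The inverse of [z%:M - jordan_block s a], as the finite geometric series in the nilpotent part.
    Its powers of (z - a)^-1 are those of Cauchy's formulas for the derivatives of f. *)
Definition jordan_resolvent s (a z : C) : 'M[C]_s :=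
  \matrix_(x, y) if (x <= y)%N then (z - a)^-1 ^+ (y - x).+1 else 0.

Lemma jordan_resolventP s (a z : C) : z - a != 0 ->
  (z%:M - jordan_block s a) *m jordan_resolvent s a z = 1%:M.
Proof.
move=> za; rewrite jordan_blockE opprD addrA -raddfB /= mulmxBl mul_scalar_mx.
apply/row_matrixP => x; rewrite linearB /= row_supdiag_mul.
apply/rowP => y; rewrite !mxE; case: insubP => [x' _ xx'|].
  rewrite !mxE xx'; have [xy|yx|/val_inj ->] := ltngtP x y.
  - rewrite -subnSK // exprS mulrA divff // mul1r subrr.
    by rewrite (_ : x == y = false) //; apply/negbTE; rewrite neq_ltn xy.
  - by rewrite mulr0 subr0 (_ : x == y = false) //; apply/negbTE; rewrite neq_ltn yx orbT.
  - by rewrite subnn expr1 divff // subr0 eqxx.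
rewrite -ltnNge ltnS => sx; rewrite mxE subr0.
have xE : x = s.-1 :> nat by have := ltn_ord x; lia.
have [xy|xy] := leqP x y; last first.
  by rewrite mulr0 (_ : x == y = false) //; apply/negbTE; rewrite neq_ltn xy orbT.
have -> : x = y by apply/val_inj => /=; have := ltn_ord y; lia.
by rewrite subnn expr1 divff // eqxx.
Qed.

Section JordanForm.
Variables (n : nat) (A : 'M[C]_n) (p : nat) (s : 'I_p -> nat) (lam : 'I_p -> C)
  (P : 'M[C]_(n, \sum_i s i)) (Q : 'M[C]_(\sum_i s i, n)).
Hypothesis AJ : jordan_form A lam P Q.

Lemma jordan_form_resolvent (z : C) : (forall i, z - lam i != 0) ->
  invmx (z%:M - A) = P *m (\mxdiag_i jordan_resolvent (s i) (lam i) z) *m Q.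
Proof.
move=> zl; have [s0 PQ QP AE] := AJ.
have E : (z%:M - A) *m (P *m (\mxdiag_i jordan_resolvent (s i) (lam i) z) *m Q) = 1%:M.
  have -> : z%:M - A = P *m (\mxdiag_i (z%:M - jordan_block (s i) (lam i))) *m Q.
    rewrite mxdiagB mxdiag_scalar mulmxBr mulmxBl -AE; congr (_ - _).
    by rewrite mul_mx_scalar -scalemxAl PQ scalemx1.
  rewrite !mulmxA -(mulmxA _ Q P) QP mulmx1 -(mulmxA P) mxdiag_mul.
  rewrite (eq_mxdiag (B'_ := fun i => 1%:M)); last first.
    by move=> i; exact: jordan_resolventP.
  by rewrite mxdiag_scalar mulmx1.
have [uA _] := mulmx1_unit E.
by rewrite -[RHS](mulKmx uA) E mulmx1.
Qed.

Lemma jordan_form_size : (\sum_i s i)%N = n.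
Proof.
have [s0 PQ QP AE] := AJ; apply/eqP; rewrite eqn_leq.
have rk (m1 m2 : nat) (X : 'M[C]_(m1, m2)) (Y : 'M[C]_(m2, m1)) : X *m Y = 1%:M ->
    (m1 <= m2)%N.
  move=> XY; have := mxrankM_maxl X Y; rewrite XY mxrank1 => /leq_trans; apply.
  exact: rank_leq_col.
by rewrite (rk _ _ _ _ QP) (rk _ _ _ _ PQ).
Qed.

(** The rank of A - lam i is at most the sum of the ranks of the shifted blocks, and the i-th of
    these has a zero last row, so its rank is less than its size. *)
Lemma jordan_form_eigenvalue i : eigenvalue A (lam i).
Proof.
have [s0 PQ QP AE] := AJ; rewrite /eigenvalue /eigenspace kermx_eq0.
rewrite /row_free neq_ltn; apply/orP; left.
have -> : A - (lam i)%:M = P *m (\mxdiag_k (jordan_block (s k) (lam k) - (lam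
    i)%:M)) *m Q.
  rewrite mxdiagB mxdiag_scalar mulmxBr mulmxBl -AE; congr (_ - _).
  by rewrite mul_mx_scalar -scalemxAl PQ scalemx1.
apply: (leq_ltn_trans (mxrankM_maxl _ _)); apply: (leq_ltn_trans (mxrankM_maxr _ _)).
rewrite rank_mxdiag -[X in (_ < X)%N]jordan_form_size.
rewrite (bigD1 i) //= [X in (_ < X)%N](bigD1 i) //= -addSn leq_add //; last first.
  by apply: leq_sum => k _; exact: rank_leq_row.
have si := s0 i; rewrite ltn_neqAle rank_leq_row andbT.
apply/negP => /row_freeP[Y YE].
have sl : ((s i).-1 < s i)%N by rewrite prednK.
have := congr1 (fun M : 'M[C]_(s i) => row (Ordinal sl) M (0 : 'I_1) (Ordinal sl)) YE.
rewrite jordan_blockE [X in X - _]addrC addrK row_supdiag_mul insubF; last first.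
  by rewrite /= prednK // ltnn.
by rewrite !mxE eqxx => /eqP; rewrite eq_sym oner_eq0.
Qed.

End JordanForm.
End JordanResolvent.

(** * Entrywise means of matrices *)

Section MatrixMean.
Context {R : realType}.
Local Notation C := R[i].

Lemma continuous_sum_fct (J : Type) (l : seq J) (g : J -> R -> C) :
  (forall j, continuous (g j)) -> continuous (fun t => \sum_(j <- l) g j t).
Proof.
move=> cg; elim: l => [|j l IH].
  rewrite (_ : (fun t => _) = fun=> 0); first exact: cst_continuous.
  by apply/funext => t; rewrite big_nil.
rewrite (_ : (fun t => _) = fun t => g j t + \sum_(i <- l) g i t).
  by move=> t; apply: cvgD; [exact: cg|exact: IH].
by apply/funext => t; rewrite big_cons.
Qed.

Lemma cmean_sum (J : Type) (l : seq J) (g : J -> R -> C) :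
  (forall j, continuous (g j)) ->
  cmean (fun t => \sum_(j <- l) g j t) = \sum_(j <- l) cmean (g j).
Proof.
move=> cg; elim: l => [|j l IH].
  by rewrite big_nil -[RHS](cmean_cst 0); congr cmean; apply/funext => t; rewrite big_nil.
rewrite big_cons -IH -(cmeanD (cg j) (@continuous_sum_fct _ l g cg)).
by congr cmean; apply/funext => t; rewrite big_cons.
Qed.

Definition mmean a b (M : R -> 'M[C]_(a, b)) : 'M[C]_(a, b) :=
  \matrix_(i, j) cmean (fun t => M t i j).

Definition mcontinuous a b (M : R -> 'M[C]_(a, b)) :=
  forall i j, continuous (fun t => M t i j).

Lemma mcontinuous_mulr a b c (P : 'M[C]_(a, b)) (M : R -> 'M[C]_(b, c)) :
  mcontinuous M -> mcontinuous (fun t => P *m M t).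
Proof.
move=> cM i j; rewrite (_ : (fun t => _) = fun t => \sum_k P i k * M t k j).
  by apply: continuous_sum_fct => k x; apply: cvgMr; exact: cM.
by apply/funext => t; rewrite mxE.
Qed.

Lemma mmean_mulr a b c (P : 'M[C]_(a, b)) (M : R -> 'M[C]_(b, c)) :
  mcontinuous M -> mmean (fun t => P *m M t) = P *m mmean M.
Proof.
move=> cM; apply/matrixP => i j; rewrite !mxE.
under eq_bigr => k _ do rewrite mxE -(cmeanZ _ (@cM k j)).
rewrite -(@cmean_sum _ _ (fun k t => P i k * M t k j)).
  by congr cmean; apply/funext => t; rewrite mxE.
by move=> k t; apply: cvgMr; exact: cM.
Qed.

Lemma mmean_mull a b c (M : R -> 'M[C]_(a, b)) (Q : 'M[C]_(b, c)) :
  mcontinuous M -> mmean (fun t => M t *m Q) = mmean M *m Q.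
Proof.
move=> cM; apply/matrixP => i j; rewrite !mxE.
under eq_bigr => k _ do rewrite mxE mulrC -(cmeanZ _ (@cM i k)).
rewrite -(@cmean_sum _ _ (fun k t => Q k j * M t i k)).
  congr cmean; apply/funext => t; rewrite mxE.
  by apply: eq_bigr => k _; rewrite mulrC.
by move=> k t; apply: cvgMr; exact: cM.
Qed.

Lemma mmean_diag p (s : 'I_p -> nat) (B : R -> forall i, 'M[C]_(s i)) :
  mmean (fun t => \mxdiag_i B t i) = \mxdiag_i mmean (fun t => B t i).
Proof.
apply/mxblockP => i j; rewrite [RHS]mxblockK; apply/matrixP => k l.
rewrite !mxE.
have E t : (\mxdiag_i B t i) (tagnat.Rank i k) (tagnat.Rank j l) =
  (if i == j then conform_mx 0 (B t i) else 0) k l.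
  rewrite -(mxblockK (fun i j => if i == j then conform_mx 0 (B t i) else 0) i j).
  by rewrite [RHS]mxE.
rewrite (funext E); case: (eqVneq i j) l {E} => [<-|ij] l.
  by rewrite conform_mx_id mxE; congr cmean; apply/funext => t; rewrite conform_mx_id.
rewrite mxE -[RHS](cmean_cst 0); congr cmean; apply/funext => t; by rewrite mxE.
Qed.

Lemma mcontinuous_diag p (s : 'I_p -> nat) (B : R -> forall i, 'M[C]_(s i)) :
  (forall i, mcontinuous (fun t => B t i)) -> mcontinuous (fun t => \mxdiag_i B t i).
Proof.
move=> cB i j; rewrite -(tagnat.sig2K i) -(tagnat.sig2K j).
move: (tagnat.sig1 i) (tagnat.sig2 i) (tagnat.sig1 j) (tagnat.sig2 j) => {i j} i k j l.
have E t : (\mxdiag_i B t i) (tagnat.Rank i k) (tagnat.Rank j l) =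
  (if i == j then conform_mx 0 (B t i) else 0) k l.
  rewrite -(mxblockK (fun i j => if i == j then conform_mx 0 (B t i) else 0) i j).
  by rewrite [RHS]mxE.
rewrite (funext E); case: (eqVneq i j) l {E} => [<-|ij] l.
  rewrite (_ : (fun t => _) = fun t => B t i k l); first exact: cB.
  by apply/funext => t; rewrite conform_mx_id.
rewrite (_ : (fun t => _) = fun=> 0); first exact: cst_continuous.
by apply/funext => t; rewrite mxE.
Qed.

Lemma continuous_exp (g : R -> C) k : continuous g -> continuous (fun t => g t ^+ k).
Proof.
move=> cg; elim: k => [|k IH].
  rewrite (_ : (fun t => _) = fun=> 1); first exact: cst_continuous.
  by apply/funext => t; rewrite expr0.
rewrite (_ : (fun t => _) = fun t => g t * g t ^+ k).
  by move=> t; apply: cvgM; [exact: cg|exact: IH].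
by apply/funext => t; rewrite exprS.
Qed.

End MatrixMean.

(** * Cauchy's formula for matrix functions *)

Section CauchyJordan.
Context {R : realType}.
Local Notation C := R[i].
Variables (f : C -> C) (ev : seq C) (r r' : R).
Hypotheses (r0 : 0 < r) (rr' : r < r') (uev : uniq ev)
  (fC1 : forall u, u \in ev -> forall y, `|y - u| < r'%:C -> C1_at f y)
  (sep : forall u v, u \in ev -> v \in ev -> u != v -> (2 * r)%:C <= `|u - v|).

(** The Riesz-Dunford integral of f(z) (z - X)^-1; the factor [circ u r t - u] comes from dz. *)
Definition cauchy_matrix n (X : 'M[C]_n) : 'M[C]_n :=
  \sum_(u <- ev) mmean (fun t => (f (circ u r t) * (circ u r t - u)) *:
                                   invmx ((circ u r t)%:M - X)).

Lemma far_circle u v (a : C) : u \in ev -> v \in ev -> u != v ->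
  `|a - v| < r%:C -> r%:C < `|a - u|.
Proof.
move=> uev' vev uv av; have := sep uev' vev uv.
have -> : u - v = (a - v) - (a - u) by ring.
move=> /le_trans /(_ (ler_normB _ _)) => H.
have : (2 * r)%:C < r%:C + `|a - u| by apply: (le_lt_trans H); rewrite ltrD2r.
by rewrite mulr_natl mulr2n rmorphD ltrD2l.
Qed.

Lemma circle_neq u (a : C) t : u \in ev ->
  (exists2 v, v \in ev & `|a - v| < r%:C) -> circ u r t - a != 0.
Proof.
move=> uev' [v vev av]; have [uv|uv] := eqVneq u v.
  by apply: circ_neq; [exact: ltW|rewrite uv].
by apply: circ_neq_out; [exact: ltW|exact: (far_circle uev' vev uv av)].
Qed.

Lemma cont_f_circ u : u \in ev ->
  continuous (fun t => f (circ u r t) * (circ u r t - u)).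
Proof.
move=> uev' t; apply: cvgM; last exact: continuous_circB.
exact: (continuous_on_circ r0 rr' (fC1 uev')).
Qed.

(** Only the circle around the [v] close to [a] contributes: [a] lies outside the others by
    [far_circle], and [cauchy_out] applies. The factorial of [cauchy_derive1n] cancels the one in
    [fun_jordan_block]. *)
Lemma fun_jordan_block_cauchy s (a : C) :
  (exists2 v, v \in ev & `|a - v| < r%:C) ->
  fun_jordan_block f s a =
  \sum_(u <- ev) mmean (fun t => (f (circ u r t) * (circ u r t - u)) *:
                                   jordan_resolvent s a (circ u r t)).
Proof.
move=> [v vev av]; apply/matrixP => x y; rewrite summxE mxE.
have [xy|xy] := leqP x y; last first.
  rewrite big1 // => u _; rewrite mxE -[RHS](cmean_cst 0); congr cmean.
  by apply/funext => t; rewrite !mxE leqNgt xy mulr0.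
have E u : (mmean (fun t => (f (circ u r t) * (circ u r t - u)) *:
     jordan_resolvent s a (circ u r t))) x y =
   cmean (fun t => f (circ u r t) * (circ u r t - u) * (circ u r t - a)^-1 ^+ (y - x).+1).
  by rewrite mxE; congr cmean; apply/funext => t; rewrite !mxE xy.
under eq_bigr => u _ do rewrite E.
rewrite (bigD1_seq v) //= big_seq_cond big1 ?addr0; last first.
  move=> u /andP[uev' uv].
  exact: (cauchy_out r0 _ rr' (fC1 uev') (far_circle uev' vev uv av)).
rewrite (cauchy_derive1n r0 _ rr' (fC1 vev) av) mulrAC divff ?mul1r //.
Qed.

(** The change of basis commutes with means and sums, and it turns the block resolvents into the
    resolvent of X. As the right-hand side does not mention the decomposition, the value of [matfun]
    does not depend on the one that [xget] selects. *)
Lemma jordan_form_cauchy n (X : 'M[C]_n) p (s : 'I_p -> nat) (lam : 'I_p -> C)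
    (P : 'M[C]_(n, \sum_i s i)) (Q : 'M[C]_(\sum_i s i, n)) :
  jordan_form X lam P Q ->
  (forall a, eigenvalue X a -> exists2 v, v \in ev & `|a - v| < r%:C) ->
  P *m (\mxdiag_i fun_jordan_block f (s i) (lam i)) *m Q = cauchy_matrix X.
Proof.
move=> XJ Xev.
have lev i := Xev _ (jordan_form_eigenvalue XJ i).
rewrite (eq_mxdiag (fun i => fun_jordan_block_cauchy (s i) (lev i))).
pose T u t i := (f (circ u r t) * (circ u r t - u)) *:
                  jordan_resolvent (s i) (lam i) (circ u r t).
have cT u i : u \in ev -> mcontinuous (fun t => T u t i).
  move=> uev' x y; have [xy|xy] := leqP x y; last first.
    rewrite (_ : (fun t => _) = fun=> 0); first exact: cst_continuous.
    by apply/funext => t; rewrite !mxE leqNgt xy mulr0.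
  rewrite (_ : (fun t => _) = fun t => (f (circ u r t) * (circ u r t - u)) *
      (circ u r t - lam i)^-1 ^+ (y - x).+1); last first.
    by apply/funext => t; rewrite !mxE xy.
  move=> t; apply: cvgM; first exact: cont_f_circ.
  apply: continuous_exp => {}t; apply: cvgV; last exact: continuous_circB.
  exact: circle_neq.
have -> : \mxdiag_i \sum_(u <- ev) mmean (fun t => T u t i) =
   \sum_(u <- ev) \mxdiag_i mmean (fun t => T u t i).
  elim: (ev) => [|u l IH].
    rewrite big_nil -(mxdiag0 (p_ := s)); apply: eq_mxdiag => i; exact: big_nil.
  rewrite big_cons -IH -mxdiagD; apply: eq_mxdiag => i; exact: big_cons.
rewrite mulmx_sumr mulmx_suml /cauchy_matrix [LHS]big_seq [RHS]big_seq; apply: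
    eq_bigr => u uev'.
rewrite -mmean_diag -mmean_mulr; last by apply: mcontinuous_diag => i; exact: cT.
rewrite -mmean_mull; last first.
  by apply: mcontinuous_mulr; apply: mcontinuous_diag => i; exact: cT.
congr mmean; apply/funext => t.
rewrite (jordan_form_resolvent XJ); last by move=> i; exact: circle_neq.
rewrite scalemxAl scalemxAr; congr (_ *m _ *m _); rewrite /T.
rewrite -mul_scalar_mx -(mxdiag_scalar s) mxdiag_mul.
by apply: eq_mxdiag => i; rewrite mul_scalar_mx.
Qed.

End CauchyJordan.

(** * Smoothness of the matrix function *)

Section MatrixNorm.
Context {K : numFieldType} {m n : nat}.
Implicit Types M : 'M[K]_(m, n).

Lemma norm_entry_le M i j : `|M i j| <= `|M|.
Proof.
rewrite -[leRHS]/(mx_norm M) mx_normE.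
have -> : `|M i j| = (`|M i j|%:nng)%:num by [].
rewrite num_le; exact: (le_bigmax _ (fun ij : 'I_m * 'I_n => `|M ij.1 ij.2|%:nng) (i, j)).
Qed.

Lemma mx_norm_le M b : 0 <= b -> (forall i j, `|M i j| <= b) -> `|M| <= b.
Proof.
move=> /nonnegP[c] Mc; rewrite -[leLHS]/(mx_norm M) mx_normE num_le.
apply/bigmax_leP; split; first by have : 0 <= c%:num by [].
by move=> [i j] _ /=; rewrite -num_le; exact: Mc.
Qed.

End MatrixNorm.

Section GoodMatrices.
Context {R : realType}.
Local Notation C := R[i].
Context {V : normedModType C} (A : set V).

Lemma good_fct_cst (a : C) : good_family A (fun _ _ => a).
Proof. by apply: (@good_cst _ _ _ (fun=> a)); exact: cst_continuous. Qed.

Lemma good_sum (J : Type) (l : seq J) (g : J -> R -> V -> C) :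
  (forall j, good_family A (g j)) ->
  good_family A (fun t X => \sum_(j <- l) g j t X).
Proof.
move=> gg; elim: l => [|j l IH].
  rewrite (_ : (fun t => _) = fun _ _ => 0); first exact: good_fct_cst.
  by apply/funext => t; apply/funext => X; rewrite big_nil.
rewrite (_ : (fun t => _) = fun t X => g j t X + \sum_(i <- l) g i t X).
  exact: good_add.
by apply/funext => t; apply/funext => X; rewrite big_cons.
Qed.

Lemma good_prod (J : Type) (l : seq J) (g : J -> R -> V -> C) :
  (forall j, good_family A (g j)) ->
  good_family A (fun t X => \prod_(j <- l) g j t X).
Proof.
move=> gg; elim: l => [|j l IH].
  rewrite (_ : (fun t => _) = fun _ _ => 1); first exact: good_fct_cst.
  by apply/funext => t; apply/funext => X; rewrite big_nil.
rewrite (_ : (fun t => _) = fun t X => g j t X * \prod_(i <- l) g i t X).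
  exact: good_mul.
by apply/funext => t; apply/funext => X; rewrite big_cons.
Qed.

(** A determinant is a polynomial in the entries. With [good_adj] and [good_inv] this puts the
    entries of a resolvent, written by Cramer's rule, among the good families. *)
Lemma good_det k (M : R -> V -> 'M[C]_k) :
  (forall i j, good_family A (fun t X => M t X i j)) ->
  good_family A (fun t X => \det (M t X)).
Proof.
move=> gM; apply: good_sum => s; apply: good_mul; first exact: good_fct_cst.
by apply: good_prod => i; exact: gM.
Qed.

Lemma good_adj k (M : R -> V -> 'M[C]_k) a b :
  (forall i j, good_family A (fun t X => M t X i j)) ->
  good_family A (fun t X => (\adj (M t X)) a b).
Proof.
move=> gM.
rewrite (_ : (fun t => _) = fun t X => (-1) ^+ (b + a) *
    \det (row' b (col' a (M t X)))).
  apply: good_mul; first exact: good_fct_cst.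
  apply: good_det => i j.
  rewrite (_ : (fun t => _) = fun t X => M t X (lift b i) (lift a j)); first exact: gM.
  by apply/funext => t; apply/funext => X; rewrite !mxE.
by apply/funext => t; apply/funext => X; rewrite mxE.
Qed.

End GoodMatrices.

(** * Semicontinuity of the spectrum *)

Section SpectrumNear.
Context {R : realType}.
Local Notation C := R[i].

Lemma good_entry m n (A : set 'M[C]_(m, n)) i j : good_family A (fun (_ : R) X => X i j).
Proof.
apply: good_lin; first by move=> a u v; rewrite !mxE.
by exists 1 => H; rewrite mul1r norm_entry_le.
Qed.

(** Families constant in the parameter are borrowed here for their continuity in X. *)
Lemma good_horner_mx n (A : set 'M[C]_n.+1) (q : {poly C}) i j :
  good_family A (fun (_ : R) X => (horner_mx X q) i j).
Proof.
elim/poly_ind: q i j => [|q c IH] i j.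
  rewrite (_ : (fun t => _) = fun _ _ => 0); first exact: good_fct_cst.
  by apply/funext => t; apply/funext => X; rewrite rmorph0 mxE.
rewrite (_ : (fun t => _) = fun _ X => \sum_k (horner_mx X q) i k * X k j + c *+ (i
    == j)).
  apply: good_add; last exact: good_fct_cst.
  by apply: good_sum => k; apply: good_mul; [exact: IH|exact: good_entry].
apply/funext => t; apply/funext => X.
by rewrite rmorphD rmorphM /= horner_mx_C horner_mx_X !mxE.
Qed.

Lemma good_entry_continuous n (g : 'M[C]_n.+1 -> C) X :
  good_family setT (fun (_ : R) X => g X) -> {for X, continuous g}.
Proof.
move=> gg; have := good_family_cvg gg (t := 0) (X := X) I.
move=> H; apply: (@cvg_comp _ _ _ (fun Y => (0 : R, Y)) (fun p => g p.2) _ _ _ _ H).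
have c0 := @cst_continuous 'M[C]_n.+1 R (0 : R) X.
exact: (cvg_pair c0 cvg_id).
Qed.

(** Let q be the characteristic polynomial of [A0]. By Cayley-Hamilton q(A0) = 0, so q(X) is small
    for X near [A0]. If v is an eigenvector of X for a, then v q(X) = q(a) v, so |q(a)| is small;
    being the product of the distances from a to the eigenvalues of [A0], it forces one of them
    below r. *)
Lemma spectrum_near n (A0 : 'M[C]_n.+1) (r : R) : 0 < r ->
  \forall X \near A0, forall a, eigenvalue X a ->
    exists2 v, eigenvalue A0 v & `|a - v| < r%:C.
Proof.
move=> r0; have [rs qE] := closed_field_poly_normal (char_poly A0).
rewrite (eqP (char_poly_monic _)) scale1r in qE.
have rC0 : 0 < r%:C :> C by rewrite ltcR.
set q := char_poly A0 in qE.
(* Entries of q(X) bounded by e give |q(a)| <= (n+1) e; the divisor n + 2 makes this strictly less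
   than r^(size rs). *)
pose e : C := r%:C ^+ size rs / n.+2%:R.
have e0 : 0 < e by rewrite divr_gt0 ?exprn_gt0 ?ltr0n.
have near_e i j : \forall X \near A0, `|(horner_mx X q) i j| <= e.
  have /cvgrPdist_le/(_ e e0) :=
    @good_entry_continuous n (fun X => (horner_mx X q) i j) A0 (good_horner_mx _ q i j).
  by rewrite Cayley_Hamilton; apply: filterS => X; rewrite mxE sub0r normrN.
pose I2 : finType := ('I_n.+1 * 'I_n.+1)%type.
have H := @filter_forall _ I2 (fun ij X => `|(horner_mx X q) ij.1 ij.2| <= e)
  (nbhs A0) (nbhs_filter A0) (fun ij => near_e ij.1 ij.2).
apply: filterS H => X Xe' a /eigenvalueP[v vX v0].
have Xe i j := Xe' (i, j).
have vq := horner_mx_eigen q vX.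
pose S := \sum_k `|v 0 k|.
have S0 : 0 < S.
  rewrite lt_neqAle eq_sym sumr_ge0 // andbT psumr_eq0 //.
  apply: contra v0 => /allP vz; apply/eqP/rowP => k; rewrite mxE.
  by apply/eqP; have := vz k (mem_index_enum k); rewrite normr_eq0.
have qa : `|q.[a]| < r%:C ^+ size rs.
  apply: (@le_lt_trans _ _ (n.+1%:R * e)); last first.
    rewrite /e mulrCA gtr_pMr ?exprn_gt0 // ltr_pdivrMr ?ltr0n // mul1r ltr_nat //.
  rewrite -(ler_pM2r S0) {1}/S mulr_sumr.
  apply: (@le_trans _ _ (\sum_(k < n.+1) e * S)); last first.
    by rewrite sumr_const card_ord -[leLHS]mulr_natl mulrA.
  apply: ler_sum => k _; rewrite -normrM.
  have -> : q.[a] * v 0 k = (v *m horner_mx X q) 0 k by rewrite vq mxE.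
  rewrite mxE (le_trans (ler_norm_sum _ _ _)) // mulr_sumr ler_sum // => l _.
  by rewrite normrM [leRHS]mulrC; apply: ler_wpM2l => //; exact: Xe.
apply: contrapT => H.
have far z : z \in rs -> r%:C <= `|a - z|.
  move=> zrs; rewrite real_leNgt ?realE ?normr_ge0 ?(ltW rC0) //; apply/negP => az.
  apply: H; exists z => //; rewrite eigenvalue_root_char -/q qE root_prod_XsubC.
  exact: zrs.
move: qa; rewrite qE horner_prod normr_prod; apply/negP.
rewrite -real_leNgt ?realE ?prodr_ge0 ?exprn_ge0 ?(ltW rC0) //.
elim: (rs) far => [|z l IH] far; first by rewrite big_nil expr0.
rewrite big_cons exprS ler_pM ?exprn_ge0 ?(ltW rC0) //.
  by rewrite !hornerE far // mem_head.
by apply: IH => y yl; apply: far; rewrite inE yl orbT.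
Qed.

End SpectrumNear.

Section DiffTimesAlgebra.
Context {K : numFieldType} {V W : normedModType K}.
Implicit Types F G : V -> W.

Lemma diff_timesD k F G x : diff_times k F x -> diff_times k G x ->
  diff_times k (fun y => F y + G y) x.
Proof.
elim: k F G => [//|[|k] IH] F G /=; first exact: differentiableD.
move=> [dF dF'] [dG dG']; split.
  by apply: filterS2 dF dG => y; exact: differentiableD.
move=> v; apply: diff_times_near_eq (IH _ _ (dF' v) (dG' v)).
by apply: filterS2 dF dG => y dFy dGy; rewrite (diffD dFy dGy).
Qed.

Lemma diff_times_cst k (a : W) x : diff_times k (fun _ : V => a) x.
Proof.
elim: k a => [//|[|k] IH] a /=; first exact: differentiable_cst.
split; first by apply: (@nearW _ (nbhs x)) => y; exact: differentiable_cst.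
move=> v; apply: diff_times_near_eq (IH 0).
by apply: (@nearW _ (nbhs x)) => y; rewrite diff_cst.
Qed.

Lemma diff_times_sum k (J : eqType) (l : seq J) (F : J -> V -> W) x :
  (forall j, j \in l -> diff_times k (F j) x) ->
  diff_times k (fun y => \sum_(j <- l) F j y) x.
Proof.
elim: l => [|j l IH] dF.
  rewrite (_ : (fun y => _) = fun=> 0); first exact: diff_times_cst.
  by apply/funext => y; rewrite big_nil.
rewrite (_ : (fun y => _) = fun y => F j y + \sum_(i <- l) F i y).
  apply: diff_timesD; first by apply: dF; rewrite mem_head.
  by apply: IH => i il; apply: dF; rewrite inE il orbT.
by apply/funext => y; rewrite big_cons.
Qed.

Lemma diff_timesZl k (c : V -> K) (w : W) x : diff_times k (c : V -> K) x ->
  diff_times k (fun y => c y *: w) x.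
Proof.
elim: k c => [//|[|k] IH] c /=; first exact: differentiableZl.
move=> [dc dc']; split; first by apply: filterS dc => y; exact: differentiableZl.
move=> v; apply: diff_times_near_eq (IH _ (dc' v)).
by apply: filterS dc => y dcy; rewrite diffZl.
Qed.

End DiffTimesAlgebra.

Lemma exists_pos_all (R : realDomainType) (T : eqType) (l : seq T) (P : T -> R -> Prop) :
  (forall x, x \in l -> exists2 d, 0 < d & P x d) ->
  (forall x d d', d' <= d -> P x d -> P x d') ->
  exists2 d, 0 < d & forall x, x \in l -> P x d.
Proof.
move=> lP Ple; elim: l lP => [|x l IH] lP; first by exists 1.
have [d d0 dl] : exists2 d, 0 < d & forall x, x \in l -> P x d.
  by apply: IH => y yl; apply: lP; rewrite inE yl orbT.
have [e e0 ex] := lP x (mem_head _ _).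
exists (Num.min d e); first by rewrite lt_min d0.
move=> y; rewrite inE => /predU1P[->|yl].
  by apply: Ple ex; rewrite ge_min lexx orbT.
by apply: Ple (dl y yl); rewrite ge_min lexx.
Qed.

Section MatfunSmooth.
Context {R : realType}.
Local Notation C := R[i].

Lemma matfun_cauchy n (f : C -> C) (ev : seq C) (r r' : R) (X : 'M[C]_n) :
  0 < r -> r < r' -> uniq ev ->
  (forall u, u \in ev -> forall y, `|y - u| < r'%:C -> C1_at f y) ->
  (forall u v, u \in ev -> v \in ev -> u != v -> (2 * r)%:C <= `|u - v|) ->
  (forall a, eigenvalue X a -> exists2 v, v \in ev & `|a - v| < r%:C) ->
  matfun f X = cauchy_matrix f ev r X.
Proof.
move=> r0 rr' uev fC1 sep Xev; rewrite /matfun.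
set S := [set B | _].
have [p [s [lam [P [Q XJ]]]]] := jordan_form_exists X.
have SX : exists B, S B by eexists; exists p, (fun i => s i), (fun i => lam i), P,
    Q; split; [exact: XJ|reflexivity].
have [p' [s' [lam' [P' [Q' [XJ' ->]]]]]] := xgetPex (0 : 'M[C]_n) SX.
exact: (jordan_form_cauchy r0 rr' uev fC1 sep XJ' Xev).
Qed.

Lemma spectral_radii n (Omega : set C) (A0 : 'M[C]_n.+1) : open Omega ->
  (forall z, eigenvalue A0 z -> Omega z) ->
  exists (ev : seq C) (r r' : R), [/\ 0 < r, r < r', uniq ev,
    forall z, (z \in ev) = eigenvalue A0 z &
    (forall u, u \in ev -> forall y, `|y - u| < r'%:C -> Omega y) /\
    (forall u v, u \in ev -> v \in ev -> u != v -> (2 * r)%:C <= `|u - v|)].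
Proof.
move=> oO AO; have [rs qE] := closed_field_poly_normal (char_poly A0).
rewrite (eqP (char_poly_monic _)) scale1r in qE.
pose ev := undup rs.
have evE z : (z \in ev) = eigenvalue A0 z.
  by rewrite eigenvalue_root_char qE root_prod_XsubC mem_undup.
have [d d0 dP] : exists2 d, 0 < d & forall u, u \in ev ->
    forall y, `|y - u| < d%:C -> Omega y.
  apply: exists_pos_all => [u|u d d' d'd dP y yu]; last first.
    by apply: dP; apply: lt_le_trans yu _; rewrite lecR.
  rewrite evE => /AO Ou; have : nbhs u Omega by exact: open_nbhs_nbhs.
  move=> /nbhs_normP[d0 /= /gt0_complexP[d d_gt0 ->] dO]; exists d => // y yu.
  by apply: dO; rewrite /= distrC.
have [e e0 eP] : exists2 e, 0 < e & forall uv, uv \in [seq (u, v) | u <- ev, v <- ev] ->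
    uv.1 != uv.2 -> e%:C <= `|uv.1 - uv.2|.
  apply: exists_pos_all => [[u v] _|[u v] x y yx H uv] /=; last first.
    by apply: le_trans (H uv); rewrite lecR.
  have [->|uv] := eqVneq u v; first by exists 1.
  have : 0 < `|u - v| by rewrite normr_gt0 subr_eq0.
  by move=> /gt0_complexP[x x0 ->]; exists x.
(* [d] keeps the discs inside Omega and [e] separates the eigenvalues; halving gives both r < d and
   2 r <= e. *)
pose r := Num.min d e / 2.
have m0 : 0 < Num.min d e by rewrite lt_min d0.
have r0 : 0 < r by rewrite divr_gt0.
exists ev, r, d; split=> //.
- apply: (@lt_le_trans _ _ (Num.min d e)); last by rewrite ge_min lexx.
  by rewrite /r ltr_pdivrMr // ltr_pMr // ltr1n.
- exact: undup_uniq.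
split=> // u v uev' vev uv; apply: (le_trans _ (eP (u, v) _ uv)); last first.
  by apply/allpairsP; exists (u, v).
by rewrite lecR /r mulrCA divff // mulr1 ge_min lexx orbT.
Qed.

Lemma matfun_entry_smooth n (Omega : set C) (f : C -> C) (A0 : 'M[C]_n.+1) :
  open Omega -> (forall z, Omega z -> C1_at f z) ->
  (forall z, eigenvalue A0 z -> Omega z) ->
  exists2 U : set 'M[C]_n.+1, open U /\ U A0 & forall i j k X, U X ->
    diff_times k (fun X => matfun f X i j) X.
Proof.
move=> oO fO AO.
have [ev [r [r' [r0 rr' uev evE [evO sep]]]]] := spectral_radii oO AO.
have fC1 u : u \in ev -> forall y, `|y - u| < r'%:C -> C1_at f y.
  by move=> uev' y yu; apply: fO; exact: evO yu.
pose P (X : 'M[C]_n.+1) := forall a, eigenvalue X a ->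
    exists2 v, v \in ev & `|a - v| < r%:C.
(* By [spectrum_near] the eigenvalue condition holds near [A0]; its interior is an open set on which
   the same circles serve every matrix. *)
pose U := interior P.
have oU : open U by exact: open_interior.
have UP X : U X -> P X by exact: interior_subset.
have UA0 : U A0.
  have := spectrum_near A0 r0; apply: filterS => X H a /H[v vA av].
  by exists v => //; rewrite evE.
exists U => // i j k X UX.
pose z u t : C := circ u r t.
(* A zero determinant would make a point of a circle an eigenvalue of [Y], which [circle_neq]
   excludes. *)
have nz u t Y : u \in ev -> U Y -> \det ((z u t)%:M - Y) != 0.
  move=> uev' /UP PY; apply/negP => /det0P[v v0 vY].
  have /PY H : eigenvalue Y (z u t).
    apply/eigenvalueP; exists v => //; apply/eqP; rewrite eq_sym -subr_eq0.
    by rewrite -mul_mx_scalar -mulmxBr vY.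
  have := circle_neq r0 sep t uev' H; by rewrite subrr eqxx.
(* Cramer's rule for the entry (i, j) of the integrand of [cauchy_matrix]. *)
pose g u (t : R) (Y : 'M[C]_n.+1) := (f (z u t) * (z u t - u)) *
   ((\det ((z u t)%:M - Y))^-1 * (\adj ((z u t)%:M - Y)) i j).
have gg u : u \in ev -> good_family U (g u).
  move=> uev'.
  have gE a b : good_family U (fun t (Y : 'M[C]_n.+1) => ((z u t)%:M - Y) a b).
    rewrite (_ : (fun t => _) = fun t (Y : 'M[C]_n.+1) => z u t *+ (a == b) + - 1 *
        Y a b).
      apply: good_add; last by apply: good_mul; [exact: good_fct_cst|exact: good_entry].
      apply: good_cst; case: (a == b) => /=.
        by rewrite (_ : (fun x => _) = circ u r) //; exact: continuous_circ.
      by rewrite (_ : (fun x => _) = fun=> 0) //; exact: cst_continuous.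
    by apply/funext => t; apply/funext => Y; rewrite !mxE mulN1r.
  apply: good_mul; first by apply: good_cst; exact: (cont_f_circ r0 rr' fC1).
  apply: good_mul; last exact: good_adj.
  by apply: good_inv; [exact: good_det|move=> t Y UY; exact: nz].
have : diff_times k (fun Y => \sum_(u <- ev) cmean ((g u)^~ Y)) X.
  by apply: diff_times_sum => u uev'; exact: (good_family_smooth k oU (gg u uev') UX).
apply: diff_times_near_eq.
have : \forall Y \near X, U Y by exact: open_nbhs_nbhs.
apply: filterS => Y UY.
rewrite (matfun_cauchy r0 rr' uev fC1 sep (UP Y UY)) summxE !big_seq.
apply: eq_bigr => u uev'; rewrite mxE; congr cmean; apply/funext => t.
rewrite /g !mxE; congr (_ * _).
by rewrite /invmx unitmxE unitfE nz // !mxE.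
Qed.

End MatfunSmooth.

(** * First order chain rule *)

Section RealDiffTimes.
Context {K : numFieldType} {V : normedModType K}.
Implicit Types F G : V -> K.

Lemma diff_timesM k F G x : diff_times k F x -> diff_times k G x ->
  diff_times k (fun y => F y * G y) x.
Proof.
elim: k F G => [//|k IH] F G dF dG.
have dFk := diff_times_le (leqnSn k) dF; have dGk := diff_times_le (leqnSn k) dG.
case: k IH dF dG dFk dGk => [|k] IH dF dG dFk dGk; first exact: differentiableM.
case: dF dG => dF dF' [dG dG']; split.
  by apply: filterS2 dF dG => y; exact: differentiableM.
move=> v.
apply: diff_times_near_eq (diff_timesD (IH _ _ dFk (dG' v)) (IH _ _ dGk (dF' v))).
by apply: filterS2 dF dG => y dFy dGy; rewrite (diffM dFy dGy).
Qed.

End RealDiffTimes.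

Lemma diff_timesZ {K : numFieldType} {V W : normedModType K} k (c : K)
    (F : V -> W) x : diff_times k F x -> diff_times k (fun y => c *: F y) x.
Proof.
elim: k F => [//|[|k] IH] F /=; first exact: differentiableZ.
move=> [dF dF']; split; first by apply: filterS dF => y; exact: differentiableZ.
move=> v; apply: diff_times_near_eq (IH _ (dF' v)).
by apply: filterS dF => y dFy; rewrite (diffZ c dFy).
Qed.

(** The definition of [diff_times] gives one neighbourhood for each direction v, and only finitely
    many can be intersected. Hence the reduction to the basis directions, from which every other
    direction follows by linearity. *)
Lemma diff_times_near {R : realType} {j : nat} (W : normedModType R) k
    (F : 'rV[R]_j -> W) x : diff_times k.+1 F x ->
  \forall y \near x, diff_times k F y.
Proof.
elim: k F => [|k IH] F; first by move=> _; apply: (@nearW _ (nbhs x)).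
move=> [dF dF']; case: k IH dF' => [|k] IH dF'; first exact: dF.
have dFi : \forall y \near x, forall i : 'I_j,
    diff_times k.+1 (fun y => 'd F y (delta_mx 0 i)) y.
  exact: (@filter_forall _ _ _ (nbhs x) (nbhs_filter x) (fun i => IH _ (dF'
      (delta_mx 0 i)))).
have dF2 := near_join dF.
apply: filterS2 dF2 dFi => y dFy dFiy; split=> // v.
have := @diff_times_sum _ _ _ k.+1 _ (index_enum 'I_j)
  (fun i y => v 0 i *: 'd F y (delta_mx 0 i)) y (fun i _ => diff_timesZ (v 0 i) (dFiy i)).
apply: diff_times_near_eq; apply: (@nearW _ (nbhs y)) => z.
rewrite {2}(row_sum_delta v) linear_sum; apply: eq_bigr => i _.
by rewrite linearZ.
Qed.

(** * Complex-valued functions on a real space *)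

Section ComplexValued.
Context {R : realType} {U : normedModType R}.
Local Notation C := R[i].
Local Notation re := (@complex.Re R).
Local Notation im := (@complex.Im R).
Implicit Types (G H : U -> C) (x : U).

Definition cdiff_times k G x :=
  diff_times k (re \o G) x /\ diff_times k (im \o G) x.

Definition cdiff G x (v : U) : C := 'd (re \o G) x v +i* 'd (im \o G) x v.

Lemma cdiff_timesD k G H x : cdiff_times k G x -> cdiff_times k H x ->
  cdiff_times k (fun y => G y + H y) x.
Proof.
move=> [Gr Gi] [Hr Hi]; split.
  rewrite (_ : re \o _ = fun y => (re \o G) y + (re \o H) y).
    exact: diff_timesD.
  by apply/funext => y /=; rewrite raddfD.
rewrite (_ : im \o _ = fun y => (im \o G) y + (im \o H) y).
  exact: diff_timesD.
by apply/funext => y /=; rewrite raddfD.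
Qed.

Lemma cdiff_timesM k G H x : cdiff_times k G x -> cdiff_times k H x ->
  cdiff_times k (fun y => G y * H y) x.
Proof.
move=> [Gr Gi] [Hr Hi]; split.
  rewrite (_ : re \o _ = fun y => (re \o G) y * (re \o H) y +
      (-1) *: ((im \o G) y * (im \o H) y)).
    by apply: diff_timesD; [|apply: diff_timesZ]; exact: diff_timesM.
  by apply/funext => y /=; case: (G y) (H y) => a b [c d] /=; rewrite scaleN1r.
rewrite (_ : im \o _ = fun y => (re \o G) y * (im \o H) y +
    (im \o G) y * (re \o H) y).
  by apply: diff_timesD; exact: diff_timesM.
by apply/funext => y /=; case: (G y) (H y) => a b [c d] /=.
Qed.

Lemma cdiff_times_cst k (a : C) x : cdiff_times k (fun=> a) x.
Proof. by split; exact: diff_times_cst. Qed.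

Lemma cdiff_times_sum k (J : eqType) (l : seq J) (G : J -> U -> C) x :
  (forall j, j \in l -> cdiff_times k (G j) x) ->
  cdiff_times k (fun y => \sum_(j <- l) G j y) x.
Proof.
elim: l => [|j l IH] dG.
  rewrite (_ : (fun y => _) = fun=> 0); first exact: cdiff_times_cst.
  by apply/funext => y; rewrite big_nil.
rewrite (_ : (fun y => _) = fun y => G j y + \sum_(i <- l) G i y).
  apply: cdiff_timesD; first by apply: dG; rewrite mem_head.
  by apply: IH => i il; apply: dG; rewrite inE il orbT.
by apply/funext => y; rewrite big_cons.
Qed.

Lemma near_eq_cdiff_times k G H x : (\forall y \near x, G y = H y) ->
  cdiff_times k G x -> cdiff_times k H x.
Proof.
move=> GH [Gr Gi]; split.
  by apply: diff_times_near_eq Gr; apply: filterS GH => y /= ->.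
by apply: diff_times_near_eq Gi; apply: filterS GH => y /= ->.
Qed.

Lemma cdiff_timesS k G x : cdiff_times k.+2 G x <->
  (\forall y \near x, cdiff_times 1 G y) /\
  (forall v, cdiff_times k.+1 (fun y => cdiff G y v) x).
Proof.
split=> [[[Gr Gr'] [Gi Gi']]|[G1 G2]].
  split; first by apply: filterS2 Gr Gi => y dr di; split.
  by move=> v; split; [exact: Gr'|exact: Gi'].
split.
  exact: (conj (filterS (fun y h => proj1 h) G1) (fun v => proj1 (G2 v))).
exact: (conj (filterS (fun y h => proj2 h) G1) (fun v => proj2 (G2 v))).
Qed.

Lemma cdiff_mixed G x : cdiff_times 1 G x -> mixed_diff G x (cdiff G x).
Proof.
move=> [Gr Gi].
apply/mixed_diffP.
- move=> a u v; rewrite -[LHS]/('d (re \o G) x (a *: u + v)) linearP; exact: erefl.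
- move=> a u v; rewrite -[LHS]/('d (im \o G) x (a *: u + v)) linearP; exact: erefl.
- have [k k0 Gk] := diff_lip Gr; have [l l0 Gl] := diff_lip Gi.
  exists (k + l) => h; apply: (le_trans (normc_le_ReIm _)).
  by rewrite lecR mulrDl; exact: lerD (Gk h) (Gl h).
- by split; apply: DiffDef.
Qed.

Lemma cdiff_lip G x : cdiff_times 1 G x ->
  exists2 k, 0 <= k & forall h, `|cdiff G x h| <= (k * `|h|)%:C.
Proof.
move=> [Gr Gi]; have [k k0 Gk] := diff_lip Gr; have [l l0 Gl] := diff_lip Gi.
exists (k + l); first by rewrite addr_ge0 // ltW.
move=> h; apply: (le_trans (normc_le_ReIm _)).
by rewrite lecR mulrDl; exact: lerD (Gk h) (Gl h).
Qed.

Lemma mixed_cdiff G x (L : U -> C) : linear (re \o L) -> linear (im \o L) ->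
  (exists k, forall h, `|L h| <= (k * `|h|)%:C) -> mixed_diff G x L ->
  cdiff_times 1 G x /\ forall v, cdiff G x v = L v.
Proof.
move=> lr li Lk GL; have [dr di] := iffLR (mixed_diffP G x lr li Lk) GL.
split; first by split; exact: ex_diff.
by move=> v; rewrite /cdiff !diff_val /=; case: (L v).
Qed.

Context {m n : nat}.
Implicit Types (A : U -> 'M[C]_(m, n)).

Definition mx_cdiff A x (v : U) : 'M[C]_(m, n) :=
  \matrix_(a, b) cdiff (fun y => A y a b) x v.

Lemma mx_cdiff_mixed A x : (forall a b, cdiff_times 1 (fun y => A y a b) x) ->
  mixed_diff A x (mx_cdiff A x).
Proof.
move=> dA e e0.
pose I2 : finType := ('I_m * 'I_n)%type.
have H := @filter_forall _ I2 (fun ab h =>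
    `|A (x + h) ab.1 ab.2 - A x ab.1 ab.2 - cdiff (fun y => A y ab.1 ab.2) x h|
      <= (e * `|h|)%:C) (nbhs (0 : U)) (nbhs_filter (0 : U))
  (fun ab => cdiff_mixed (dA ab.1 ab.2) e0).
apply: filterS H => h Hh; apply: mx_norm_le; first by rewrite lecR mulr_ge0 // ltW.
by move=> a b; rewrite !mxE; exact: (Hh (a, b)).
Qed.

Lemma mx_cdiff_lip A x : (forall a b, cdiff_times 1 (fun y => A y a b) x) ->
  exists k, forall h, `|mx_cdiff A x h| <= (k * `|h|)%:C.
Proof.
move=> dA.
have [k k0 Ak] : exists2 k : 'I_m * 'I_n -> R, forall ab, 0 <= k ab &
    forall ab h, `|cdiff (fun y => A y ab.1 ab.2) x h| <= (k ab * `|h|)%:C.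
  have H ab := cdiff_lip (dA ab.1 ab.2).
  by exists (fun ab => s2val (cid2 (H ab))) => ab; [exact: (s2valP (cid2 (H
      ab)))|exact: (s2valP' (cid2 (H ab)))].
exists (\sum_ab k ab) => h; apply: mx_norm_le.
  by rewrite lecR mulr_ge0 // sumr_ge0.
move=> a b; rewrite mxE; apply: (le_trans (Ak (a, b) h)); rewrite lecR ler_wpM2r //.
by rewrite (bigD1 (a, b)) //= lerDl sumr_ge0.
Qed.

Lemma mx_cdiff_linear A x a b c u v : (mx_cdiff A x (c *: u + v)) a b =
  c%:C * (mx_cdiff A x u) a b + (mx_cdiff A x v) a b.
Proof.
rewrite !mxE /cdiff !linearP /=.
by apply/eqP; rewrite eq_complex /=; apply/andP; split; apply/eqP; rewrite !mul0r
    ?subr0 ?addr0.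
Qed.

(** The real and imaginary parts of the composite mix those of [A], so the composition is done at
    the level of [mixed_diff], where the real-linear [mx_cdiff] is followed by the complex-linear
    differential of [Phi]. *)
Lemma cdiff_comp (Phi : 'M[C]_(m, n) -> C) A x :
  (forall a b, cdiff_times 1 (fun y => A y a b) x) ->
  differentiable Phi (A x) ->
  cdiff_times 1 (Phi \o A) x /\
  forall v, cdiff (Phi \o A) x v = 'd Phi (A x) (mx_cdiff A x v).
Proof.
move=> dA dPhi.
have mA := mx_cdiff_mixed dA; have [k Ak] := mx_cdiff_lip dA.
have mPA := mixed_diff_comp Ak mA dPhi.
have lin c u v : 'd Phi (A x) (mx_cdiff A x (c *: u + v)) =
    c%:C * 'd Phi (A x) (mx_cdiff A x u) + 'd Phi (A x) (mx_cdiff A x v).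
  have -> : mx_cdiff A x (c *: u + v) = c%:C *: mx_cdiff A x u + mx_cdiff A x v.
    by apply/matrixP => a b; rewrite mx_cdiff_linear !mxE.
  by rewrite linearP.
apply: mixed_cdiff => //.
- move=> c u v /=; rewrite lin raddfD /=; congr (_ + _).
  by case: ('d Phi (A x) (mx_cdiff A x u)) => a b /=; rewrite mul0r subr0.
- move=> c u v /=; rewrite lin raddfD /=; congr (_ + _).
  by case: ('d Phi (A x) (mx_cdiff A x u)) => a b /=; rewrite mul0r addr0.
have [kd kd0 dk] := diff_lip dPhi; have [l l0 lE] := gt0_complexP kd0.
exists (l * k) => h; apply: (le_trans (dk _)); rewrite lE -mulrA [X in _ <= X]rmorphM.
by apply: ler_wpM2l; [rewrite lecR ltW|exact: Ak].
Qed.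

Lemma mx_continuous A x : (forall a b, cdiff_times 1 (fun y => A y a b) x) ->
  {for x, continuous A}.
Proof.
move=> dA; have mA := mx_cdiff_mixed dA; have [k Ak] := mx_cdiff_lip dA.
have kk h : `|mx_cdiff A x h| <= (`|k| * `|h|)%:C.
  by rewrite (le_trans (Ak h)) // lecR ler_wpM2r // ler_norm.
have := mixed_diff_cvg kk mA => H.
apply/cvgrPdist_lt => _ /gt0_complexP[e e0 ->].
have k0 : 0 < 1 + `|k| by rewrite ltr_pwDl.
have e1 : 0 < e / (1 + `|k|) by rewrite divr_gt0.
have H2 : \forall h \near (0 : U), `|A (x + h) - A x| < e%:C.
  have hs : \forall h \near (0 : U), `|h| < e / (1 + `|k|) by exact: nbhs0_lt.
  apply: filterS2 H hs => h Ah he; apply: (le_lt_trans Ah).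
  by rewrite ltcR mulrC -ltr_pdivlMr.
suff : \forall t \near x, `|A x - A t| < e%:C by [].
rewrite (near_shift 0 x); apply: filterS H2 => h; rewrite /= subr0 (addrC h).
by rewrite distrC.
Qed.

End ComplexValued.

(** * Higher Frechet derivatives *)

Section SmoothOn.
Context {K : numFieldType} {V W : normedModType K}.
Implicit Types (O : set V) (F G : V -> W).

Definition smooth_on O F := forall k X, O X -> diff_times k F X.

Lemma smooth_on_diff O F X : smooth_on O F -> O X -> differentiable F X.
Proof. by move=> sF OX; exact: (sF 1%N X OX). Qed.

Lemma smooth_on_d O F E : smooth_on O F -> smooth_on O (fun X => 'd F X E).
Proof. by move=> sF [//|k] X OX; have [_] := sF k.+2 X OX; exact. Qed.

(** Every step of [frechet] differentiates again, so agreement at a point is not enough; on the open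
    set [O] it is agreement near each point and passes to the differentials. *)
Lemma frechet_eq_on O F G : open O -> (forall X, O X -> F X = G X) ->
  smooth_on O F -> forall X L, O X -> frechet F X L = frechet G X L.
Proof.
move=> oO FG sF X L; elim: L F G FG sF => [|E L IH] F G FG sF OX /=; first exact: FG.
apply: IH => // [Y OY|]; last exact: smooth_on_d.
have nFG : \forall Z \near Y, F Z = G Z.
  by apply: filterS (open_nbhs_nbhs (conj oO OY)) => Z; exact: FG.
by have [_ ->] := near_eq_differentiable nFG (smooth_on_diff sF OY).
Qed.

Lemma smooth_on_sum O (I : eqType) (l : seq I) (c : I -> K) (F : I -> V -> W) :
  (forall i, smooth_on O (F i)) ->
  smooth_on O (fun X => \sum_(i <- l) c i *: F i X).
Proof.
move=> sF k X OX; apply: diff_times_sum => i _; apply: diff_timesZ; exact: sF.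
Qed.

Lemma frechet_sum O (I : eqType) (l : seq I) (c : I -> K) (F : I -> V -> W) X L :
  open O -> (forall i, smooth_on O (F i)) -> O X ->
  frechet (fun X => \sum_(i <- l) c i *: F i X) X L =
  \sum_(i <- l) c i *: frechet (F i) X L.
Proof.
move=> oO sF OX; elim: L F sF => [//|E L IH] F sF /=.
rewrite -IH; last by move=> i; exact: smooth_on_d.
apply: (@frechet_eq_on O _ _ oO) OX => [Y OY|]; last first.
  by apply: smooth_on_d; exact: smooth_on_sum.
have H : is_diff Y (fun X => \sum_(i <- l) c i *: F i X)
    (fun E => \sum_(i <- l) c i *: 'd (F i) Y E).
  elim: l {IH} => [|i l IHl].
    under eq_fun do rewrite big_nil.
    under [X in is_diff _ _ X]eq_fun do rewrite big_nil.
    exact: is_diff_cst.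
  under eq_fun do rewrite big_cons.
  under [X in is_diff _ _ X]eq_fun do rewrite big_cons.
  apply: (@is_diffD _ _ _ (c i *: F i) _ (c i *: ('d (F i) Y : V -> W))).
  apply: is_diffZ; apply/differentiableP; exact: smooth_on_diff (sF i) OY.
by rewrite diff_val.
Qed.

End SmoothOn.

Section MatrixFrechet.
Context {K : numFieldType} {m n : nat}.
Local Notation V := 'M[K]_(m, n).
Local Notation I2 := ('I_m * 'I_n)%type.

Lemma diff_delta_sum (W : normedModType K) (F : V -> W) X E :
  'd F X E = \sum_(p <- index_enum I2) E p.1 p.2 *: 'd F X (delta_mx p.1 p.2).
Proof.
rewrite {1}(matrix_sum_delta E) pair_bigA linear_sum; apply: eq_bigr => p _.
by rewrite linearZ.
Qed.

(** [frechet] nests derivatives in constant directions. Expanding the first one in matrix units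
    turns it into scalar coefficients, so that a direction depending on the point can be
    differentiated like an ordinary factor. *)
Lemma frechet_cons_sum (W : normedModType K) O (F : V -> W) X E L : open O ->
  smooth_on O F -> O X ->
  frechet F X (E :: L) = \sum_(p <- index_enum I2)
    E p.1 p.2 *: frechet (fun Y => 'd F Y (delta_mx p.1 p.2)) X L.
Proof.
move=> oO sF OX /=.
rewrite -(frechet_sum _ _ _ oO _ OX); last by move=> p; exact: smooth_on_d.
by congr (frechet _ X L); apply/funext => Y; exact: diff_delta_sum.
Qed.

Lemma diff_entry a b (V' : normedModType K) (F : V' -> V) X E :
  differentiable F X -> 'd (fun Y => F Y a b) X E = ('d F X E) a b.
Proof.
move=> dF.
have H : is_diff X (fun Y => F Y a b) (fun E => ('d F X E) a b).
  apply: is_diff_eps.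
  - by move=> c u v; rewrite linearP !mxE.
  - have [k k0 Fk] := diff_lip dF; exists k => h.
    exact: le_trans (norm_entry_le _ a b) (Fk h).
  move=> e e0; apply: filterS (diff_eps dF e0) => h; apply: le_trans.
  by have := norm_entry_le (F (X + h) - F X - 'd F X h) a b; rewrite !mxE.
by rewrite diff_val.
Qed.

Lemma frechet_entry a b (V' : normedModType K) O (F : V' -> V) X L : open O ->
  smooth_on O F -> smooth_on O (fun X => F X a b) -> O X ->
  (frechet F X L) a b = frechet (fun X => F X a b) X L.
Proof.
move=> oO sF sFab OX; elim: L F sF sFab => [//|E L IH] F sF sFab /=.
have dE Y : O Y -> 'd (fun Y => F Y a b) Y E = ('d F Y E) a b.
  by move=> OY; apply: diff_entry; exact: smooth_on_diff sF OY.
have sd := smooth_on_d E sFab.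
rewrite IH; last first.
- move=> k Y OY; apply: diff_times_near_eq (sd k Y OY).
  by apply: filterS (open_nbhs_nbhs (conj oO OY)) => Z; exact: dE.
- exact: smooth_on_d.
by apply/esym; apply: (frechet_eq_on oO) => // Y; exact: dE.
Qed.

End MatrixFrechet.

Section HigherChain.
Context {R : realType} {U : normedModType R} {m n : nat}.
Local Notation C := R[i].
Local Notation V := 'M[C]_(m, n).
Local Notation I2 := ('I_m * 'I_n)%type.
Variable (O : set V).
Hypothesis oO : open O.

Lemma cdiff_times_le k l (G : U -> C) x : (k <= l)%N -> cdiff_times l G x ->
    cdiff_times k G x.
Proof. by move=> kl [Gr Gi]; split; [exact: diff_times_le Gr|exact: diff_times_le
    Gi]. Qed.

(** The differential of the composite is a sum over the entries p of a derivative of the entry p of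
    [A] times the partial derivative of [Phi] at p composed with [A]. That partial derivative is
    again smooth on [O], so the induction on [k] runs over all [Phi]. *)
Lemma cdiff_times_comp k (Phi : V -> C) (A : U -> V) x : smooth_on O Phi -> O (A x) ->
  (forall a b, cdiff_times k (fun y => A y a b) x) -> cdiff_times k (Phi \o A) x.
Proof.
elim: k Phi => [|k IH] Phi sPhi OAx dA; first by split.
have dA1 a b : cdiff_times 1 (fun y => A y a b) x by apply: cdiff_times_le (dA a b).
case: k IH dA => [|k] IH dA.
  by have [] := cdiff_comp dA1 (smooth_on_diff sPhi OAx).
have nA : \forall y \near x, (forall p : I2, cdiff_times 1 (fun y => A y p.1 p.2) y).
  apply: (@filter_forall _ _ _ (nbhs x) (nbhs_filter x)) => p.
  by have [] := iffLR (cdiff_timesS _ _ _) (dA p.1 p.2).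
have nO : \forall y \near x, O (A y).
  exact: (mx_continuous dA1) (open_nbhs_nbhs (conj oO OAx)).
have chain : \forall y \near x, cdiff_times 1 (Phi \o A) y /\
    forall v, cdiff (Phi \o A) y v = 'd Phi (A y) (mx_cdiff A y v).
  apply: filterS2 nA nO => y dAy Oy; apply: cdiff_comp; last exact: smooth_on_diff
      sPhi Oy.
  by move=> a b; exact: (dAy (a, b)).
apply/cdiff_timesS; split; first by apply: filterS chain => y [].
move=> v.
apply: (@near_eq_cdiff_times _ _ _ (fun y => \sum_(p <- index_enum I2)
   cdiff (fun y => A y p.1 p.2) y v * ((fun X => 'd Phi X (delta_mx p.1 p.2)) \o A) y)).
  apply: (@filterS _ (nbhs x) _ _ _ _ chain) => y [_ yE].
  apply: etrans (esym (yE v)).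
  rewrite [RHS]diff_delta_sum.
  apply: eq_bigr => p _.
  by rewrite mxE.
apply: cdiff_times_sum => p _; apply: cdiff_timesM.
  by have [_] := iffLR (cdiff_timesS _ _ _) (dA p.1 p.2); exact.
apply: IH => //; first exact: smooth_on_d.
by move=> a b; apply: cdiff_times_le (dA a b).
Qed.

End HigherChain.

(** * Multi-indices and partial derivatives *)

Section FirstIndex.
Context {j : nat}.
Implicit Types (alpha beta u : multi_index j) (i l : 'I_j).

(** The condition on [u] under which one more derivative in the variable [i] belongs on the outside
    of [pderive u]. *)
Definition zero_below u i := forall l, (l < i)%N -> u l = 0%N.

Lemma sorted_enum_ord : sorted (fun a b : 'I_j => (a < b)%N) (enum 'I_j).
Proof.
by have := iota_ltn_sorted 0 j; rewrite -val_enum_ord sorted_map.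
Qed.

(** [pick] returns the head of the filtered enumeration, and ordinals are enumerated in increasing
    order. *)
Lemma pick_ord_min (P : pred 'I_j) i : [pick i | P i] = Some i ->
  P i /\ forall l, (l < i)%N -> ~~ P l.
Proof.
have tr : transitive (fun a b : 'I_j => (a < b)%N) by move=> a b c; exact: ltn_trans.
have sP := sorted_filter tr P sorted_enum_ord.
have memP l : (l \in [seq x <- enum 'I_j | P x]) = P l.
  by rewrite mem_filter mem_enum andbT.
have -> : [pick i | P i] = ohead [seq x <- enum 'I_j | P x].
  by rewrite enumT.
case: [seq x <- enum 'I_j | P x] sP memP => [//|x s] /= sP memP [xi].
rewrite {x}xi in sP memP *.
split; first by rewrite -memP mem_head.
move=> l li; rewrite -memP inE negb_or; apply/andP; split.
  by apply: contraTN li => /eqP ->; rewrite ltnn.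
apply/negP => ls; have := order_path_min tr sP => /allP /(_ l ls) il.
by have := ltn_trans li il; rewrite ltnn.
Qed.

Lemma mi_deg_unit i : mi_deg (mi_unit i) = 1%N.
Proof.
rewrite /mi_deg (bigD1 i) //= big1 => [|l li]; first by rewrite ffunE eqxx.
by rewrite ffunE (negbTE li).
Qed.

Lemma mi_degD alpha beta : mi_deg (mi_add alpha beta) = (mi_deg alpha + mi_deg beta)%N.
Proof. by rewrite /mi_deg -big_split; apply: eq_bigr => i _; rewrite ffunE. Qed.

Lemma mi_deg_eq0 u i : mi_deg u = 0%N -> u i = 0%N.
Proof. by move=> /eqP; rewrite /mi_deg sum_nat_eq0 => /forallP /(_ i) /eqP. Qed.

Lemma mi_deg_le u alpha : (forall l, u l <= alpha l)%N -> (mi_deg u <= mi_deg alpha)%N.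
Proof. by move=> ua; apply: leq_sum. Qed.

Lemma mi_subK alpha i : (0 < alpha i)%N ->
  mi_add (mi_sub alpha (mi_unit i)) (mi_unit i) = alpha.
Proof.
move=> ai; apply/ffunP => l; rewrite !ffunE.
by have [->|_] := eqVneq l i; rewrite ?subn0 ?addn0 // subnK.
Qed.

Lemma mi_first alpha : (0 < mi_deg alpha)%N ->
  exists2 i, [pick i | (0 < alpha i)%N] = Some i &
    zero_below alpha i /\ (0 < alpha i)%N.
Proof.
move=> a0; case E : [pick i | (0 < alpha i)%N] => [i|].
  have [ai al] := pick_ord_min E; exists i => //; split=> // l /al.
  by rewrite lt0n negbK => /eqP.
move: E; case: pickP => // al _.
by move: a0; rewrite /mi_deg big1 // => i _; apply/eqP; rewrite -leqn0 leqNgt al.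
Qed.

Lemma mi_deg_sub_unit alpha i : (0 < alpha i)%N ->
  mi_deg alpha = (mi_deg (mi_sub alpha (mi_unit i))).+1.
Proof. by move=> ai; rewrite -[in LHS](mi_subK ai) mi_degD mi_deg_unit addn1. Qed.

Lemma zero_below_sub alpha i : zero_below alpha i ->
  zero_below (mi_sub alpha (mi_unit i)) i.
Proof. by move=> a0 l /a0 al; rewrite !ffunE al. Qed.

Lemma mi_partitions_recS N alpha i k : [pick i | (0 < alpha i)%N] = Some i ->
  (k.+2 <= mi_deg alpha)%N ->
  let gamma := mi_unit i in
  let beta := mi_sub alpha gamma in
  mi_partitions_rec N.+1 alpha k.+2 =
    [seq rcons w gamma | w <- mi_partitions_rec N beta k.+1] ++
    flatten [seq [seq set_nth gamma w q (mi_add (nth gamma w q) gamma)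
                     | q <- iota 0 k.+2]
                | w <- mi_partitions_rec N beta k.+2].
Proof. by move=> E kd gamma beta; rewrite [LHS]/= ltnNge kd E. Qed.

(** The entrywise bound lets the members of a partition inherit [zero_below] and a degree bound from
    [alpha]. *)
Lemma mi_partitions_recP N alpha k s : s \in mi_partitions_rec N alpha k ->
  size s = k /\ forall u, u \in s -> forall l, (u l <= alpha l)%N.
Proof.
elim: N alpha k s => [|N IH] alpha [|[|k]] s.
- by [].
- by rewrite inE => /eqP ->; split=> // u; rewrite inE => /eqP ->.
- by rewrite /=; case: ifP.
- by [].
- by rewrite inE => /eqP ->; split=> // u; rewrite inE => /eqP ->.
have [dk|kd] := ltnP (mi_deg alpha) k.+2; first by rewrite /= dk.
have [|i E [_ ai]] := mi_first (alpha := alpha); first exact: leq_trans kd.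
rewrite (mi_partitions_recS _ E kd).
have le_sub l : (mi_sub alpha (mi_unit i) l <= alpha l)%N by rewrite ffunE leq_subr.
have unit_le l : (mi_unit i l <= alpha l)%N.
  by rewrite ffunE; case: eqP => // ->.
rewrite mem_cat => /orP[/mapP[u /IH[us ub] ->]|/flattenP[_ /mapP[u /IH[us ub] ->]]].
  split; first by rewrite size_rcons us.
  move=> w; rewrite mem_rcons inE => /orP[/eqP -> //|wu] l.
  exact: leq_trans (ub _ wu l) (le_sub l).
move=> /mapP[q]; rewrite mem_iota add0n => /andP[_ qk] ->.
split; first by rewrite size_set_nth us; apply/maxn_idPr.
move=> w /(nthP (mi_unit i))[p]; rewrite size_set_nth us (maxn_idPr qk) => pk <- l.
rewrite nth_set_nth /=; case: eqP => _.
  have qs : (q < size u)%N by rewrite us.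
  have := ub _ (mem_nth (mi_unit i) qs) l; rewrite !ffunE.
  case: eqP => [->|_]; last by rewrite subn0 addn0.
  by move=> H; rewrite -(subnK ai) leq_add2r.
by apply: leq_trans (ub _ _ l) (le_sub l); rewrite mem_nth // us.
Qed.

Lemma mi_partitions1 alpha : mi_partitions alpha 1 = [:: [:: alpha]].
Proof. by rewrite /mi_partitions; case: (mi_deg alpha). Qed.

Lemma mi_partitions_gt alpha k : (mi_deg alpha < k)%N -> (1 < k)%N ->
  mi_partitions alpha k = [::].
Proof.
case: k => [|[|k]] // dk _; rewrite /mi_partitions; move: {1}(mi_deg alpha) => N.
by case: N => [|N] /=; rewrite dk.
Qed.

(** The fuel is the degree and drops by one together with it, so the recursion closes on
    [mi_partitions] itself. *)
Lemma mi_partitionsS alpha i k : [pick i | (0 < alpha i)%N] = Some i ->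
  (k.+2 <= mi_deg alpha)%N ->
  let gamma := mi_unit i in
  let beta := mi_sub alpha gamma in
  mi_partitions alpha k.+2 =
    [seq rcons w gamma | w <- mi_partitions beta k.+1] ++
    flatten [seq [seq set_nth gamma w q (mi_add (nth gamma w q) gamma)
                     | q <- iota 0 k.+2]
                | w <- mi_partitions beta k.+2].
Proof.
move=> E kd; have [ai _] := pick_ord_min E.
by rewrite /mi_partitions (mi_deg_sub_unit ai) (mi_partitions_recS _ E kd).
Qed.

End FirstIndex.

Section PartialDerivatives.
Context {R : realType} {j : nat}.
Local Notation U := 'rV[R]_j.
Implicit Types (alpha u : multi_index j) (F : U -> R) (x : U).

Lemma pderive0 u F : mi_deg u = 0%N -> pderive u F = F.
Proof.
move=> u0; rewrite /pderive; elim: (enum 'I_j) => [//|i s IH] /=.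
by rewrite (mi_deg_eq0 i u0) IH.
Qed.

(** Indices enumerated before [i] have exponent 0 and apply no derivative; the exponents of those
    after [i] are not changed by the added unit. *)
Lemma pderive_add_unit u i F : zero_below u i ->
  pderive (mi_add u (mi_unit i)) F = fun x => 'D_(delta_mx 0 i) (pderive u F) x.
Proof.
move=> u0; rewrite /pderive.
have := @sorted_enum_ord j; have := enum_uniq 'I_j; have := mem_enum 'I_j i.
rewrite [i \in _]inE.
elim: (enum 'I_j) => [//|l s IH] /=; rewrite inE => ils /andP[ls us] srt.
have [il|il] := eqVneq i l.
  rewrite -il in ls *; rewrite !ffunE eqxx addn1 /=.
  suff -> : foldr (fun l G => iter (mi_add u (mi_unit i) l) (fun H x =>
      'D_(delta_mx 0 l) H x) G) F s
      = foldr (fun l G => iter (u l) (fun H x => 'D_(delta_mx 0 l) H x) G) F s by [].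
  elim: {IH us srt ils} s ls => [//|l' s IH] /=; rewrite inE negb_or => /andP[il' /IH ->].
  by rewrite !ffunE eq_sym (negbTE il') addn0.
move: ils; rewrite (negbTE il) /= => is_.
have tr : transitive (fun a b : 'I_j => (a < b)%N) by move=> a b c; exact: ltn_trans.
have /allP/(_ _ is_) li := order_path_min tr srt.
rewrite !ffunE eq_sym (negbTE il) u0 //= IH //; exact: path_sorted srt.
Qed.

End PartialDerivatives.

Section PartialSmooth.
Context {R : realType} {j : nat}.
Local Notation U := 'rV[R]_j.
Implicit Types (alpha u : multi_index j) (F : U -> R) (x : U).

Lemma diff_times_derive k F x v : diff_times k.+1 F x ->
  diff_times k (fun y => 'D_v F y) x.
Proof.
case: k => [//|k] [dF dF']; apply: (@diff_times_near_eq _ _ _ k.+1 (fun y => 'd F y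
    v) _ _ _ (dF' v)).
by apply: filterS dF => y dFy; rewrite deriveE.
Qed.

Lemma diff_times_pderive k u F x : diff_times (mi_deg u + k) F x ->
  diff_times k (pderive u F) x.
Proof.
move Ed : (mi_deg u) => d; elim: d u k Ed => [|d IH] u k Ed dF.
  by rewrite pderive0.
have [|i _ [u0 ui]] := mi_first (alpha := u); first by rewrite Ed.
have Ed' : mi_deg (mi_sub u (mi_unit i)) = d.
  by apply: succn_inj; rewrite -mi_deg_sub_unit.
rewrite -(mi_subK ui) (pderive_add_unit _ (zero_below_sub u0)).
by apply: diff_times_derive; apply: IH => //; rewrite addnS -addSn.
Qed.

End PartialSmooth.

Section ComplexDerivative.
Context {R : realType} {U : normedModType R}.
Local Notation C := R[i].
Local Notation re := (@complex.Re R).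
Local Notation im := (@complex.Im R).
Implicit Types (G H : U -> C) (x v : U) (c d : C).

Definition cder G x v c :=
  is_derive x v (re \o G) (re c) /\ is_derive x v (im \o G) (im c).

Lemma cderE G x v c : cder G x v c ->
  'D_v (re \o G) x +i* 'D_v (im \o G) x = c.
Proof. by case=> dr di; rewrite !derive_val; case: c {dr di}. Qed.

Lemma cder_cst a x v : cder (fun=> a) x v 0.
Proof. by split; exact: is_derive_cst. Qed.

Lemma cderD G H x v c d : cder G x v c -> cder H x v d ->
  cder (fun y => G y + H y) x v (c + d).
Proof.
move=> [Gr Gi] [Hr Hi]; split; rewrite raddfD.
  rewrite (_ : re \o _ = (re \o G) + (re \o H)); first exact: is_deriveD.
  by apply/funext => y /=; rewrite raddfD.
rewrite (_ : im \o _ = (im \o G) + (im \o H)); first exact: is_deriveD.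
by apply/funext => y /=; rewrite raddfD.
Qed.

Lemma cderM G H x v c d : cder G x v c -> cder H x v d ->
  cder (fun y => G y * H y) x v (c * H x + G x * d).
Proof.
move=> [Gr Gi] [Hr Hi]; split.
  rewrite (_ : re \o _ = (re \o G) * (re \o H) - (im \o G) * (im \o H)); last first.
    by apply/funext => y; rewrite !fctE /=; case: (G y) (H y) => ? ? [].
  rewrite (_ : re _ = (re (G x) *: re d + re (H x) *: re c) -
     (im (G x) *: im d + im (H x) *: im c)).
    by apply: is_deriveB; exact: is_deriveM.
  case: (G x) (H x) c d {Gr Gi Hr Hi} => a b [a' b'] [a1 b1] [a2 b2] /=.
  rewrite /GRing.scale /=; ring.
rewrite (_ : im \o _ = (re \o G) * (im \o H) + (im \o G) * (re \o H)); last first.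
  by apply/funext => y; rewrite !fctE /=; case: (G y) (H y) => ? ? [].
rewrite (_ : im _ = (re (G x) *: im d + im (H x) *: re c) +
   (im (G x) *: re d + re (H x) *: im c)).
  by apply: is_deriveD; exact: is_deriveM.
case: (G x) (H x) c d {Gr Gi Hr Hi} => a b [a' b'] [a1 b1] [a2 b2] /=.
rewrite /GRing.scale /=; ring.
Qed.

Lemma cder_sum (J : eqType) (l : seq J) (G : J -> U -> C) x v (c : J -> C) :
  (forall q, q \in l -> cder (G q) x v (c q)) ->
  cder (fun y => \sum_(q <- l) G q y) x v (\sum_(q <- l) c q).
Proof.
elim: l => [|q l IH] dG.
  by under eq_fun do rewrite big_nil; rewrite big_nil; exact: cder_cst.
under eq_fun do rewrite big_cons.
rewrite big_cons; apply: cderD; first by apply: dG; rewrite mem_head.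
by apply: IH => p pl; apply: dG; rewrite inE pl orbT.
Qed.

Lemma near_eq_cder G H x v c : (\forall y \near x, G y = H y) ->
  cder G x v c -> cder H x v c.
Proof.
move=> GH [Gr Gi]; split.
  by apply: near_eq_is_derive Gr; apply: filterS GH => y /= ->.
by apply: near_eq_is_derive Gi; apply: filterS GH => y /= ->.
Qed.

Lemma cdiff_cder G x v : cdiff_times 1 G x -> cder G x v (cdiff G x v).
Proof.
move=> [Gr Gi]; split; rewrite /cdiff /= -deriveE //.
  by apply: derivableP; apply: diff_derivable.
by apply: derivableP; apply: diff_derivable.
Qed.

End ComplexDerivative.

(** * Product rule for Frechet derivatives with moving base point and directions *)

Section FrechetDerivative.
Context {R : realType} {U : normedModType R} {m n : nat}.
Local Notation C := R[i].
Local Notation V := 'M[C]_(m, n).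
Variables (O : set V) (A : U -> V) (x v : U).
Hypotheses (oO : open O) (OAx : O (A x)).
Hypothesis dA : forall a b, cdiff_times 1 (fun y => A y a b) x.

(* The product rule: the derivative of frechet Phi (A y) [:: E_1 y; ...; E_i y]
   hits either the base point or one of the directions. *)
Lemma frechet_cder (T : eqType) (t0 : T) (E : T -> U -> V) (DE : T -> V) (s : seq T)
    (Phi : V -> C) : smooth_on O Phi ->
  (forall t, t \in s -> forall a b, cder (fun y => E t y a b) x v (DE t a b)) ->
  cder (fun y => frechet Phi (A y) [seq E t y | t <- s]) x v
    (frechet Phi (A x) (rcons [seq E t x | t <- s] (mx_cdiff A x v)) +
     \sum_(l <- iota 0 (size s))
        frechet Phi (A x) (set_nth 0 [seq E t x | t <- s] l (DE (nth t0 s l)))).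
Proof.
elim: s Phi => [|t s IH] Phi sPhi dE.
  rewrite big_nil addr0 /=.
  have [d1 d2] := cdiff_comp dA (smooth_on_diff sPhi OAx).
  by rewrite -d2; exact: cdiff_cder.
have nO : \forall y \near x, O (A y).
  exact: (mx_continuous dA) (open_nbhs_nbhs (conj oO OAx)).
(* The entries of the head direction become scalar factors; the induction hypothesis applies to the
   partial derivatives [P p] of [Phi], with the remaining directions. *)
pose P (p : 'I_m * 'I_n) := fun Y => 'd Phi Y (delta_mx p.1 p.2).
have sP p : smooth_on O (P p) by exact: smooth_on_d.
have IHp p := IH (P p) (sP p) (fun t' ts => dE t' (mem_behead (s := t :: s) ts)).
have cons_sum X L := @frechet_cons_sum _ _ _ _ O Phi (A x) X L oO sPhi OAx.
rewrite [size _]/= [iota _ _]/= big_cons -[iota 1 _]/(iota (1 + 0) _) iotaDl big_map.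
rewrite [map _ (_ :: _)]/= [rcons _ _]/= [set_nth _ _ 0 _]/=.
rewrite (cons_sum (DE t)) (cons_sum (E t x)).
under [X in _ + (_ + X)]eq_bigr => l _.
  rewrite add1n [set_nth _ _ _ _]/= [nth _ _ _]/= cons_sum.
  over.
rewrite exchange_big /= addrCA -big_split /= -big_split /=.
apply: (@near_eq_cder _ _ (fun y => \sum_(p <- index_enum ('I_m * 'I_n)%type)
    E t y p.1 p.2 * frechet (P p) (A y) [seq E t y | t <- s])); last first.
  apply: cder_sum => p _; rewrite -scaler_sumr -scalerDr.
  exact: cderM (dE t (mem_head t s) p.1 p.2) (IHp p).
apply: (@filterS _ (nbhs x) _ _ _ _ nO) => y Oy.
exact: (esym (@frechet_cons_sum _ _ _ _ O Phi (A y) (E t y) [seq E t y | t <- s] oO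
    sPhi Oy)).
Qed.

End FrechetDerivative.

Section ComplexPartial.
Context {R : realType} {j : nat}.
Local Notation C := R[i].
Local Notation U := 'rV[R]_j.
Local Notation re := (@complex.Re R).
Local Notation im := (@complex.Im R).
Implicit Types (alpha u : multi_index j) (G : U -> C) (x : U).

Definition cpderive alpha G x : C :=
  pderive alpha (re \o G) x +i* pderive alpha (im \o G) x.

Lemma cpderive_cder u i G x : zero_below u i -> cdiff_times (mi_deg u).+1 G x ->
  cder (cpderive u G) x (delta_mx 0 i) (cpderive (mi_add u (mi_unit i)) G x).
Proof.
move=> u0; rewrite -[(mi_deg u).+1]addn1 => -[Gr Gi].
split; rewrite /cpderive /= pderive_add_unit //.
  exact: derivableP (diff_derivable (diff_times_pderive Gr)).
exact: derivableP (diff_derivable (diff_times_pderive Gi)).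
Qed.

Lemma cdiff_times_near k G x : cdiff_times k.+1 G x ->
  \forall y \near x, cdiff_times k G y.
Proof.
move=> [/diff_times_near Gr /diff_times_near Gi].
by apply: filterS2 Gr Gi => y; split.
Qed.

Lemma mx_diff_times_near k n (A : U -> 'M[C]_n) x : mx_diff_times k.+1 A x ->
  \forall y \near x, mx_diff_times k A y.
Proof.
move=> dA; have H := @filter_forall _ ('I_n * 'I_n)%type
  (fun p y => cdiff_times k (fun y => A y p.1 p.2) y) (nbhs x) (nbhs_filter x)
  (fun p => cdiff_times_near (dA p.1 p.2)).
by apply: (@filterS _ (nbhs x) _ _ _ _ H) => y Hy a b; exact: (Hy (a, b)).
Qed.

End ComplexPartial.

(** * The partition formula for a scalar function of A(y) *)

Section ChainRule.
Context {R : realType} {j n : nat}.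
Local Notation C := R[i].
Local Notation U := 'rV[R]_j.
Local Notation V := 'M[C]_n.
Implicit Types (alpha u : multi_index j).
Variable (O : set V).
Hypothesis oO : open O.
Variables (A : U -> V) (Phi : V -> C).
Hypothesis sPhi : smooth_on O Phi.

Let term y s := frechet Phi (A y) [seq mx_pderive u A y | u <- s].

Lemma mx_cdiff_pderive x i : mx_diff_times 1 A x ->
  mx_cdiff A x (delta_mx 0 i) = mx_pderive (mi_unit i) A x.
Proof.
move=> dA; apply/matrixP => a b; rewrite !mxE.
have z0 : mi_deg ([ffun=> 0%N] : multi_index j) = 0%N.
  by rewrite /mi_deg big1 // => l _; rewrite ffunE.
have E : mi_add [ffun=> 0%N] (mi_unit i) = mi_unit i.
  by apply/ffunP => l; rewrite !ffunE.
have Z : zero_below [ffun=> 0%N] i by move=> l _; rewrite ffunE.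
have H := @cpderive_cder _ _ _ i (fun y => A y a b) x Z.
rewrite z0 E in H; have := cderE (H (dA a b)).
rewrite /cpderive !(pderive0 _ z0) => <-.
have [dr di] := dA a b.
by rewrite /cdiff !deriveE.
Qed.

(** The members of [s] have degree at most d + 1, so d + 2 derivatives of [A] leave room for one
    more on each of them. *)
Lemma term_cder y d i (s : seq (multi_index j)) : O (A y) -> mx_diff_times d.+2 A y ->
  (forall u, u \in s -> zero_below u i /\ (mi_deg u <= d.+1)%N) ->
  cder (fun y => term y s) y (delta_mx 0 i)
   (term y (rcons s (mi_unit i)) +
    \sum_(l <- iota 0 (size s))
      term y (set_nth (mi_unit i) s l (mi_add (nth (mi_unit i) s l) (mi_unit i)))).
Proof.
move=> OAy dA sP.
have dA1 : mx_diff_times 1 A y by move=> a b; exact: (cdiff_times_le _ (dA a b)).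
have H := @frechet_cder R U n n O A y (delta_mx 0 i) oO OAy dA1 _ (mi_unit i)
  (fun u y => mx_pderive u A y) (fun u => mx_pderive (mi_add u (mi_unit i)) A y) s
      Phi sPhi.
have dE u : u \in s -> forall a b, cder (fun y => mx_pderive u A y a b) y (delta_mx 0 i)
     (mx_pderive (mi_add u (mi_unit i)) A y a b).
  move=> /sP[u0 ud] a b; rewrite mxE.
  under eq_fun do rewrite mxE.
  apply: (@cpderive_cder _ _ u i (fun y => A y a b)) => //.
  exact: (cdiff_times_le _ (dA a b)).
have {H} := H dE; rewrite mx_cdiff_pderive // -map_rcons.
congr (cder _ _ _ (_ + _)); rewrite !big_seq; apply: eq_bigr => l.
rewrite mem_iota add0n => /andP[_ ls]; rewrite /term; congr (frechet _ _ _).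
by rewrite !set_nthE size_map ls map_cat map_take map_cons map_drop.
Qed.

(** Stated at a variable point, since the inductive step differentiates the formula for beta and
    thus needs it near [y]; there [A] is still differentiable one time less, by
    [mx_diff_times_near]. *)
Lemma chain_rule d alpha y : mi_deg alpha = d.+1 -> O (A y) ->
  mx_diff_times d.+1 A y ->
  cpderive alpha (Phi \o A) y =
  \sum_(1 <= i < d.+2) \sum_(s <- mi_partitions alpha i) term y s.
Proof.
elim: d alpha y => [|d IH] alpha y ad OAy dA.
  have [|i Ei [a0 ai]] := mi_first (alpha := alpha); first by rewrite ad.
  set beta := mi_sub alpha (mi_unit i).
  have b0 : mi_deg beta = 0%N by apply: succn_inj; rewrite -mi_deg_sub_unit.
  rewrite big_nat1 mi_partitions1 big_seq1 /term /=.
  have [d1 d2] := @cdiff_comp _ _ _ _ Phi A y dA (smooth_on_diff sPhi OAy).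
  have := @cpderive_cder _ _ beta i (Phi \o A) y (zero_below_sub a0).
  rewrite b0 mi_subK // => /(_ d1) /cderE <-.
  have au : alpha = mi_unit i.
    rewrite -(mi_subK ai); apply/ffunP => l; rewrite ffunE.
    by rewrite -/beta (mi_deg_eq0 l b0).
  rewrite au -mx_cdiff_pderive // -d2 /cpderive !(pderive0 _ b0).
  have [dr di] := d1.
  by rewrite /cdiff !deriveE.
have [|i Ei [a0 ai]] := mi_first (alpha := alpha); first by rewrite ad.
set gamma := mi_unit i; set beta := mi_sub alpha gamma.
have bd : mi_deg beta = d.+1 by apply: succn_inj; rewrite -mi_deg_sub_unit.
have b0 : zero_below beta i := zero_below_sub a0.
have dA1 : mx_diff_times 1 A y by move=> a b; exact: (cdiff_times_le _ (dA a b)).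
have sm k s : s \in mi_partitions beta k -> size s = k /\
    forall u, u \in s -> zero_below u i /\ (mi_deg u <= d.+1)%N.
  move=> /mi_partitions_recP[sk sb]; split=> // u us; split.
    by move=> l /b0 bl; apply/eqP; rewrite -leqn0 -bl; exact: sb us l.
  by rewrite -bd; apply: mi_deg_le; exact: sb us.
have dPA : cdiff_times d.+2 (Phi \o A) y by exact: (cdiff_times_comp oO sPhi OAy dA).
rewrite -bd in dPA; have D1 := cpderive_cder b0 dPA; rewrite mi_subK // in D1.
have nO : \forall y' \near y, O (A y').
  exact: (@mx_continuous _ _ _ _ A y dA1) (open_nbhs_nbhs (conj oO OAy)).
have nE : \forall y' \near y, cpderive beta (Phi \o A) y' =
    \sum_(k <- index_iota 1 d.+2) \sum_(s <- mi_partitions beta k) term y' s.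
  by apply: filterS2 nO (mx_diff_times_near dA) => y' Oy' dAy'; exact: IH.
have D2 := cder_sum (l := index_iota 1 d.+2) (fun k _ =>
  cder_sum (l := mi_partitions beta k) (fun s sk =>
    term_cder OAy dA (proj2 (sm k s sk)))).
rewrite -(cderE D1) (cderE (near_eq_cder (filterS (fun _ => @esym _ _ _) nE) D2)).
under eq_bigr do rewrite big_split /=.
rewrite big_split /=.
(* [a] collects the terms where the base point is differentiated, [b] those where a direction is. By
   the recursion for partitions, the terms of order k + 1 for [alpha] are [a k + b k.+1] when k is
   at least 1. *)
pose a k := \sum_(s <- mi_partitions beta k) term y (rcons s gamma).
pose b k := \sum_(s <- mi_partitions beta k) \sum_(l <- iota 0 k)
   term y (set_nth gamma s l (mi_add (nth gamma s l) gamma)).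
rewrite (_ : \sum_(k <- _) _ = \sum_(1 <= k < d.+2) a k) //.
rewrite [X in _ + X](_ : _ = \sum_(1 <= k < d.+2) b k); last first.
  apply: eq_bigr => k _; rewrite /b !big_seq; apply: eq_bigr => s /sm[-> _]; exact: erefl.
rewrite [in RHS]big_ltn // mi_partitions1 big_seq1.
rewrite [in RHS]big_add1 /= [in RHS](eq_big_nat _ _ (F2 := fun k => a k + b k.+1));
    last first.
  move=> k /andP[k1 kd]; rewrite -(prednK k1).
  rewrite (mi_partitionsS Ei) ?ad ?prednK // big_cat big_map big_flatten [X in _ X
      = _]big_map.
  congr (_ + _). apply: eq_bigr => s _. rewrite big_map; exact: erefl.
rewrite big_split /= addrCA; congr (_ + _).
(* No partition of [beta] has d + 2 members, so the last [b] vanishes; what remains at the lower end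
   is [b 1], the term of the partition of [alpha] into itself. *)
rewrite [in RHS]big_nat_recr //= [b d.+2]big1_seq ?addr0; last first.
  by move=> s; rewrite mi_partitions_gt // bd.
rewrite [in LHS]big_ltn // [in LHS]big_add1 /=; congr (_ + _).
by rewrite /b mi_partitions1 !big_seq1 /= mi_subK.
Qed.

End ChainRule.

Lemma cont_diff_C1 (R : realType) N (Omega : set R[i]) (f : R[i] -> R[i]) z :
  open Omega -> cont_diff_times_on N.+1 Omega f -> Omega z -> C1_at f z.
Proof.
move=> oO [fd fc] Oz; split.
  apply: (@filterS _ (nbhs z) _ _ _ _ (open_nbhs_nbhs (conj oO Oz))) => y Oy.
  exact: (fd 0%N y).
case: N fd fc => [|N] fd fc; first exact: fc.
have d1 := fd 1%N z isT Oz.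
by apply: differentiable_continuous; apply/derivable1_diffP.
Qed.

Theorem theorem3p3 (R : realType) (j k n m : nat)
    (j_gt0 : (0 < j)%N) (k_gt0 : (0 < k)%N)
    (n_gt0 : (0 < n)%N) (m_gt0 : (0 < m)%N)
    (Omega : set R[i]) (Omega_open : open Omega)
    (A : 'rV[R]_j -> 'M[R[i]]_n) (xbar : 'rV[R]_j)
    (A_diff : mx_diff_times k A xbar)
    (A_class : \forall x \near xbar, spectral_class Omega m (A x))
    (f : R[i] -> R[i])
    (f_diff : cont_diff_times_on (k.+1 * m).-1 Omega f)
    (alpha : multi_index j) (alpha_deg : (1 <= mi_deg alpha <= k)%N) :
  [/\ (* both sides of the formula are well defined *)
      mx_diff_times (mi_deg alpha) (fun x => matfun f (A x)) xbar,
      diff_times (mi_deg alpha) (@matfun R f n) (A xbar) &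
      mx_pderive alpha (fun x => matfun f (A x)) xbar =
      \sum_(1 <= i < (mi_deg alpha).+1)
        \sum_(s <- mi_partitions alpha i)
          frechet (@matfun R f n) (A xbar)
            [seq mx_pderive u A xbar | u <- s]].
Proof.
case: n n_gt0 A A_diff A_class => [//|n] _ A A_diff A_class.
have [AO _] := nbhs_singleton A_class.
have fC1 z : Omega z -> C1_at f z.
  (* As k and m are at least 1, (k + 1) m - 1 is at least 1, so f has a continuous first
     derivative. *)
  have [N NE] : exists N, (k.+1 * m).-1 = N.+1.
    by exists (k * m + m).-2; nia.
  by rewrite NE in f_diff; exact: cont_diff_C1 Omega_open f_diff.
have [ O [oO OA] sO] := matfun_entry_smooth Omega_open fC1 AO.
have smE a b : smooth_on O (fun X => matfun f X a b) by move=> l X; exact: sO.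
(* Smoothness passes from the entries to the matrix by expansion in matrix units. *)
have sM : smooth_on O (@matfun R f n.+1).
  move=> l X OX.
  rewrite (_ : @matfun R f n.+1 = fun X =>
    \sum_(p <- index_enum ('I_n.+1 * 'I_n.+1)%type) matfun f X p.1 p.2 *: delta_mx
        p.1 p.2).
    by apply: diff_times_sum => p _; apply: diff_timesZl; exact: smE.
  by apply/funext => Y; rewrite {1}(matrix_sum_delta (matfun f Y)) pair_bigA.
have [a0 ak] := andP alpha_deg.
have dA : mx_diff_times (mi_deg alpha) A xbar.
  by move=> a b; exact: (cdiff_times_le ak (A_diff a b)).
split; first by move=> a b; exact: (cdiff_times_comp oO (smE a b) OA dA).
  exact: sM.
apply/matrixP => a b; rewrite mxE summxE.
have ad := esym (prednK a0).
rewrite ad in dA *.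
apply: etrans (chain_rule oO (smE a b) ad OA dA) _.
apply: eq_bigr => i _; rewrite summxE; apply: eq_bigr => s _.
exact: (esym (@frechet_entry _ _ _ a b _ O _ _ _ oO sM (smE a b) OA)).
Qed.
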